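(* Let $K\subset\mathbb R^d\setminus\{0\}$ be compact. Write $\langle\cdot,\cdot\rangle$ for the duality pairing between $\mathcal P'(\Omega)$ and $\mathcal P(\Omega)$ and $B$ for the unit ball at the origin in $\mathbb C$. Assume that there are $\lambda_0,M>0$ such that for all $k\in K$ and $0\le\lambda<\lambda_0$ the resolvent $z\mapsto(H^{\mathrm{st}}_{k,\lambda}-z)^{-1}$, defined on $\Im z>0$ as a family of operators $\mathcal P(\Omega)\to\mathcal P'(\Omega)$, can be extended meromorphically to the complex ball $|z|\le\frac1M$ with a unique simple pole; that is, there exist continuous collections $\{z_{k,\lambda}\}_{k,\lambda}\subset\mathbb C$ and $\{\Psi^\pm_{k,\lambda}\}_{k,\lambda}\subset\mathcal P'(\Omega)$ such that for all $\phi,\phi'\in\mathcal P(\Omega)$ and $\Im z>0$, $$\big\langle\phi',(H^{\mathrm{st}}_{k,\lambda}-z)^{-1}\phi\big\rangle_{L^2(\Omega)}=\frac{\overline{\langle\Psi^+_{k,\lambda},\phi'\rangle}\,\langle\Psi^-_{k,\lambda},\phi\rangle}{z_{k,\lambda}-z}+\zeta^{\phi',\phi}_{k,\lambda}(z),$$ where $\zeta^{\phi',\phi}_{k,\lambda}$ is holomorphic on $\{z:\Im z>0\}\cup\frac1MB$ and depends continuously on $k,\lambda$. Assume further that for all $k\in K$ and $\phi,\phi'\in\mathcal P(\Omega)$ the map $$[0,\lambda_0)\to\mathbb C\times\mathcal P'(\Omega)\times\mathcal P'(\Omega)\times L^\infty_{\mathrm{loc}}(\tfrac1MB):\ \lambda\mapsto(z_{k,\lambda},\Psi^+_{k,\lambda},\Psi^-_{k,\lambda},\zeta^{\phi',\phi}_{k,\lambda})$$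 is of class $C^2$. Then, up to a gauge transformation (replacing $(\Psi^+_{k,\lambda},\Psi^-_{k,\lambda})$ by $(a_\lambda\Psi^+_{k,\lambda},\bar a_\lambda^{-1}\Psi^-_{k,\lambda})$ for some nonvanishing complex-valued function $\lambda\mapsto a_\lambda$), there hold as $\lambda\downarrow0$, for all $k\in K$, $$z_{k,\lambda}=\lambda^2(\beta_k-i\alpha_k)+o_k(\lambda^2),\qquad \Psi^\pm_{k,\lambda}=1+\lambda\Phi^{1,\pm}_k+\lambda^2\Phi^{2,\pm}_k+o_k(\lambda^2),$$ where $\alpha_k,\beta_k\in\mathbb R$ are given by $\alpha_k+i\beta_k=\lim_{\varepsilon\downarrow0}\frac1i\mathbb E[V(H^{\mathrm{st}}_{k,0}-i\varepsilon)^{-1}V]$, and where $\Phi^{1,\pm}_k=-(H^{\mathrm{st}}_{k,0}\mp i0)^{-1}V$ and $\Phi^{2,\pm}_k=(H^{\mathrm{st}}_{k,0}\mp i0)^{-1}\Pi V(H^{\mathrm{st}}_{k,0}\mp i0)^{-1}V$ are understood as the elements of $\mathcal P'(\Omega)$ defined by, for all $\phi\in\mathcal P(\Omega)$, $$\langle\Phi^{1,\pm}_k,\phi\rangle=-\lim_{\varepsilon\downarrow0}\mathbb E\big[V(H^{\mathrm{st}}_{k,0}\pm i\varepsilon)^{-1}\phi\big],$$ $$\langle\Phi^{2,\pm}_k,\phi\rangle=\lim_{\varepsilon\downarrow0}\mathbb E\big[V(H^{\mathrm{st}}_{k,0}\pm i\varepsilon)^{-1}V(H^{\mathrm{st}}_{k,0}\pm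 i\varepsilon)^{-1}\Pi\phi\big].$$
   Context: $(\Omega,\mathbb P)$ is a complete probability space with a measurable measure-preserving action $\tau=(\tau_x)_{x\in\mathbb R^d}$ of $(\mathbb R^d,+)$ ($\tau_x\tau_y=\tau_{x+y}$, jointly measurable). Random variables $\phi$ are identified with stationary random fields $\phi(x,\omega)=\phi(\tau_{-x}\omega)$. $V$ is a real-valued centered stationary random field with finite moments of all orders, for which the operators below are (essentially) self-adjoint. The inner product is $\langle\phi',\phi\rangle_{L^2(\Omega)}=\mathbb E[\overline{\phi'}\phi]$. The stationary gradient $\nabla^{\mathrm{st}}$ generates the unitary group $(T_x\phi)(\omega)=\phi(\tau_{-x}\omega)$ on $L^2(\Omega)$; $\triangle^{\mathrm{st}}=\nabla^{\mathrm{st}}\cdot\nabla^{\mathrm{st}}$; $H^{\mathrm{st}}_{k,0}=-\triangle^{\mathrm{st}}-2ik\cdot\nabla^{\mathrm{st}}$ and $H^{\mathrm{st}}_{k,\lambda}=H^{\mathrm{st}}_{k,0}+\lambda V$. $\mathcal P(\Omega)=\{\sum_{j=1}^na_j\prod_{l=1}^{m_j}V(x_{lj}):n\ge1,a_j\in\mathbb C,m_j\ge0,x_{lj}\in\mathbb R^d\}$ is the space of $V$-polynomials, dense in $L^2(\Omega)$, and $\mathcal P'(\Omega)$ is its dual space of (continuous) linear functionals with the weak-$*$ topology; $1\in\mathcal P'(\Omega)$ denotes the functional $\phi\mapsto\mathbb E[\phi]$. $\Pi:=\mathrm{Id}-\mathbb E$ is the orthogonal projection onto $L^2(\Omega)\ominus\mathbb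 C$. Expansions of $\Psi^\pm_{k,\lambda}$ are understood weakly, i.e. when tested with each $\phi\in\mathcal P(\Omega)$; the existence of the limits $\varepsilon\downarrow0$ is part of the statement.
   Formalization: One gauge a_λ cannot give both Ψ^± the λ² expansion on constants (the product of ⟨Ψ⁺,1⟩ conjugated and ⟨Ψ⁻,1⟩ is invariant); here, for each sign, a gauge (depending on k) gives it in full for that sign, and for the other to o(λ), and to o(λ²) on φ with E[φ]=0. *)

(* Defs.v *)
From HB Require Import structures.
From mathcomp Require Import all_boot all_order all_algebra.
From mathcomp Require Import all_classical all_reals all_analysis.
From mathcomp Require Import complex.
Set Implicit Arguments.
Unset Strict Implicit.
Unset Printing Implicit Defensive.
Import Order.TTheory GRing.Theory Num.Theory numFieldNormedType.Exports.
Local Open Scope classical_set_scope.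
Local Open Scope ring_scope.

(* R[i] carries no topology of its own; as the regular module over itself it
   has the one given by the complex modulus, and [derivable f z 1] for
   f : Cplx R -> Cplx R is complex differentiability at z. *)
Notation Cplx R := (R[i]^o).

Section RandomVariables.
Context {disp : measure_display} {Om : measurableType disp} {R : realType}.
Variable P : probability Om R.
Implicit Types f g : Om -> Cplx R.

Definition Expect f : Cplx R :=
  ((\int[P]_(w in setT) complex.Re (f w))%R +i* (\int[P]_(w in setT) complex.Im (f w))%R)%C.

Definition inner f g : Cplx R := Expect (fun w => (conjc (f w) : Cplx R) * g w).

Definition sqnorm f : \bar R :=
  (\int[P]_w ((complex.Re (f w)) ^+ 2 + (complex.Im (f w)) ^+ 2)%:E)%E.

(* Elements of L^2 are represented by functions; all notions below are
   insensitive to modification on a null set. *)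
Definition L2 f : Prop :=
  [/\ measurable_fun setT (fun w => complex.Re (f w)),
      measurable_fun setT (fun w => complex.Im (f w)) & (sqnorm f < +oo)%E].

Definition Proj f : Om -> Cplx R := fun w => f w - Expect f.

(* An unbounded operator is given by its graph, a set of pairs (u, A u). *)
Definition op_graph := set ((Om -> Cplx R) * (Om -> Cplx R)).
Implicit Types G : op_graph.

Definition op_closure G : op_graph := [set p | [/\ L2 p.1, L2 p.2 &
  forall e : R, 0 < e -> exists q, [/\ G q,
    (sqnorm (fun w => p.1 w - q.1 w)%R < e%:E)%E &
    (sqnorm (fun w => p.2 w - q.2 w)%R < e%:E)%E]]].

Definition op_adjoint G : op_graph := [set p | [/\ L2 p.1, L2 p.2 &
  forall q, G q -> inner p.1 q.2 = inner p.2 q.1]].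

Definition dense_in_L2 (D : set (Om -> Cplx R)) : Prop :=
  forall f, L2 f -> forall e : R, 0 < e ->
  exists g, [/\ D g, L2 g & (sqnorm (fun w => f w - g w)%R < e%:E)%E].

Definition op_selfadjoint G : Prop :=
  dense_in_L2 [set u | exists v, G (u, v)] /\ G = op_adjoint G.

Definition op_ess_selfadjoint G : Prop :=
  dense_in_L2 [set u | exists v, G (u, v)] /\ op_selfadjoint (op_closure G).

(* (A - z)^-1 f for the closure A of G: some u in the domain of A with
   A u = f + z u (0 if there is none); it is unique up to null sets when A is
   self-adjoint and Im z <> 0. *)
Definition op_resolvent G (z : Cplx R) f : Om -> Cplx R :=
  xget (fun=> 0) [set u | op_closure G (u, fun w => f w + z * u w)].

End RandomVariables.

Section StationaryOperators.
Context {disp : measure_display} {Om : measurableType disp} {R : realType}.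
Variables (P : probability Om R) (d : nat).
Variable tau : 'rV[R]_d -> Om -> Om.
Variable V : Om -> R.
Implicit Types (k x : 'rV[R]_d) (u f g : Om -> Cplx R).

Definition preserving_action : Prop :=
  [/\ forall w, tau 0 w = w,
      forall x y w, tau x (tau y w) = tau (x + y) w,
      forall x, measurable_fun setT (tau x) &
      forall x A, measurable A -> P (tau x @^-1` A) = P A].

(* Null sets of (Lebesgue measure on R^d) x P, via coverings by boxes. *)
Definition prod_null (N : set (d.-tuple R * Om)) : Prop :=
  forall e : R, 0 < e ->
  exists (a b : nat -> d.-tuple R) (A : nat -> set Om),
    [/\ forall n i, tnth (a n) i <= tnth (b n) i,
        forall n, measurable (A n),
        N `<=` \bigcup_n [set p |
           (forall i, tnth (a n) i <= tnth p.1 i <= tnth (b n) i) /\ A n p.2] &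
        (\sum_(0 <= n <oo)
           ((\prod_(i < d) (tnth (b n) i - tnth (a n) i))%:E * P (A n))
         <= e%:E)%E].

(* Joint measurability of (x, w) |-> tau_x w. As the sigma-algebra of Om is
   P-complete, the sigma-algebra on R^d x Om has to be the completion of the
   product one: already for translations on a torus with the Lebesgue
   sigma-algebra, the preimages of null sets are in general not measurable for
   the uncompleted product. *)
Definition jointly_measurable : Prop :=
  forall A : set Om, measurable A ->
  exists B : set (d.-tuple R * Om), measurable B /\
    prod_null
      [set p | ~ (B p <-> A (tau (\row_(i < d) tnth p.1 i) p.2))].

Definition transl x (T : Type) (f : Om -> T) : Om -> T := fun w => f (tau (- x) w).

(* u is in the domain of the j-th component of the stationary gradient (the
   strong L^2-generator of the translations along e_j), with value g. *)
Definition is_grad (j : 'I_d) u g : Prop :=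
  [/\ L2 P u, L2 P g &
   sqnorm P (fun w =>
       (h^-1)%:C%C * (transl (h *: delta_mx 0 j) u w - u w) - g w)
     @[h --> (0 : R)^'] --> 0%E].

(* -Lap - 2i k.grad + lam V, on all u of class H^2 such that lam V u is in
   L^2; the self-adjoint operator is the closure of this one. *)
Definition Hst k (lam : R) : @op_graph _ Om R := [set p |
  L2 P p.1 /\ L2 P p.2 /\
  L2 P (fun w => lam%:C%C * (V w)%:C%C * p.1 w) /\
  exists g l : 'I_d -> Om -> Cplx R,
    [/\ forall j, is_grad j p.1 (g j),
        forall j, is_grad j (g j) (l j) &
        ae_eq P setT p.2 (fun w =>
          - (\sum_(j < d) l j w)
          - 2%:R * 'i%C * (\sum_(j < d) (k 0 j)%:C%C * g j w)
          + lam%:C%C * (V w)%:C%C * p.1 w)]].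

Definition resolvent k lam (z : Cplx R) f : Om -> Cplx R :=
  op_resolvent P (Hst k lam) z f.

(* Multiplication by V. *)
Definition mulV f : Om -> Cplx R := fun w => (V w)%:C%C * f w.

Definition Vpoly : set (Om -> Cplx R) := [set f |
  exists (n : nat) (a : 'I_n.+1 -> Cplx R) (m : 'I_n.+1 -> nat)
         (x : 'I_n.+1 -> nat -> 'rV[R]_d),
    f = fun w => \sum_(j < n.+1) a j *
          (\prod_(l < m j) (transl (x j l) V w)%:C%C)].

(* The dual P'(Om): linear functionals on V-polynomials, seen as random
   variables up to null sets. Values outside Vpoly are irrelevant. *)
Definition Vdual (psi : (Om -> Cplx R) -> Cplx R) : Prop :=
  (forall (a : Cplx R) f g, Vpoly f -> Vpoly g ->
     psi (fun w => a * f w + g w) = a * psi f + psi g) /\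
  (forall f g, Vpoly f -> Vpoly g -> ae_eq P setT f g -> psi f = psi g).

End StationaryOperators.

Section C2.
Context {R : realType} {U : choiceType}.
Variables (fam : set (set U)) (l0 : R).
Implicit Types f g : R -> U -> Cplx R.

(* Functions on U carry the topology of uniform convergence on the members of
   fam; derivatives on [0, l0) are one-sided at 0. *)
Definition has_deriv_in f g : Prop :=
  forall l, 0 <= l < l0 ->
  {family fam,
    (fun u : U => ((h^-1)%:C%C * (f (l + h) u - f l u) : Cplx R))
      @[h --> within [set h | 0 <= l + h < l0] (0 : R)^'] --> g l}.

Definition cont_in f : Prop :=
  forall l, 0 <= l < l0 ->
  {family fam, f m @[m --> within [set m | 0 <= m < l0] (nbhs l)] --> f l}.

Definition C2_in f : Prop :=
  exists f1 f2, [/\ has_deriv_in f f1, has_deriv_in f1 f2 & cont_in f2].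

End C2.

Definition C2_scalar {R : realType} (l0 : R) (f : R -> Cplx R) : Prop :=
  C2_in [set [set: unit]] l0 (fun l (_ : unit) => f l).

(* Uniform convergence on compact subsets of the open disc |z| < 1/M: the
   L^oo_loc topology for functions that are continuous there. *)
Definition disc {R : realType} (M : R) : set (Cplx R) :=
  [set z | `|z| < (M^-1)%:C%C].

Definition compacts_of_disc {R : realType} (M : R) : set (set (Cplx R)) :=
  [set A | compact A /\ A `<=` disc M].

(* Sign +/-: true is +, false is -. *)
Definition pm {R : realType} (s : bool) : Cplx R := if s then 1 else -1.

(* The family (a Psi^+, conj(a)^-1 Psi^-). Gauge transformations preserve
   conj(Psi^+(1)) * Psi^-(1), a quantity equal to 1 - c lam^2 + o(lam^2), where
   c is the z-derivative of E[V (H_{k,0} - z)^-1 V] at z = 0 and is nonzero in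
   general. So one gauge cannot give both Psi^+(1) and Psi^-(1) the value
   1 + o(lam^2): the gauge in an order lam^2 expansion depends on the sign. *)
Definition gauge {R : realType} {T : Type} (a : Cplx R) (s : bool)
    (psi : T -> Cplx R) : T -> Cplx R :=
  fun phi => (if s then a else (conjc a : Cplx R)^-1) * psi phi.

(* r(l) = o(l^n) as l decreases to 0. *)
Definition littleo_pow {R : realType} (n : nat) (r : R -> Cplx R) : Prop :=
  ((l ^+ n)^-1)%:C%C * r l @[l --> (0 : R)^'+] --> (0 : Cplx R).

(* Main.v *)
Require Import Defs.
From HB Require Import structures.
From mathcomp Require Import all_boot all_order all_algebra.
From mathcomp Require Import all_classical all_reals all_analysis.
From mathcomp Require Import measurable_realfun complex.
From mathcomp Require Import ring lra.
Set Implicit Arguments.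
Unset Strict Implicit.
Unset Printing Implicit Defensive.
Import Order.TTheory GRing.Theory Num.Theory numFieldNormedType.Exports.
Local Open Scope classical_set_scope.
Local Open Scope ring_scope.

(* The constant 1 is mapped to lam V by H_lam, so that, R denoting the resolvent,
     lam <V, R(z) phi> = E[phi] + z <1, R(z) phi>,
   and similarly with the roles of bra and ket exchanged. Inserting the
   meromorphic representation, removing <Psi^+, V> with the limit z -> 0 along
   the positive imaginary axis, expanding in lam at fixed z and only then letting
   z -> 0, one obtains
     conj<Psi^+, 1> <Psi^-, phi> = E[phi] - lam zeta_0(0) - lam^2 zeta_0'(0) + o(lam^2)
   with zeta = zeta^{V,phi} and ' the derivative in lam. Here zeta_0(z) is
   <V, R_0(z) phi>, and by the second resolvent identity zeta_0'(z) is
   -<R_0(conj z) V, V R_0(z) phi> if E[phi] = 0, which identifies Phi^1 and Phi^2.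
   The gauge is the choice of how the factor conj<Psi^+, 1> <Psi^-, 1> is split.

   The second resolvent identity needs V R_0(z) phi in L^2, although V is
   unbounded. For F(u) = u min(|u|^(1/n), N), the pairing of F(u) with
   (-i grad + k)^2 u lies in the sector |Im| <= Re / n: by translation invariance
   this reduces to a pointwise inequality for difference quotients twisted by a
   phase. For n large depending on Im z, this bounds the norm of R_0(z) phi in
   L^(2+1/n) uniformly in N, and V has all moments. *)

(** * Complex numbers by real and imaginary parts *)

(** The pole tends to 0 as the coupling constant does, so the resolvent is not controlled near z = 0
    uniformly in lam; only the remainder zeta is. The limits in eps are therefore not obtained by
    spectral analysis: they are values at z = 0 of zeta and of its lam-derivative, which are
    continuous along the imaginary axis because difference quotients in lam converge uniformly on
    compact sets of z. For zeta to be computable from free resolvents, the pole term must drop out.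
    At lam = 0 it does since V is centered. For the first derivative, both factors of the pole term
    have to vanish at lam = 0, which requires E[phi] = 0; this is the origin of the projection in
    Phi^2. The constant component of phi is carried separately by the product conj<Psi^+, 1> <Psi^-,
    1>, whose second-order coefficient the gauge can absorb for one sign at a time. In the sector
    estimate the nonlinear function F(u) need not have weak derivatives that are at hand. This is
    why F is truncated so as to be Lipschitz, and why second derivatives are moved onto F(u) only as
    difference quotients. *)

Section ComplexModulus.
Variable R : realType.
Implicit Types z w : R[i].

Lemma ReM z w : complex.Re (z * w) =
  complex.Re z * complex.Re w - complex.Im z * complex.Im w.
Proof. by case: z => a b; case: w. Qed.

Lemma ImM z w : complex.Im (z * w) =
  complex.Re z * complex.Im w + complex.Im z * complex.Re w.
Proof. by case: z => a b; case: w. Qed.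

Lemma Re_conjc z : complex.Re (conjc z) = complex.Re z.
Proof. by case: z. Qed.

Lemma Im_conjc z : complex.Im (conjc z) = - complex.Im z.
Proof. by case: z. Qed.

Lemma complex_eq z w :
  complex.Re z = complex.Re w -> complex.Im z = complex.Im w -> z = w.
Proof. by case: z => a b; case: w => c e /= -> ->. Qed.

Lemma ReD z w : complex.Re (z + w) = complex.Re z + complex.Re w.
Proof. by case: z; case: w. Qed.

Lemma ImD z w : complex.Im (z + w) = complex.Im z + complex.Im w.
Proof. by case: z; case: w. Qed.

Lemma ReN z : complex.Re (- z) = - complex.Re z.
Proof. by case: z. Qed.

Lemma ImN z : complex.Im (- z) = - complex.Im z.
Proof. by case: z. Qed.

Lemma conjcM z w : conjc (z * w) = conjc z * conjc w.
Proof. by case: z; case: w => a b c e; apply: complex_eq => /=; ring. Qed.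

Lemma ReC (x : R) : complex.Re x%:C%C = x. Proof. by []. Qed.
Lemma ImC (x : R) : complex.Im x%:C%C = 0. Proof. by []. Qed.
Lemma Rei : complex.Re ('i%C : R[i]) = 0. Proof. by []. Qed.
Lemma Imi : complex.Im ('i%C : R[i]) = 1. Proof. by []. Qed.
Lemma Re1 : complex.Re (1 : R[i]) = 1. Proof. by []. Qed.
Lemma Im1 : complex.Im (1 : R[i]) = 0. Proof. by []. Qed.
Lemma Re0 : complex.Re (0 : R[i]) = 0. Proof. by []. Qed.
Lemma Im0 : complex.Im (0 : R[i]) = 0. Proof. by []. Qed.

(** Together with [complex_eq], this reduces an identity with conjugates to two polynomial
    identities between real and imaginary parts. *)
Definition reimE := (ReM, ImM, ReD, ImD, ReN, ImN, Re_conjc, Im_conjc,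
  Rei, Imi, Re1, Im1, Re0, Im0, ReC, ImC).

Definition sqn z : R := complex.Re z ^+ 2 + complex.Im z ^+ 2.

(** The norm of [R[i]] takes its values in [R[i]]; this real-valued modulus keeps all estimates
    inside the ordered field [R]. *)
Definition nrm z : R := Num.sqrt (sqn z).

Lemma sqn_ge0 z : 0 <= sqn z.
Proof. by rewrite addr_ge0 ?sqr_ge0. Qed.

Lemma sqr_nrm z : nrm z ^+ 2 = sqn z.
Proof. by rewrite sqr_sqrtr ?sqn_ge0. Qed.

Lemma nrm_ge0 z : 0 <= nrm z.
Proof. exact: sqrtr_ge0. Qed.

Lemma nrmE z : `|z| = (nrm z)%:C%C.
Proof. by rewrite normc_def. Qed.

Lemma nrm0 : nrm 0 = 0.
Proof. by apply: complexI; rewrite -nrmE normr0. Qed.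

Lemma nrmM z w : nrm (z * w) = nrm z * nrm w.
Proof. by apply: complexI; rewrite rmorphM /= -!nrmE normrM. Qed.

Lemma nrmD z w : nrm (z + w) <= nrm z + nrm w.
Proof. by rewrite -lecR rmorphD /= -!nrmE ler_normD. Qed.

Lemma nrmN z : nrm (- z) = nrm z.
Proof. by apply: complexI; rewrite -!nrmE normrN. Qed.

Lemma nrmB z w : nrm (z - w) <= nrm z + nrm w.
Proof. by rewrite (le_trans (nrmD _ _))// nrmN. Qed.

Lemma nrm_eq0 z : nrm z = 0 -> z = 0.
Proof. by move=> h; apply/eqP; rewrite -normr_eq0 nrmE h. Qed.

Lemma nrmJ z : nrm (conjc z) = nrm z.
Proof. by rewrite /nrm /sqn !reimE sqrrN. Qed.

Lemma nrmR (x : R) : nrm x%:C%C = `|x|.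
Proof. by rewrite /nrm /sqn /= expr0n /= addr0 sqrtr_sqr. Qed.

Lemma nrm1 : nrm 1 = 1.
Proof. by have := nrmR 1; rewrite normr1. Qed.

Lemma normRe_le z : `|complex.Re z| <= nrm z.
Proof.
by rewrite -sqrtr_sqr ler_wsqrtr // /sqn lerDl sqr_ge0.
Qed.

Lemma normIm_le z : `|complex.Im z| <= nrm z.
Proof.
by rewrite -sqrtr_sqr ler_wsqrtr // /sqn lerDr sqr_ge0.
Qed.

Lemma nrm_le_ReIm z : nrm z <= `|complex.Re z| + `|complex.Im z|.
Proof.
rewrite -[leRHS]ger0_norm ?addr_ge0// -sqrtr_sqr ler_wsqrtr //.
rewrite sqrrD !real_normK ?num_real// /sqn; rewrite -addrA lerD2l lerDr.
by rewrite mulrn_wge0 // mulr_ge0.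
Qed.

Lemma nrmV z : nrm z^-1 = (nrm z)^-1.
Proof. by apply: complexI; rewrite fmorphV /= -!nrmE normfV. Qed.

Lemma mulJE z : conjc z * z = (sqn z)%:C%C.
Proof. by apply: complex_eq; rewrite !reimE /sqn; ring. Qed.

End ComplexModulus.

(** * Self-adjoint graphs in a complete semi-inner product space *)

Section SemiHilbert.
Variables (R : realType) (E : lmodType R[i]).

(** Vectors are functions rather than classes modulo null sets, so the form may vanish on nonzero
    vectors and limits are unique only up to vectors of norm 0. The predicate [L] stands for the
    square-integrable functions inside the module of all functions. *)
Record semi_hilbert (L : E -> Prop) (ip : E -> E -> R[i]) : Prop := SemiHilbert {
  sh0 : L 0;
  sh_lin : forall a u v, L u -> L v -> L (a *: u + v);
  sh_ipl : forall a u v w, L u -> L v -> L w ->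
    ip w (a *: u + v) = a * ip w u + ip w v;
  sh_ipC : forall u v, L u -> L v -> ip v u = conjc (ip u v);
  sh_ge0 : forall u, L u -> 0 <= complex.Re (ip u u);
  sh_complete : forall u : nat -> E, (forall n, L (u n)) ->
    (forall e : R, 0 < e -> exists N, forall m n, (N <= m)%N -> (N <= n)%N ->
       complex.Re (ip (u m - u n) (u m - u n)) < e) ->
    exists2 v, L v & forall e : R, 0 < e -> exists N, forall n, (N <= n)%N ->
       complex.Re (ip (u n - v) (u n - v)) < e }.

Variables (L : E -> Prop) (ip : E -> E -> R[i]).
Hypothesis H : semi_hilbert L ip.
Implicit Types u v w : E.

Let n2 u := complex.Re (ip u u).
Definition hnorm u : R := Num.sqrt (n2 u).

Lemma shD u v : L u -> L v -> L (u + v).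
Proof. by move=> Lu Lv; rewrite -[u]scale1r; exact: (sh_lin H). Qed.

Lemma shZ a u : L u -> L (a *: u).
Proof. by move=> Lu; rewrite -[_ *: _]addr0; apply: (sh_lin H) => //; exact: (sh0 H). Qed.

Lemma shN u : L u -> L (- u).
Proof. by rewrite -scaleN1r; exact: shZ. Qed.

Lemma shB u v : L u -> L v -> L (u - v).
Proof. by move=> Lu Lv; apply: shD => //; exact: shN. Qed.

Lemma ipDr w u v : L w -> L u -> L v -> ip w (u + v) = ip w u + ip w v.
Proof. by move=> *; rewrite -{1}[u]scale1r (sh_ipl H)// mul1r. Qed.

Lemma ip0r w : L w -> ip w 0 = 0.
Proof.
move=> Lw; have L0 := sh0 H.
have := ipDr Lw L0 L0; rewrite addr0 => /eqP.
by rewrite -subr_eq0 opprD addrA subrr sub0r oppr_eq0 => /eqP.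
Qed.

Lemma ipZr a w u : L w -> L u -> ip w (a *: u) = a * ip w u.
Proof.
by move=> Lw Lu; have L0 := sh0 H; rewrite -[_ *: _]addr0 (sh_ipl H)// ip0r// addr0.
Qed.

Lemma ipNr w u : L w -> L u -> ip w (- u) = - ip w u.
Proof. by move=> *; rewrite -scaleN1r ipZr// mulN1r. Qed.

Lemma ipBr w u v : L w -> L u -> L v -> ip w (u - v) = ip w u - ip w v.
Proof. by move=> Lw Lu Lv; have Lnv := shN Lv; rewrite ipDr ?ipNr//. Qed.

Lemma ipDl w u v : L w -> L u -> L v -> ip (u + v) w = ip u w + ip v w.
Proof.
move=> Lw Lu Lv; rewrite (sh_ipC H Lw (shD Lu Lv)) ipDr// rmorphD/=.
by rewrite -!(sh_ipC H).
Qed.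

Lemma ipZl a w u : L w -> L u -> ip (a *: u) w = conjc a * ip u w.
Proof.
move=> Lw Lu; rewrite (sh_ipC H Lw (shZ a Lu)) ipZr// rmorphM/=.
by rewrite -!(sh_ipC H).
Qed.

Lemma ipNl w u : L w -> L u -> ip (- u) w = - ip u w.
Proof. by move=> *; rewrite -scaleN1r ipZl// rmorphN1 mulN1r. Qed.

Lemma ipBl w u v : L w -> L u -> L v -> ip (u - v) w = ip u w - ip v w.
Proof. by move=> Lw Lu Lv; have Lnv := shN Lv; rewrite ipDl ?ipNl//. Qed.

Lemma ipE u : L u -> ip u u = (n2 u)%:C%C.
Proof.
move=> Lu; apply: complex_eq => //=.
have := congr1 (@complex.Im R) (sh_ipC H Lu Lu).
by rewrite Im_conjc; lra.
Qed.

Lemma sqr_hnorm u : L u -> hnorm u ^+ 2 = n2 u.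
Proof. by move=> Lu; rewrite sqr_sqrtr// (sh_ge0 H). Qed.

Lemma hnorm_ge0 u : 0 <= hnorm u. Proof. exact: sqrtr_ge0. Qed.

Lemma n2Z a u : L u -> n2 (a *: u) = sqn a * n2 u.
Proof.
by move=> Lu; rewrite /n2 ipZl ?ipZr ?ipE//; [rewrite !reimE /sqn; ring|exact: shZ].
Qed.

Lemma hnormZ a u : L u -> hnorm (a *: u) = nrm a * hnorm u.
Proof. by move=> Lu; rewrite /hnorm n2Z// sqrtrM// sqn_ge0. Qed.

Lemma hnormN u : L u -> hnorm (- u) = hnorm u.
Proof. by move=> Lu; rewrite -scaleN1r hnormZ// nrmN nrm1 mul1r. Qed.

Lemma hnormBC u v : L u -> L v -> hnorm (u - v) = hnorm (v - u).
Proof. by move=> Lu Lv; rewrite -hnormN ?opprB//; exact: shB. Qed.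

Lemma n2D u v : L u -> L v ->
  n2 (u + v) = n2 u + n2 v + 2 * complex.Re (ip u v).
Proof.
move=> Lu Lv; rewrite /n2 ipDl ?ipDr//; last exact: shD.
by rewrite (sh_ipC H Lu Lv) !reimE; ring.
Qed.

Lemma n2B u v : L u -> L v ->
  n2 (u - v) = n2 u + n2 v - 2 * complex.Re (ip u v).
Proof.
move=> Lu Lv; rewrite n2D//; last exact: shN.
by rewrite ipNr// -[- v]scaleN1r n2Z// /sqn !reimE; ring.
Qed.

(** Expand the squared norm of [u - t conj(p) v]: the factor [conj p] makes the cross term real. The
    value [t = 1 / n2 v] is optimal; if [n2 v = 0], the expression is affine in [t] and would become
    negative for large [t] unless [p = 0]. *)
Lemma cauchy_schwarz_sqr u v : L u -> L v -> sqn (ip u v) <= n2 u * n2 v.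
Proof.
move=> Lu Lv; set p := ip u v.
have key (t : R) : 0 <= n2 u - 2 * t * sqn p + t ^+ 2 * sqn p * n2 v.
  have := sh_ge0 H (shB Lu (shZ (t%:C%C * conjc p) Lv)).
  rewrite -/(n2 _) n2B//; last exact: shZ.
  rewrite n2Z// ipZr// -/p => /le_trans; apply; rewrite le_eqVlt; apply/orP; left.
  by apply/eqP; rewrite /sqn !reimE; ring.
have [v0|v0] := ltP 0 (n2 v).
  have := key (n2 v)^-1.
  have -> : n2 u - 2 * (n2 v)^-1 * sqn p + (n2 v)^-1 ^+ 2 * sqn p * n2 v
     = n2 u - sqn p / n2 v by field; rewrite gt_eqF.
  by rewrite subr_ge0 ler_pdivrMr.
have {}v0 : n2 v = 0 by apply/eqP; rewrite eq_le v0 (sh_ge0 H).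
rewrite v0 mulr0; rewrite leNgt; apply/negP => p0.
have := key ((n2 u + 1) / (2 * sqn p)).
rewrite v0 mulr0 addr0.
have -> : n2 u - 2 * ((n2 u + 1) / (2 * sqn p)) * sqn p = -1.
  by field; rewrite gt_eqF.
by rewrite lerNr oppr0 leNgt ltr01.
Qed.

Lemma cauchy_schwarz u v : L u -> L v -> nrm (ip u v) <= hnorm u * hnorm v.
Proof.
move=> Lu Lv; rewrite /nrm /hnorm -sqrtrM ?(sh_ge0 H)//.
by rewrite ler_wsqrtr// cauchy_schwarz_sqr.
Qed.

Lemma hnormD u v : L u -> L v -> hnorm (u + v) <= hnorm u + hnorm v.
Proof.
move=> Lu Lv; have := cauchy_schwarz Lu Lv => cs.
rewrite -[leRHS]ger0_norm ?addr_ge0 ?hnorm_ge0// -sqrtr_sqr ler_wsqrtr//.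
rewrite n2D// sqrrD !sqr_hnorm//.
have := le_trans (ler_norm _) (le_trans (normRe_le _) cs); lra.
Qed.

Lemma parallelogram u v : L u -> L v ->
  n2 (u - v) = 2 * n2 u + 2 * n2 v - n2 (u + v).
Proof. by move=> Lu Lv; rewrite n2B// n2D//; ring. Qed.

Lemma ip_hnorm0 u v : L u -> L v -> hnorm v = 0 -> ip u v = 0.
Proof.
move=> Lu Lv v0; apply: nrm_eq0; apply/eqP; rewrite eq_le nrm_ge0 andbT.
by rewrite (le_trans (cauchy_schwarz Lu Lv))// v0 mulr0.
Qed.

Lemma hnorm_n2_lt u e : L u -> 0 < e -> (hnorm u < e) = (n2 u < e ^+ 2).
Proof.
move=> Lu e0; rewrite -sqr_hnorm// ltr_pXn2r// ?nnegrE ?hnorm_ge0//.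
exact: ltW.
Qed.

Lemma sh_complete_norm (u : nat -> E) : (forall n, L (u n)) ->
  (forall e : R, 0 < e -> exists N, forall m n, (N <= m)%N -> (N <= n)%N ->
       hnorm (u m - u n) < e) ->
  exists2 v, L v & forall e : R, 0 < e -> exists N, forall n, (N <= n)%N ->
       hnorm (u n - v) < e.
Proof.
move=> Lu cu; have [//| |v Lv vP] := sh_complete H (u := u).
- move=> e e0; have se : 0 < Num.sqrt e by rewrite sqrtr_gt0.
  have [N NP] := cu _ se; exists N => m n Nm Nn.
  have := NP _ _ Nm Nn; rewrite hnorm_n2_lt//; last exact: shB.
  by rewrite sqr_sqrtr// ltW.
- exists v => // e e0; have [N NP] := vP _ (exprn_gt0 2 e0).
  exists N => n Nn; rewrite hnorm_n2_lt//; last exact: shB.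
  exact: NP.
Qed.

Section SelfAdjoint.
Variable G : E -> E -> Prop.
(** Self-adjointness in the form of a graph equal to its own adjoint graph; linearity and closedness
    of [G] are consequences. *)
Hypothesis GE : forall u v, G u v <-> [/\ L u, L v &
  forall a b, G a b -> ip u b = ip v a].

Lemma G_lin a u v u' v' : G u v -> G u' v' -> G (a *: u + u') (a *: v + v').
Proof.
move=> /GE[Lu Lv Hu] /GE[Lu' Lv' Hu']; apply/GE; split; try exact: (sh_lin H).
move=> b c bc; have /GE[Lb Lc _] := bc.
rewrite !ipDl//; try exact: shZ.
by rewrite !ipZl// (Hu _ _ bc) (Hu' _ _ bc).
Qed.

Lemma G0 : G 0 0.
Proof.
apply/GE; split; try exact: (sh0 H).
move=> b c bc; have /GE[Lb Lc _] := bc.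
by rewrite (sh_ipC H Lc (sh0 H)) (sh_ipC H Lb (sh0 H)) !ip0r.
Qed.

Lemma G_sym u v u' v' : G u v -> G u' v' -> ip u v' = ip v u'.
Proof. by move=> /GE[_ _ Hu] /Hu. Qed.

(** By symmetry [ip u v] is real, so only the term with [z] contributes to the imaginary part of
    [ip u (v - z u)], and Cauchy-Schwarz bounds that imaginary part. *)
Lemma shift_norm_ge (z : R[i]) u v : G u v ->
  `|complex.Im z| * hnorm u <= hnorm (v - z *: u).
Proof.
move=> Guv; have /GE[Lu Lv _] := Guv.
have Lw : L (v - z *: u) by apply: shB => //; exact: shZ.
have im0 : complex.Im (ip u v) = 0.
  have := G_sym Guv Guv; rewrite (sh_ipC H Lu Lv) => h.
  by have := congr1 (@complex.Im R) h; rewrite Im_conjc; lra.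
have [u0|u0] := ltP 0 (hnorm u); last first.
  by rewrite (le_trans _ (hnorm_ge0 _))// mulr_ge0_le0.
rewrite -(ler_pM2r u0) [leRHS]mulrC -mulrA -expr2 sqr_hnorm//.
apply: le_trans (cauchy_schwarz Lu Lw).
apply: le_trans (normIm_le _).
rewrite ipBr//; last exact: shZ.
rewrite ipZr// ipE// !reimE im0 mulr0 !add0r normrN normrM.
by rewrite [`|n2 u|]ger0_norm// (sh_ge0 H).
Qed.

Lemma resolvent_norm_le (z : R[i]) f u : G u (f + z *: u) ->
  `|complex.Im z| * hnorm u <= hnorm f.
Proof. by move=> /(shift_norm_ge z); rewrite addrK. Qed.

Lemma resolvent_adjoint (z : R[i]) f g u v : L f -> L g ->
  G u (f + z *: u) -> G v (g + conjc z *: v) -> ip g u = ip v f.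
Proof.
move=> Lf Lg Gu Gv; have /GE[Lu _ _] := Gu; have /GE[Lv _ _] := Gv.
have Lzu := shZ z Lu; have Lzv := shZ (conjc z) Lv.
have := G_sym Gv Gu.
rewrite ipDr// ipDl// ipZr// ipZl// conjcK => /eqP.
by rewrite (inj_eq (addIr _)) => /eqP ->.
Qed.

(** The minimisation below yields the resolvent equation only up to a vector of norm 0, which is
    removed in this way. *)
Lemma G_null u v v' : G u v -> L v' -> hnorm (v' - v) = 0 -> G u v'.
Proof.
move=> Guv Lv' v0; have /GE[Lu Lv Hu] := Guv; apply/GE; split => // a b ab.
have /GE[La Lb _] := ab; rewrite (Hu _ _ ab).
apply/eqP; rewrite -subr_eq0 -ipBl//; apply/eqP.
rewrite (sh_ipC H La); last exact: shB.
rewrite ip_hnorm0 ?conjc0//; first exact: shB.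
by rewrite hnormBC.
Qed.

Lemma G_closed (u v : nat -> E) a b : (forall n, G (u n) (v n)) -> L a -> L b ->
  (forall e : R, 0 < e -> exists n, hnorm (u n - a) < e /\ hnorm (v n - b) < e) ->
  G a b.
Proof.
move=> Guv La Lb cuv; apply/GE; split => // c d cd.
have /GE[Lc Ld _] := cd.
apply/eqP; rewrite -subr_eq0; apply/eqP/nrm_eq0/eqP.
rewrite eq_le nrm_ge0 andbT; apply/ler_addgt0Pr => e e0; rewrite add0r.
have D0 : 0 < hnorm c + hnorm d + 1.
  by rewrite ltr_wpDl// addr_ge0 ?hnorm_ge0.
have [n [ua vb]] := cuv _ (divr_gt0 e0 D0).
have /GE[Lun Lvn Hn] := Guv n.
have -> : ip a d - ip b c = ip (v n - b) c - ip (u n - a) d.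
  by rewrite !ipBl// (Hn _ _ cd); ring.
apply: le_trans (nrmB _ _) _.
have h1 := cauchy_schwarz (shB Lvn Lb) Lc.
have h2 := cauchy_schwarz (shB Lun La) Ld.
have h3 : hnorm (v n - b) * hnorm c <= e / (hnorm c + hnorm d + 1) * hnorm c.
  by rewrite ler_wpM2r ?hnorm_ge0// ltW.
have h4 : hnorm (u n - a) * hnorm d <= e / (hnorm c + hnorm d + 1) * hnorm d.
  by rewrite ler_wpM2r ?hnorm_ge0// ltW.
have h5 : e = e / (hnorm c + hnorm d + 1) * (hnorm c + hnorm d + 1).
  by rewrite divfK// gt_eqF.
have h6 : 0 < e / (hnorm c + hnorm d + 1) by exact: divr_gt0.
lra.
Qed.

(* A minimising sequence for the distance from f to the range of G - z is Cauchy
   by the parallelogram law, and the residual is orthogonal to the range, hence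
   in the kernel of G - conj z. *)
Lemma resolvent_exists (z : R[i]) f : complex.Im z != 0 -> L f ->
  exists u, G u (f + z *: u).
Proof.
move=> z0 Lf.
have iz0 : 0 < `|complex.Im z| by rewrite normr_gt0.
pose S := [set r : R | exists u v, G u v /\ r = n2 (v - z *: u - f)].
have LG u v : G u v -> L (v - z *: u - f).
  by move=> /GE[? ? _]; apply: shB => //; apply: shB => //; exact: shZ.
have S0 : S !=set0.
  by exists (n2 (0 - z *: 0 - f)); exists 0, 0; split => //; exact: G0.
have lbS : has_lbound S.
  by exists 0 => r [u [v [/LG Luv ->]]]; exact: (sh_ge0 H Luv).
have hinf : has_inf S by split.
set I := inf S.
have Ile u v : G u v -> I <= n2 (v - z *: u - f).
  by move=> Guv; apply: (ge_inf lbS); exists u, v.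
have seqP (n : nat) : exists uv : E * E, G uv.1 uv.2 /\
    n2 (uv.2 - z *: uv.1 - f) < I + n.+1%:R^-1.
  have [|r [u [v [Guv ->]]] rI] := @inf_adherent R S n.+1%:R^-1 _ hinf.
    by rewrite invr_gt0 ltr0n.
  by exists (u, v).
have [uv uvP] := choice seqP.
pose u n := (uv n).1; pose v n := (uv n).2.
have Guv n : G (u n) (v n) by case: (uvP n).
have Lu n : L (u n) by have /GE[] := Guv n.
have Lv n : L (v n) by have /GE[] := Guv n.
pose w n := v n - z *: u n - f.
have Lw n : L (w n) by apply: LG.
have wI n : n2 (w n) < I + n.+1%:R^-1 by case: (uvP n).
(* The mean of [w m] and [w n] is again a residual, so its squared norm is at least [I]; this is the
   bound [4 * I] in the parallelogram law. *)
have cauchy_w m n : n2 (w m - w n) < 2 * m.+1%:R^-1 + 2 * n.+1%:R^-1.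
  rewrite parallelogram//.
  have h : 4 * I <= n2 (w m + w n).
    have hm : w m + w n = 2 *: ((2^-1 : R[i]) *: (v m + v n)
        - z *: ((2^-1 : R[i]) *: (u m + u n)) - f).
      rewrite /w !scalerBr !scalerA.
      have h2 : (2 : R[i]) != 0 by rewrite pnatr_eq0.
      rewrite divff// scale1r mulrA [2 * z]mulrC -mulrA divff// mulr1.
      rewrite scaler_nat mulr2n !scalerDr !opprD.
      by rewrite (AC (3*3) ((1*4)*(2*5)*(3*6)))/=.
    have Gm : G ((2^-1 : R[i]) *: (u m + u n)) ((2^-1 : R[i]) *: (v m + v n)).
      rewrite -[_ *: _]addr0 -[X in G _ X]addr0; apply: G_lin G0.
      by rewrite -[u m]scale1r -[v m]scale1r; apply: G_lin.
    rewrite hm n2Z; last exact: LG.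
    have -> : sqn (2 : R[i]) = 4.
      by rewrite /sqn -[2 : R[i]]/(2%:R) mulr2n !reimE; ring.
    by rewrite ler_pM2l//; apply: Ile.
  move: h (wI m) (wI n); move: (m.+1%:R^-1) (n.+1%:R^-1) => p q; lra.
have inv_small (e : R) : 0 < e -> exists N, forall n, (N <= n)%N -> n.+1%:R^-1 < e.
  move=> e0; have [N _ NP] := near_infty_natSinv_lt (PosNum e0).
  by exists N => n Nn; exact: NP.
have vzu m n : w m - w n = (v m - v n) - z *: (u m - u n).
  rewrite /w scalerBr !opprD !opprK.
  by rewrite (AC (3*3) ((1*4)*(2*5)*(3*6)))/= addNr addr0.
have hw_small (e : R) : 0 < e -> exists N, forall m n,
    (N <= m)%N -> (N <= n)%N -> hnorm (w m - w n) < e.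
  move=> e0; have [N NP] := inv_small (e ^+ 2 / 4) (divr_gt0 (exprn_gt0 2 e0) (ltr0Sn _ _)).
  exists N => m n Nm Nn; rewrite hnorm_n2_lt//; last exact: shB.
  apply: lt_trans (cauchy_w m n) _.
  move: (NP _ Nm) (NP _ Nn).
  by move: (m.+1%:R^-1) (n.+1%:R^-1) (e ^+ 2) => p q r; lra.
have Gmn m n : G (u m - u n) (v m - v n).
  by rewrite ![_ m - _]addrC -2!scaleN1r; apply: G_lin.
have [a La aP] : exists2 a, L a & forall e : R, 0 < e -> exists N,
    forall n, (N <= n)%N -> hnorm (u n - a) < e.
  apply: sh_complete_norm => // e e0.
  have [N NP] := hw_small (e * `|complex.Im z|) (mulr_gt0 e0 iz0).
  exists N => m n Nm Nn; rewrite -(ltr_pM2l iz0).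
  apply: le_lt_trans (shift_norm_ge z (Gmn m n)) _.
  by rewrite -vzu mulrC [ltRHS]mulrC mulrC NP.
have [b Lb bP] : exists2 b, L b & forall e : R, 0 < e -> exists N,
    forall n, (N <= n)%N -> hnorm (w n - b) < e.
  exact: sh_complete_norm.
have Ga : G a (b + f + z *: a).
  apply: (G_closed (u := u) (v := v)) => //.
    by apply: shD; [exact: shD|exact: shZ].
  move=> e e0.
  have D0 : 0 < nrm z + 1 by rewrite ltr_wpDl ?nrm_ge0.
  have e2 : 0 < e / 2 / (nrm z + 1) by rewrite !divr_gt0.
  have [N1 N1P] := aP _ e2; have [N2 N2P] := bP _ (divr_gt0 e0 (ltr0Sn _ 1)).
  exists (maxn N1 N2); set n := maxn _ _.
  have h1 := N1P n (leq_maxl _ _); have h2 := N2P n (leq_maxr _ _).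
  have h3 : e / 2 / (nrm z + 1) * (nrm z + 1) = e / 2 by rewrite divfK// gt_eqF.
  have h4 : nrm z * hnorm (u n - a) <= nrm z * (e / 2 / (nrm z + 1)).
    by rewrite ler_wpM2l ?nrm_ge0// ltW.
  have h5 : 0 <= nrm z * (e / 2 / (nrm z + 1)) by rewrite mulr_ge0 ?nrm_ge0// ltW.
  split; first lra.
  have -> : v n - (b + f + z *: a) = (w n - b) + z *: (u n - a).
    rewrite /w scalerBr !opprD !addrA.
    by rewrite [RHS](AC 6 (1*4*3*6*(2*5)))/= addNr addr0.
  apply: le_lt_trans (hnormD _ _) _; try exact: shB.
    by apply: shZ; exact: shB.
  rewrite hnormZ; last exact: shB.
  lra.
have bI : n2 b <= I.
  apply/ler_addgt0Pr => e e0.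
  have I1 : 0 <= I + 1.
    have := wI 0; rewrite invr1 => /ltW; apply: le_trans; exact: (sh_ge0 H).
  pose W := Num.sqrt (I + 1).
  have W0 : 0 <= W by exact: sqrtr_ge0.
  have wW n : hnorm (w n) <= W.
    rewrite ler_wsqrtr//; have := ltW (wI n) => /le_trans; apply.
    by rewrite lerD2l invf_le1 ?ltr0Sn// ler1n.
  pose dl := Num.min 1 (e / 2 / (1 + 2 * W)).
  have W1 : 0 < 1 + 2 * W by rewrite ltr_pwDl// mulr_ge0.
  have dl0 : 0 < dl by rewrite lt_min ltr01 !divr_gt0.
  have dl1 : dl <= 1 by rewrite ge_min lexx.
  have dl2 : dl * (1 + 2 * W) <= e / 2.
    by rewrite -ler_pdivlMr// ge_min lexx orbT.
  have [N1 N1P] := bP _ dl0; have [N2 N2P] := inv_small _ (divr_gt0 e0 (ltr0Sn _ 1)).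
  set n := maxn N1 N2.
  have h1 := N1P n (leq_maxl _ _); have h2 := N2P n (leq_maxr _ _).
  have Ld : L (w n - b) by exact: shB.
  have -> : n2 b = n2 (w n - (w n - b)) by rewrite opprB addrCA subrr addr0.
  rewrite n2B// -(sqr_hnorm Ld).
  have cs := le_trans (normRe_le _) (cauchy_schwarz (Lw n) Ld).
  have h3 : hnorm (w n) * hnorm (w n - b) <= W * dl.
    by rewrite ler_pM ?hnorm_ge0// ltW.
  have h4 : hnorm (w n - b) ^+ 2 <= dl.
    rewrite expr2 -[leRHS]mul1r ler_pM ?hnorm_ge0// ?ltW//.
    exact: lt_le_trans dl1.
  have := ler_norm (- complex.Re (ip (w n) (w n - b))); rewrite normrN => h5.
  move: (wI n) h2 dl2; rewrite mulrDr mulr1.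
  by move: (n.+1%:R^-1) => q; lra.
have orth c d : G c d -> ip b (d - z *: c) = 0.
  move=> Gcd; have /GE[Lc Ld _] := Gcd.
  set x := d - z *: c; have Lx : L x by apply: shB => //; exact: shZ.
  set p := ip b x.
  have key (s : R[i]) : 0 <= 2 * complex.Re (s * p) + sqn s * n2 x.
    have := le_trans bI (Ile _ _ (G_lin s Gcd Ga)).
    have -> : s *: d + (b + f + z *: a) - z *: (s *: c + a) - f = b + s *: x.
      rewrite /x scalerBr scalerDr !scalerA [z * s]mulrC !opprD !addrA.
      by rewrite (AC 7 (2*1*5*(3*7)*(4*6)))//= !subrr !addr0.
    rewrite n2D ?n2Z ?ipZr//; first lra.
    exact: shZ.
  apply: nrm_eq0; rewrite /nrm; apply/eqP; rewrite sqrtr_eq0 leNgt; apply/negP => p0.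
  have n0 : 0 <= n2 x by exact: (sh_ge0 H Lx).
  have D0 : n2 x + 1 != 0 by rewrite gt_eqF// ltr_wpDl.
  (* For this [s] the linear term is [-2 |p|² / (n2 x + 1)] and outweighs the quadratic one; adding
     1 to [n2 x] covers the case [n2 x = 0]. *)
  have := key (- (n2 x + 1)^-1%:C%C * conjc p).
  have -> : 2 * complex.Re (- (n2 x + 1)^-1%:C%C * conjc p * p) +
      sqn (- (n2 x + 1)^-1%:C%C * conjc p) * n2 x =
      - (sqn p * (n2 x + 2) / (n2 x + 1) ^+ 2).
    by rewrite /sqn !reimE; field.
  rewrite oppr_ge0 leNgt => /negP; apply; apply: divr_gt0.
    by apply: mulr_gt0 => //; lra.
  by apply: exprn_gt0; lra.
have Gb : G b (conjc z *: b).
  apply/GE; split => //; first exact: shZ.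
  move=> c d Gcd; have /GE[Lc Ld _] := Gcd.
  have Lzc := shZ z Lc.
  have /eqP := orth _ _ Gcd; rewrite ipBr// subr_eq0 => /eqP ->.
  by rewrite ipZr// ipZl// conjcK.
have b0 : hnorm b = 0.
  have := shift_norm_ge (conjc z) Gb; rewrite subrr Im_conjc normrN.
  rewrite [hnorm 0]/hnorm /n2 ip0r ?sqrtr0; last exact: (sh0 H).
  by rewrite pmulr_rle0// => h; apply/eqP; rewrite eq_le h hnorm_ge0.
exists a; apply: (G_null Ga); first by apply: shD => //; exact: shZ.
by rewrite -(addrA b) opprD addrCA subrr addr0 hnormN.
Qed.

End SelfAdjoint.
End SemiHilbert.

(** * The space L^2 *)

Section RealIntegrals.
Context {disp : measure_display} {Om : measurableType disp} {R : realType}.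
Variable P : probability Om R.
Implicit Types f g : Om -> R.

Definition rint f := P.-integrable setT (EFin \o f).

Definition rmeas f := measurable_fun setT f.

Lemma rint_meas f : rint f -> rmeas f.
Proof. by move=> /integrableP[mf _]; exact/measurable_EFinP. Qed.

Lemma rint_cst (c : R) : rint (fun=> c).
Proof. exact: finite_measure_integrable_cst. Qed.

Lemma rintD f g : rint f -> rint g -> rint (fun w => f w + g w).
Proof. by move=> fi gi; exact: (integrableD measurableT fi gi). Qed.

Lemma rintZ (c : R) f : rint f -> rint (fun w => c * f w).
Proof. by move=> fi; exact: (integrableZl measurableT c fi). Qed.

Lemma rintN f : rint f -> rint (fun w => - f w).
Proof. by move=> fi; exact: (integrableN fi). Qed.

Lemma rintB f g : rint f -> rint g -> rint (fun w => f w - g w).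
Proof. by move=> fi gi; apply: rintD => //; exact: rintN. Qed.

Lemma rint_le f g : rmeas f -> (forall w, `|f w| <= g w) -> rint g -> rint f.
Proof.
move=> mf fg gi; apply: (le_integrable measurableT _ _ gi).
  exact/measurable_EFinP.
by move=> w _; rewrite /= lee_fin (le_trans (fg w))// ler_norm.
Qed.

Lemma rint_norm f : rint f -> rint (fun w => `|f w|).
Proof.
move=> fi; apply: (le_integrable measurableT _ _ fi).
  by apply/measurable_EFinP; apply: measurableT_comp (rint_meas fi).
by move=> w _; rewrite /= normr_id.
Qed.

Lemma integral_Rintegral f : rint f ->
  (\int[P]_w (f w)%:E = (\int[P]_w f w)%:E)%E.
Proof. by move=> fi; rewrite /Rintegral fineK// integrable_fin_num. Qed.

Lemma rint_ge0 f : rmeas f -> (forall w, 0 <= f w) ->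
  (\int[P]_w (f w)%:E < +oo)%E -> rint f.
Proof.
move=> mf f0 fi; apply/integrableP; split; first exact/measurable_EFinP.
by under eq_integral => w _ do rewrite /= ger0_norm//.
Qed.

Lemma rint_lty f : rint f -> (\int[P]_w (f w)%:E < +oo)%E.
Proof. by move=> fi; rewrite integral_Rintegral// ltry. Qed.

Lemma Rintegral_ae f g : rmeas f -> rmeas g -> ae_eq P setT f g ->
  \int[P]_w f w = \int[P]_w g w.
Proof.
move=> mf mg fg; rewrite /Rintegral; congr fine.
apply: ae_eq_integral => //; try exact/measurable_EFinP.
by apply: filterS fg => w /(_ I) fgw _ /=; rewrite fgw.
Qed.

Lemma fatou_le (h : nat -> Om -> R) f e : (forall n, rmeas (h n)) -> rmeas f ->
  (forall n w, 0 <= h n w) -> (forall w, 0 <= f w) ->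
  {ae P, forall w, h ^~ w @ \oo --> f w} ->
  (forall n, (\int[P]_w (h n w)%:E <= e)%E) -> (\int[P]_w (f w)%:E <= e)%E.
Proof.
move=> mh mf h0 f0 hf he.
have mhE n : measurable_fun setT (EFin \o h n) by apply/measurable_EFinP; exact: mh.
have -> : (\int[P]_w (f w)%:E = \int[P]_w limn_einf (fun n => (h n w)%:E))%E.
  apply: ge0_ae_eq_integral => //.
  - exact/measurable_EFinP.
  - have -> : (fun w => limn_einf (fun n => (h n w)%:E)) =
        (fun w => - limn_esup (fun n => (- (h n w))%:E))%E.
      by [].
    apply: measurableT_comp => //.
    apply: measurable_fun_limn_esup => n.
    by apply/measurable_EFinP; apply: measurable_funN; exact: mh.
  - by move=> w _; rewrite lee_fin.
  - move=> w _; rewrite limn_einf_lim; apply: lime_ge; first exact: is_cvg_einfs.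
    by apply: nearW => n; apply: le_ereal_inf_tmp => _ [m _ <-]; rewrite lee_fin.
  - apply: filterS hf => w hw _.
    have hE : EFin \o h ^~ w @ \oo --> (f w)%:E by apply: cvg_EFin => //; exact: nearW.
    have hc : cvgn (fun n => (h n w)%:E) by apply/cvg_ex; exists (f w)%:E.
    by rewrite is_cvg_limn_einfE//; apply/esym/cvg_lim.
apply: le_trans (fatou P measurableT mhE _) _.
  by move=> n w _; rewrite lee_fin.
rewrite limn_einf_lim; apply: lime_le; first exact: is_cvg_einfs.
apply: nearW => n; apply: le_trans (he n).
by apply: ereal_inf_lbound; exists n => /=.
Qed.

End RealIntegrals.

(** * Completeness of real L^2 *)

Section RieszFischer.
Context {R : realType}.

Lemma sum_half_le n : \sum_(0 <= i < n) (2^-1 : R) ^+ i <= 2.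
Proof.
suff -> : \sum_(0 <= i < n) (2^-1 : R) ^+ i = 2 - 2 * 2^-1 ^+ n.
  by rewrite gerBl mulr_ge0// exprn_ge0// invr_ge0.
elim: n => [|n IH]; first by rewrite big_geq// expr0; ring.
by rewrite big_nat_recr//= IH exprS; field.
Qed.

(** A step [x] is at most [2^-k] in modulus or satisfies [1 <= 2^k |x|], so that
    [|x| <= 2^-k + 2^k x²] in either case; hence the steps are absolutely summable. *)
Lemma cvgn_of_weighted_steps (a : nat -> R) :
  (\sum_(0 <= k <oo) (2 ^+ k * (a k.+1 - a k) ^+ 2)%:E < +oo)%E -> cvgn a.
Proof.
set b := fun k => 2 ^+ k * (a k.+1 - a k) ^+ 2.
have b0 k : 0 <= b k by apply: mulr_ge0; [exact: exprn_ge0|exact: sqr_ge0].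
set S := (X in (X < _)%E) => Soo.
have bS n : \sum_(0 <= k < n) b k <= fine S.
  have h : ((\sum_(0 <= k < n) b k)%:E <= S)%E.
    rewrite -sumEFin; by apply: nneseries_lim_ge => k _; rewrite lee_fin.
  rewrite -lee_fin fineK// ge0_fin_numE//.
  by apply: le_trans h; rewrite lee_fin sumr_ge0.
have step k : `|a k.+1 - a k| <= 2^-1 ^+ k + b k.
  set x := a k.+1 - a k.
  have t0 : 0 < (2 : R) ^+ k by rewrite exprn_gt0.
  rewrite /b -/x exprVn -[x ^+ 2]real_normK ?num_real//.
  have := normr_ge0 x; move: `|x| => y y0; move: t0; move: (2 ^+ k) => t t0.
  have [h|h] := leP y t^-1.
    by rewrite (le_trans h)// lerDl mulr_ge0 ?sqr_ge0// ltW.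
  apply: le_trans (_ : t * y ^+ 2 <= _); last by rewrite lerDr invr_ge0 ltW.
  rewrite expr2 mulrA ler_peMl//.
  by rewrite -(mulfV (lt0r_neq0 t0)) ler_pM2l// ltW.
have cs : cvgn (series (telescope a)).
  apply: normed_cvg; apply: nondecreasing_is_cvgn.
    by apply/nondecreasing_seqP => n; rewrite /= /series /= big_nat_recr//= lerDl.
  exists (2 + fine S) => _ [n _ <-]; rewrite /series /=.
  apply: le_trans (lerD (sum_half_le n) (bS n)).
  rewrite -big_split /=; apply: ler_sum => i _; exact: step.
have -> : a = fun n => series (telescope a) n + a 0%N.
  by apply/funext => n; rewrite telescopeK /= subrK.
by apply: is_cvgD => //; exact: is_cvg_cst.
Qed.

Context {disp : measure_display} {Om : measurableType disp}.
Variable P : probability Om R.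

(* Along a subsequence with squared increments of integral at most 4^-k, the sum
   of 2^k times the squared increments is integrable, hence finite a.e., and
   dominates the increments up to 2^-k; Fatou's lemma then gives L^2 convergence. *)
Lemma real_L2_complete (u : nat -> Om -> R) : (forall n, rmeas (u n)) ->
  (forall e : R, 0 < e -> exists N, forall m n, (N <= m)%N -> (N <= n)%N ->
     (\int[P]_w ((u m w - u n w) ^+ 2)%:E < e%:E)%E) ->
  exists2 f, rmeas f & forall e : R, 0 < e -> exists N, forall n, (N <= n)%N ->
     (\int[P]_w ((u n w - f w) ^+ 2)%:E <= e%:E)%E.
Proof.
move=> mu cu.
have [N NP] : exists N : nat -> nat, forall k m n, (N k <= m)%N -> (N k <= n)%N ->
    (\int[P]_w ((u m w - u n w) ^+ 2)%:E < ((4^-1) ^+ k)%:E)%E.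
  have [k|N NP] := @choice nat nat (fun k N => forall m n, (N <= m)%N ->
      (N <= n)%N -> (\int[P]_w ((u m w - u n w) ^+ 2)%:E < ((4^-1) ^+ k)%:E)%E).
    by apply: cu; rewrite exprn_gt0.
  by exists N.
(* Summing successors gives at once [N k <= psi k], monotonicity and [k <= psi k]. *)
pose psi k := (\sum_(0 <= i < k.+1) (N i).+1)%N.
have psiN k : (N k <= psi k)%N.
  by rewrite /psi big_nat_recr//= (leq_trans (leqnSn _))// leq_addl.
have psiS k : (psi k <= psi k.+1)%N.
  by rewrite /psi [leqRHS]big_nat_recr//= leq_addr.
have psik k : (k <= psi k)%N.
  elim: k => // k IH; rewrite /psi big_nat_recr//=.
  by rewrite addnS ltnS (leq_trans IH)// leq_addr.
pose v k := u (psi k).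
have mv k : rmeas (v k) by exact: mu.
pose g k w := 2 ^+ k * (v k.+1 w - v k w) ^+ 2.
have mg k : rmeas (g k).
  apply: measurable_funM; first exact: measurable_cst.
  by apply: measurable_funX; apply: measurable_funB; (exact: mu || exact: mf).
have g0 k w : 0 <= g k w by apply: mulr_ge0; [exact: exprn_ge0|exact: sqr_ge0].
have mgE k : measurable_fun setT (EFin \o g k) by apply/measurable_EFinP; exact: mg.
have gk k : (\int[P]_w (g k w)%:E <= ((2^-1) ^+ k)%:E)%E.
  rewrite /g; under eq_integral do rewrite EFinM.
  rewrite ge0_integralZl_EFin//; last 2 first.
  - by move=> w _; rewrite lee_fin sqr_ge0.
  - by apply/measurable_EFinP; apply: measurable_funX; apply: measurable_funB; (exact: mu || exact: mf).
  have := ltW (NP k _ _ (leq_trans (psiN k) (psiS k)) (psiN k)).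
  rewrite -/(v _) -/(v _) => /(@lee_wpmul2l _ (2 ^+ k)%:E); rewrite lee_fin => h.
  apply: le_trans (h (exprn_ge0 _ _)) _ => //.
  by rewrite -EFinM lee_fin -exprMn; have -> : (2 * 4^-1 : R) = 2^-1 by field.
have goodw : {ae P, forall w, cvgn (v ^~ w)}.
  have iS : P.-integrable setT (fun w => \sum_(0 <= k <oo) (g k w)%:E)%E.
    apply/integrableP; split.
      by apply: ge0_emeasurable_sum => [k w _ _|k _]; [rewrite lee_fin|exact: mgE].
    have S0 w : (0 <= \sum_(0 <= k <oo) (g k w)%:E)%E.
      by apply: nneseries_ge0 => k _ _; rewrite lee_fin.
    under eq_integral => w _ do rewrite gee0_abs//.
    rewrite integral_nneseries//; last by move=> *; rewrite lee_fin.
    apply: (@le_lt_trans _ _ 2%:E); last by rewrite ltry.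
    apply: lime_le.
      by apply: is_cvg_nneseries => k _ _; apply: integral_ge0 => w _; rewrite lee_fin.
    apply: nearW => n; apply: le_trans (_ : \sum_(0 <= i < n) ((2^-1) ^+ i)%:E <= _)%E.
      by apply: lee_sum.
    by rewrite sumEFin lee_fin sum_half_le.
  apply: filterS (integrable_ae measurableT iS) => w /(_ I).
  rewrite fin_numE => /andP[_ h]; apply: cvgn_of_weighted_steps.
  by rewrite ltey.
(* The limit superior is measurable and defined everywhere; almost everywhere it is the limit. *)
pose f w := fine (limn_esup (fun k => (v k w)%:E)).
have mf : rmeas f.
  apply: measurableT_comp => //; apply: measurable_fun_limn_esup => n.
  by apply/measurable_EFinP; exact: mv.
have vf : {ae P, forall w, v ^~ w @ \oo --> f w}.
  apply: filterS goodw => w /cvg_ex[l vl].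
  rewrite /f is_cvg_limn_esupE; last first.
    by apply/cvg_ex; exists l%:E; apply: cvg_EFin => //; exact: nearW.
  have -> : limn (fun k => (v k w)%:E) = l%:E.
    by apply/cvg_lim => //; apply: cvg_EFin => //; exact: nearW.
  exact: vl.
exists f => // e e0; have [N0 N0P] := cu e e0; exists N0 => n Nn.
(* The shift by [N0] makes the Cauchy bound hold for every term of the sequence, as [fatou_le]
   demands. *)
apply: (@fatou_le _ _ _ P (fun k w => (u n w - v (k + N0)%N w) ^+ 2)).
- by move=> k; apply: measurable_funX; apply: measurable_funB; (exact: mu || exact: mf).
- by apply: measurable_funX; apply: measurable_funB; (exact: mu || exact: mf).
- by move=> k w; exact: sqr_ge0.
- by move=> w; exact: sqr_ge0.
- apply: filterS vf => w vw.
  have : v (k + N0)%N w @[k --> \oo] --> f w by rewrite (cvg_shiftn N0 (v ^~ w)).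
  move=> {}vw; by apply: cvgM; apply: cvgB => //; exact: cvg_cst.
- move=> k; apply: ltW; apply: N0P => //.
  by apply: leq_trans (psik _); rewrite leq_addl.
Qed.
End RieszFischer.

(** * Complex L^2 as a complete semi-inner product space *)

Section ComplexL2.
Context {disp : measure_display} {Om : measurableType disp} {R : realType}.
Variable P : probability Om R.
Implicit Types f g : Om -> Cplx R.

Definition cmeas f := rmeas (fun w => complex.Re (f w)) /\
  rmeas (fun w => complex.Im (f w)).

Definition cint f := rint P (fun w => complex.Re (f w)) /\
  rint P (fun w => complex.Im (f w)).

Lemma cmeas_cst (c : Cplx R) : cmeas (fun=> c).
Proof. by split; exact: measurable_cst. Qed.

Lemma cmeas_real (f : Om -> R) : rmeas f -> cmeas (fun w => (f w)%:C%C).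
Proof. by move=> mf; split => //; exact: measurable_cst. Qed.

Lemma cmeasD f g : cmeas f -> cmeas g -> cmeas (fun w => f w + g w).
Proof.
move=> [a b] [c e]; split.
- by under eq_fun do rewrite ReD; exact: measurable_funD.
- by under eq_fun do rewrite ImD; exact: measurable_funD.
Qed.

Lemma cmeasM f g : cmeas f -> cmeas g -> cmeas (fun w => f w * g w).
Proof.
move=> [a b] [c e]; split.
- by under eq_fun do rewrite ReM; apply: measurable_funB; exact: measurable_funM.
- by under eq_fun do rewrite ImM; apply: measurable_funD; exact: measurable_funM.
Qed.

Lemma cmeasN f : cmeas f -> cmeas (fun w => - f w).
Proof.
move=> mf; have -> : (fun w => - f w) = (fun w => (-1) * f w).
  by apply/funext => w; rewrite mulN1r.
by apply: cmeasM => //; exact: cmeas_cst.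
Qed.

Lemma cmeasB f g : cmeas f -> cmeas g -> cmeas (fun w => f w - g w).
Proof. by move=> mf mg; apply: cmeasD => //; exact: cmeasN. Qed.

Lemma cmeasJ f : cmeas f -> cmeas (fun w => conjc (f w)).
Proof.
move=> [a b]; split; first by under eq_fun do rewrite Re_conjc.
by under eq_fun do rewrite Im_conjc; exact: measurable_funN.
Qed.

Lemma rmeas_sqn f : cmeas f -> rmeas (fun w => sqn (f w)).
Proof.
by move=> [a b]; apply: measurable_funD; apply: measurable_funX.
Qed.

Lemma rmeas_nrm f : cmeas f -> rmeas (fun w => nrm (f w)).
Proof.
move=> mf; have -> : (fun w => nrm (f w)) = (fun w => (sqn (f w)) `^ (2^-1)).
  by apply/funext => w; rewrite powR12_sqrt// sqn_ge0.
by apply: (measurableT_comp (measurable_powR _)); exact: rmeas_sqn.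
Qed.

Lemma cint_le f (h : Om -> R) : cmeas f -> (forall w, nrm (f w) <= h w) ->
  rint P h -> cint f.
Proof.
move=> [a b] fh ih; split; apply: rint_le ih => // w;
  by apply: le_trans (fh w); rewrite ?normRe_le ?normIm_le.
Qed.

Lemma cint_cst (c : Cplx R) : cint (fun=> c).
Proof. by split; exact: rint_cst. Qed.

Lemma Re_Expect f : complex.Re (Expect P f) = \int[P]_w complex.Re (f w).
Proof. by []. Qed.

Lemma Im_Expect f : complex.Im (Expect P f) = \int[P]_w complex.Im (f w).
Proof. by []. Qed.

Lemma Expect_lin (c : Cplx R) f g : cint f -> cint g ->
  Expect P (fun w => c * f w + g w) = c * Expect P f + Expect P g.
Proof.
move=> [fr fi] [gr gi]; apply: complex_eq.
- rewrite ReD ReM !Re_Expect Im_Expect; under eq_Rintegral do rewrite ReD ReM.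
  rewrite RintegralD//; last by apply: rintB; exact: rintZ.
  by rewrite RintegralB// ?RintegralZl//; exact: rintZ.
- rewrite ImD ImM !Im_Expect Re_Expect; under eq_Rintegral do rewrite ImD ImM.
  rewrite RintegralD//; last by apply: rintD; exact: rintZ.
  by rewrite RintegralD// ?RintegralZl//; exact: rintZ.
Qed.

Lemma Expect_cst (c : Cplx R) : Expect P (fun=> c) = c.
Proof.
have h (r : R) : \int[P]_(_ in setT) r = r.
  by rewrite Rintegral_cst// [X in fine X]probability_setT mulr1.
by apply: complex_eq; rewrite (Re_Expect, Im_Expect).
Qed.

Lemma Expect_ae f g : cmeas f -> cmeas g -> ae_eq P setT f g ->
  Expect P f = Expect P g.
Proof.
move=> [a b] [c e] fg; apply: complex_eq => /=; apply: Rintegral_ae => //;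
  by apply: filterS fg => w h _; rewrite h.
Qed.

Lemma Expect_conjc f : cint f ->
  Expect P (fun w => conjc (f w)) = conjc (Expect P f).
Proof.
move=> [_ fi].
apply: complex_eq.
- by rewrite Re_conjc !Re_Expect; under eq_Rintegral do rewrite Re_conjc.
- rewrite Im_conjc !Im_Expect; under eq_Rintegral do rewrite Im_conjc.
  rewrite -mulN1r -RintegralZl//.
  by apply: eq_Rintegral => w _; rewrite mulN1r.
Qed.

Lemma L2P f : L2 P f <-> cmeas f /\ rint P (fun w => sqn (f w)).
Proof.
split=> [[a b ?]|[[a b] /rint_lty ?]]; last by split.
split; first by split.
by apply: rint_ge0 => // [|w]; [exact: rmeas_sqn|exact: sqn_ge0].
Qed.

Lemma sqnormE f : L2 P f -> sqnorm P f = (\int[P]_w sqn (f w))%:E.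
Proof. by move=> /L2P[_ h]; rewrite -integral_Rintegral. Qed.

Lemma sqn2 (z w : R[i]) : sqn (z + w) <= 2 * sqn z + 2 * sqn w.
Proof.
rewrite /sqn !reimE.
have := sqr_ge0 (complex.Re z - complex.Re w).
have := sqr_ge0 (complex.Im z - complex.Im w); lra.
Qed.

Lemma sqnM (z w : R[i]) : sqn (z * w) = sqn z * sqn w.
Proof. by rewrite /sqn !reimE; ring. Qed.

Lemma L2D f g : L2 P f -> L2 P g -> L2 P (fun w => f w + g w).
Proof.
move=> /L2P[mf fi] /L2P[mg gi]; apply/L2P.
have m := cmeasD mf mg; split => //.
apply: (rint_le _ _ (rintD (rintZ 2 fi) (rintZ 2 gi))).
  exact: rmeas_sqn m.
by move=> w; rewrite ger0_norm ?sqn_ge0// sqn2.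
Qed.

Lemma L2Z (c : Cplx R) f : L2 P f -> L2 P (fun w => c * f w).
Proof.
move=> /L2P[mf fi]; apply/L2P; split.
  by apply: cmeasM => //; exact: cmeas_cst.
by under eq_fun do rewrite sqnM; exact: rintZ.
Qed.

Lemma L2B f g : L2 P f -> L2 P g -> L2 P (fun w => f w - g w).
Proof.
move=> Lf Lg; have := L2D (L2Z (-1) Lg) Lf.
by congr L2; apply/funext => w; rewrite mulN1r addrC.
Qed.

Lemma L2_cst (c : Cplx R) : L2 P (fun=> c).
Proof. by apply/L2P; split; [exact: cmeas_cst|exact: rint_cst]. Qed.

Lemma nrm_mul_le (z w : R[i]) : nrm (z * w) <= sqn z + sqn w.
Proof.
rewrite nrmM -!sqr_nrm; have := sqr_ge0 (nrm z - nrm w).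
have := nrm_ge0 z; have := nrm_ge0 w; nra.
Qed.

Lemma cint_mulJ f g : L2 P f -> L2 P g -> cint (fun w => conjc (f w) * g w).
Proof.
move=> /L2P[mf fi] /L2P[mg gi]; apply: (cint_le _ _ (rintD fi gi)).
  by apply: cmeasM => //; exact: cmeasJ.
move=> w; apply: le_trans (nrm_mul_le _ _) _.
by rewrite lerD2r {1}/sqn Re_conjc Im_conjc sqrrN.
Qed.

Lemma L2_cint f : L2 P f -> cint f.
Proof.
move=> Lf; have := cint_mulJ (L2_cst 1) Lf.
by under eq_fun do rewrite conjc1 mul1r.
Qed.

Lemma innerE f : complex.Re (inner P f f) = \int[P]_w sqn (f w).
Proof. by rewrite /inner Re_Expect; apply: eq_Rintegral => w _; rewrite mulJE. Qed.

(** Completeness is obtained for real and imaginary parts separately; the limit is square integrable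
    because it differs from some [u N] by a square-integrable function. *)
Lemma L2_semi_hilbert :
  @semi_hilbert R (Om -> Cplx R) (L2 P) (inner P).
Proof.
split.
- exact: L2_cst.
- by move=> a u v Lu Lv; apply: L2D => //; exact: L2Z.
- move=> a u v w Lu Lv Lw; rewrite /inner -Expect_lin; try exact: cint_mulJ.
  congr Expect; apply/funext => x /=.
  rewrite -[(a *: u + v) x]/(a * u x + v x); ring.
- move=> u v Lu Lv; rewrite /inner -Expect_conjc; last exact: cint_mulJ.
  congr Expect; apply/funext => w.
  by rewrite rmorphM /= conjcK mulrC.
- move=> u _; rewrite innerE; apply: Rintegral_ge0 => w _; exact: sqn_ge0.
move=> u Lu cu.
have Lsub m n : L2 P (u m - u n).
  exact: (L2B (Lu m) (Lu n)).
have cu' (e : R) : 0 < e -> exists N, forall m n, (N <= m)%N -> (N <= n)%N ->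
    (\int[P]_w (sqn (u m w - u n w))%:E < e%:E)%E.
  move=> e0; have [N NP] := cu _ e0; exists N => m n Nm Nn.
  have /L2P[_ h] := Lsub m n.
  by have := NP _ _ Nm Nn; rewrite innerE -lte_fin -integral_Rintegral.
have mu n : cmeas (u n) by have /L2P[] := Lu n.
have sqle (h : Om -> R) m n : rmeas h -> (forall w, 0 <= h w <= sqn (u m w - u n w)) ->
    (\int[P]_w (h w)%:E <= \int[P]_w (sqn (u m w - u n w))%:E)%E.
  move=> mh hle; apply: ge0_le_integral => //.
  - by move=> w _; rewrite lee_fin; case/andP: (hle w).
  - exact/measurable_EFinP.
  - by apply/measurable_EFinP; apply: rmeas_sqn; exact: cmeasB.
  - by move=> w _; rewrite lee_fin; case/andP: (hle w).
have [fr mfr frP] : exists2 f, rmeas f & forall e : R, 0 < e -> exists N,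
    forall n, (N <= n)%N ->
    (\int[P]_w ((complex.Re (u n w) - f w) ^+ 2)%:E <= e%:E)%E.
  apply: real_L2_complete => [n|e e0]; first by case: (mu n).
  have [N NP] := cu' e e0; exists N => m n Nm Nn.
  apply: le_lt_trans (NP m n Nm Nn); apply: sqle => [|w].
    by apply: measurable_funX; apply: measurable_funB; [case: (mu m)|case: (mu n)].
  by rewrite sqr_ge0 /sqn ReD ReN lerDl sqr_ge0.
have [fi mfi fiP] : exists2 f, rmeas f & forall e : R, 0 < e -> exists N,
    forall n, (N <= n)%N ->
    (\int[P]_w ((complex.Im (u n w) - f w) ^+ 2)%:E <= e%:E)%E.
  apply: real_L2_complete => [n|e e0]; first by case: (mu n).
  have [N NP] := cu' e e0; exists N => m n Nm Nn.
  apply: le_lt_trans (NP m n Nm Nn); apply: sqle => [|w].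
    by apply: measurable_funX; apply: measurable_funB; [case: (mu m)|case: (mu n)].
  by rewrite sqr_ge0 /sqn ImD ImN lerDr sqr_ge0.
pose f w : Cplx R := (fr w +i* fi w)%C.
have mf : cmeas f by split.
have fP (e : R) : 0 < e -> exists N, forall n, (N <= n)%N ->
    (\int[P]_w (sqn (u n w - f w))%:E < e%:E)%E.
  move=> e0; have e4 : 0 < e / 4 by rewrite divr_gt0.
  have [N1 N1P] := frP _ e4; have [N2 N2P] := fiP _ e4.
  exists (maxn N1 N2) => n; rewrite geq_max => /andP[h1 h2].
  have [a b] := mu n.
  rewrite /sqn; under eq_integral do rewrite EFinD ReD ImD ReN ImN.
  rewrite ge0_integralD//; try by move=> w _; rewrite lee_fin sqr_ge0.
  - apply: le_lt_trans (leeD (N1P n h1) (N2P n h2)) _.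
    by rewrite -EFinD lte_fin; lra.
  - by apply/measurable_EFinP; apply: measurable_funX; apply: measurable_funB.
  - by apply/measurable_EFinP; apply: measurable_funX; apply: measurable_funB.
have Ld n : (\int[P]_w (sqn (u n w - f w))%:E < +oo)%E -> L2 P (u n - f).
  move=> h; apply/L2P; have mm : cmeas (fun w => u n w - f w) by exact: cmeasB.
  split => //; apply: rint_ge0 => //; first exact: rmeas_sqn mm.
  by move=> w; exact: sqn_ge0.
have Lf : L2 P f.
  have [N NP] := fP 1 ltr01.
  have h := Ld N (lt_trans (NP N (leqnn N)) (ltry _)).
  have -> : f = fun w => (-1) * (u N - f) w + u N w.
    by apply/funext => w; rewrite -[(u N - f) w]/(u N w - f w); ring.
  by apply: L2D => //; exact: L2Z.
exists f => // e e0; have [N NP] := fP _ e0; exists N => n Nn.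
have := NP n Nn => h; rewrite innerE -lte_fin -integral_Rintegral//.
by have /L2P[] := Ld n (lt_trans h (ltry _)).
Qed.

End ComplexL2.

(** * Resolvents of essentially self-adjoint operators *)

Section OperatorResolvent.
Context {disp : measure_display} {Om : measurableType disp} {R : realType}.
Variable P : probability Om R.
Implicit Types f g u v : Om -> Cplx R.

Notation H := (L2_semi_hilbert P).
Definition hn f : R := hnorm (E := Om -> Cplx R) (inner P) f.

Lemma sqr_hn f : L2 P f -> hn f ^+ 2 = \int[P]_w sqn (f w).
Proof. by move=> Lf; rewrite /hn (sqr_hnorm H)// innerE. Qed.

Lemma sqnorm_hn f : L2 P f -> sqnorm P f = (hn f ^+ 2)%:E.
Proof. by move=> Lf; rewrite sqr_hn// sqnormE. Qed.

Lemma hn_ge0 f : 0 <= hn f. Proof. exact: sqrtr_ge0. Qed.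

Lemma sqnorm_lt f (e : R) : L2 P f -> 0 < e ->
  (sqnorm P f < (e ^+ 2)%:E)%E = (hn f < e).
Proof.
move=> Lf e0; rewrite sqnorm_hn// lte_fin ltr_pXn2r// ?nnegrE ?hn_ge0//.
exact: ltW.
Qed.

Lemma ae_hn_eq0 f g : L2 P f -> L2 P g -> ae_eq P setT f g ->
  hn (fun w => f w - g w) = 0.
Proof.
move=> Lf Lg fg; have /L2P[mfg ifg] := L2B Lf Lg.
apply/eqP; rewrite -sqrf_eq0 sqr_hn; last exact: L2B.
rewrite (@Rintegral_ae _ _ _ P _ (fun=> 0)).
- by rewrite Rintegral_cst// mul0r.
- exact: rmeas_sqn mfg.
- exact: measurable_cst.
- apply: filterS fg => w h _; rewrite h// subrr /sqn Re0 Im0; ring.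
Qed.

Variable G0 : @op_graph _ Om R.
Hypothesis G0L : forall q, G0 q -> L2 P q.1 /\ L2 P q.2.
Hypothesis sa : op_selfadjoint P (op_closure P G0).

Lemma op_closureP p : op_closure P G0 p <-> [/\ L2 P p.1, L2 P p.2 &
  forall e : R, 0 < e -> exists q, [/\ G0 q,
    hn (fun w => p.1 w - q.1 w) < e & hn (fun w => p.2 w - q.2 w) < e]].
Proof.
split=> -[L1 L2' h]; split => // e e0.
- have [q [Gq h1 h2]] := h _ (exprn_gt0 2 e0); exists q; have [? ?] := G0L Gq.
  by split => //; rewrite -sqnorm_lt//; exact: L2B.
- have se : 0 < Num.sqrt e by rewrite sqrtr_gt0.
  have [q [Gq h1 h2]] := h _ se; exists q; have [? ?] := G0L Gq.
  split => //; rewrite -[e]sqr_sqrtr ?(ltW e0)//.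
    by rewrite sqnorm_lt//; exact: L2B.
  by rewrite sqnorm_lt//; exact: L2B.
Qed.

Lemma sub_closure q : G0 q -> op_closure P G0 q.
Proof.
move=> Gq; have [L1 L2'] := G0L Gq; apply/op_closureP; split => // e e0.
by exists q; split => //; rewrite ae_hn_eq0//; exact: aeW.
Qed.

Definition clG u v := op_closure P G0 (u, v).

Lemma clGE u v : clG u v <-> [/\ L2 P u, L2 P v &
  forall a b, clG a b -> inner P u b = inner P v a].
Proof.
rewrite /clG {1}(proj2 sa); split.
  by move=> [Lu Lv h]; split => // a b ab; exact: (h _ ab).
move=> [Lu Lv h]; split => // -[a b] ab; exact: (h _ _ ab).
Qed.

(** A core and its closure have the same adjoint, which is the closure itself by self-adjointness.
    Membership can thus be tested on core pairs, where [Hst] for different coupling constants can be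
    compared explicitly. *)
Lemma clG_of_core u v : L2 P u -> L2 P v ->
  (forall a b, G0 (a, b) -> inner P u b = inner P v a) -> clG u v.
Proof.
move=> Lu Lv h; apply/clGE; split => // a b /op_closureP[/= La Lb hab].
apply/eqP; rewrite -subr_eq0; apply/eqP/nrm_eq0/eqP.
rewrite eq_le nrm_ge0 andbT; apply/ler_addgt0Pr => e e0; rewrite add0r.
have D0 : 0 < hn u + hn v + 1 by rewrite ltr_wpDl// addr_ge0 ?hn_ge0.
have [[c d] [/= Gcd h1 h2]] := hab _ (divr_gt0 e0 D0).
have [/= Lc Ld] := G0L Gcd.
have -> : inner P u b - inner P v a = inner P u (b - d) - inner P v (a - c).
  by rewrite !(ipBr H)// (h _ _ Gcd); ring.
apply: le_trans (nrmB _ _) _.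
have c1 := cauchy_schwarz H Lu (shB H Lb Ld).
have c2 := cauchy_schwarz H Lv (shB H La Lc).
have h3 := ler_wpM2l (hn_ge0 u) (ltW h2).
have h4 := ler_wpM2l (hn_ge0 v) (ltW h1).
have h5 : e = e / (hn u + hn v + 1) * (hn u + hn v + 1).
  by rewrite divfK// gt_eqF.
have h6 : 0 < e / (hn u + hn v + 1) by exact: divr_gt0.
apply: le_trans (lerD (le_trans c1 h3) (le_trans c2 h4)) _.
lra.
Qed.

Lemma op_resolventP (z : R[i]) f : complex.Im z != 0 -> L2 P f ->
  clG (op_resolvent P G0 z f) (fun w => f w + z * op_resolvent P G0 z f w).
Proof.
move=> z0 Lf; have [u Gu] := resolvent_exists H clGE z0 Lf.
apply: (@xgetPex _ (fun=> 0)
  [set u | op_closure P G0 (u, fun w => f w + z * u w)]).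
by exists u; exact: Gu.
Qed.

Lemma op_resolvent_L2 (z : R[i]) f : complex.Im z != 0 -> L2 P f ->
  L2 P (op_resolvent P G0 z f).
Proof. by move=> z0 /(op_resolventP z0)/clGE[]. Qed.

Lemma op_resolvent_adj (z : R[i]) f g : complex.Im z != 0 -> L2 P f -> L2 P g ->
  inner P g (op_resolvent P G0 z f) =
  inner P (op_resolvent P G0 (conjc z) g) f.
Proof.
move=> z0 Lf Lg; have z0' : complex.Im (conjc z) != 0 by rewrite Im_conjc oppr_eq0.
exact: (resolvent_adjoint H clGE (z := z) Lf Lg (op_resolventP z0 Lf)
  (op_resolventP z0' Lg)).
Qed.

End OperatorResolvent.

(** * The sector estimate *)

Section Cone.
Variable R : realType.
Implicit Types q : R[i].

(** A closed convex cone: the sector condition survives expectations, sums over coordinates and the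
    closure of the operator. *)
Definition cone (kap : R) : set R[i] :=
  [set q | `|complex.Im q| <= kap * complex.Re q].

Lemma coneD kap q q' : cone kap q -> cone kap q' -> cone kap (q + q').
Proof.
rewrite /cone /= ReD ImD mulrDr => h h'.
exact: le_trans (ler_normD _ _) (lerD h h').
Qed.

Lemma cone0 kap : cone kap 0.
Proof. by rewrite /cone /= normr0 mulr0. Qed.

Lemma coneZ kap (c : R) q : 0 <= c -> cone kap q -> cone kap (c%:C%C * q).
Proof.
move=> c0; rewrite /cone /= => h.
rewrite ReM ImM ReC ImC !mul0r subr0 addr0 normrM (ger0_norm c0) mulrCA.
exact: ler_wpM2l.
Qed.

Lemma cone_closed kap q : 0 <= kap ->
  (forall e : R, 0 < e -> exists2 q', cone kap q' & nrm (q - q') <= e) ->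
  cone kap q.
Proof.
move=> k0 h; rewrite /cone /=; apply/ler_addgt0Pr => e e0.
have D0 : 0 < 1 + kap by rewrite ltr_wpDr.
have [q' cq' qq'] := h _ (divr_gt0 e0 D0).
have h1 := le_trans (normIm_le _) qq'; have h2 := le_trans (normRe_le _) qq'.
rewrite !reimE in h1 h2.
move: cq'; rewrite /cone /= => h3.
have h4 : kap * complex.Re q' <= kap * (complex.Re q + e / (1 + kap)).
  rewrite ler_wpM2l//; move: h2; rewrite ler_norml => /andP[]; lra.
have h5 := ler_normD (complex.Im q - complex.Im q') (complex.Im q').
rewrite subrK in h5.
have h6 : e = e / (1 + kap) + kap * (e / (1 + kap)) by field; rewrite gt_eqF.
rewrite mulrDr in h4; lra.
Qed.

End Cone.

(** * Invariance of integrals under the action *)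

Section Translations.
Context {disp : measure_display} {Om : measurableType disp} {R : realType}.
Variables (P : probability Om R) (d : nat) (tau : 'rV[R]_d -> Om -> Om).
Hypothesis tau_action : preserving_action P tau.
Implicit Types (x : 'rV[R]_d) (f g u v l : Om -> Cplx R).

Lemma tau_meas x : measurable_fun setT (tau x).
Proof. by case: tau_action. Qed.

Lemma tau_rmeas x (f : Om -> R) : rmeas f -> rmeas (f \o tau x).
Proof. by move=> mf; apply: measurableT_comp (tau_meas x). Qed.

Lemma tau_ge0_integral x (f : Om -> R) : rmeas f -> (forall w, 0 <= f w) ->
  (\int[P]_w (f (tau x w))%:E = \int[P]_w (f w)%:E)%E.
Proof.
move=> mf f0; have [_ _ _ pres] := tau_action.
transitivity (\int[pushforward P (tau x)]_y (f y)%:E)%E; last first.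
  apply: eq_measure_integral; first exact: tau_meas.
  by move=> mt A mA _; exact: pres.
rewrite ge0_integral_pushforward//; first exact: tau_meas.
  exact/measurable_EFinP.
by move=> y _; rewrite lee_fin.
Qed.

Lemma tau_rint x (f : Om -> R) : rint P f -> rint P (f \o tau x).
Proof.
move=> fi; have mf := rint_meas fi; apply/integrableP; split.
  by apply/measurable_EFinP; exact: tau_rmeas.
have := tau_ge0_integral x (measurableT_comp (@normr_measurable R setT) mf)
  (fun w => normr_ge0 (f w)).
by move=> /= ->; have /integrableP[] := fi.
Qed.

Lemma tau_Rintegral x (f : Om -> R) : rint P f ->
  \int[P]_w f (tau x w) = \int[P]_w f w.
Proof.
move=> fi; have [_ _ _ pres] := tau_action; congr fine.
transitivity (\int[pushforward P (tau x)]_y (f y)%:E)%E; last first.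
  apply: eq_measure_integral; first exact: tau_meas.
  by move=> mt A mA _; exact: pres.
rewrite integral_pushforward//; first exact: tau_meas.
  by apply/measurable_EFinP; exact: rint_meas fi.
exact: tau_rint.
Qed.

Lemma cmeas_transl x f : cmeas f -> cmeas (transl tau x f).
Proof. by move=> [a b]; split; [exact: (tau_rmeas (- x) a)|exact: (tau_rmeas (- x) b)]. Qed.

Lemma transl_L2 x f : L2 P f -> L2 P (transl tau x f).
Proof.
move=> /L2P[mf fi]; apply/L2P; split; first exact: cmeas_transl.
exact: (tau_rint (- x) fi).
Qed.

Lemma Expect_transl x f : cint P f -> Expect P (transl tau x f) = Expect P f.
Proof.
move=> [fr fi]; apply: complex_eq.
  exact: (tau_Rintegral (- x) fr).
exact: (tau_Rintegral (- x) fi).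
Qed.

Lemma inner_transl x f g : L2 P f -> L2 P g ->
  inner P (transl tau x f) (transl tau x g) = inner P f g.
Proof. by move=> Lf Lg; apply: (Expect_transl x); exact: cint_mulJ. Qed.

Lemma translD x y (T : Type) (f : Om -> T) :
  transl tau x (transl tau y f) = transl tau (x + y) f.
Proof.
have [_ tauD _ _] := tau_action.
by apply/funext => w; rewrite /transl tauD -opprD addrC.
Qed.

Lemma transl0 (T : Type) (f : Om -> T) : transl tau 0 f = f.
Proof.
by have [tau0 _ _ _] := tau_action; apply/funext => w; rewrite /transl oppr0 tau0.
Qed.

End Translations.

(** * Difference quotients approximating D + i k *)

Section TwistedDifferences.
Context {disp : measure_display} {Om : measurableType disp} {R : realType}.
Variables (P : probability Om R) (d : nat) (tau : 'rV[R]_d -> Om -> Om).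
Hypothesis tau_action : preserving_action P tau.
Variables (j : 'I_d) (kp : R).
Implicit Types (h e : R) (f g u v l : Om -> Cplx R).

Notation H := (L2_semi_hilbert P).
Notation hn := (hn P).

(* A unimodular substitute for exp(i kp h), rational in h. *)
Definition phase h : R[i] :=
  (1 + 'i%C * (kp * h / 2)%:C%C) / (1 - 'i%C * (kp * h / 2)%:C%C).

Let den h : R[i] := 1 - 'i%C * (kp * h / 2)%:C%C.

Let sqn_den h : sqn (den h) = 1 + (kp * h / 2) ^+ 2.
Proof. by rewrite /sqn /den !reimE; ring. Qed.

Let nrm_den_ge1 h : 1 <= nrm (den h).
Proof.
by rewrite -[1]sqrtr1 ler_wsqrtr// sqn_den lerDl sqr_ge0.
Qed.

Let den_neq0 h : den h != 0.
Proof.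
by apply/eqP => h0; have := nrm_den_ge1 h; rewrite h0 nrm0 ler10.
Qed.

Let nrm_divden_le z h : nrm (z / den h) <= nrm z.
Proof.
rewrite nrmM nrmV ler_piMr ?nrm_ge0// invf_le1 ?nrm_den_ge1//.
exact: lt_le_trans ltr01 (nrm_den_ge1 h).
Qed.

Lemma nrm_phase h : nrm (phase h) = 1.
Proof.
have n0 : nrm (den h) != 0 by rewrite gt_eqF// (lt_le_trans ltr01).
rewrite /phase -/(den h) nrmM nrmV.
suff -> : nrm (1 + 'i%C * (kp * h / 2)%:C%C) = nrm (den h) by rewrite divff.
by congr Num.sqrt; rewrite /sqn /den !reimE; ring.
Qed.

(** This symmetry, shared with [exp (i kp h)], makes the twisted difference quotient skew-adjoint up
    to the sign of [h]. *)
Lemma conjc_phase h : conjc (phase (- h)) = phase h.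
Proof.
have cE (z : R) : conjc (1 + 'i%C * z%:C%C) = 1 - 'i%C * z%:C%C :> R[i].
  by apply: complex_eq; rewrite !reimE; ring.
have cE' (z : R) : conjc (1 - 'i%C * z%:C%C) = 1 + 'i%C * z%:C%C :> R[i].
  by apply: complex_eq; rewrite !reimE; ring.
have cM (y z : R[i]) : conjc (y / z) = conjc y / conjc z.
  by rewrite -conjc_inv; apply: complex_eq; rewrite !reimE; ring.
rewrite /phase cM cE cE'.
have -> : kp * - h / 2 = - (kp * h / 2) by ring.
by rewrite rmorphN !mulrN opprK.
Qed.

Let phase_sub1 h : phase h - 1 = ('i%C * (kp * h)%:C%C) / den h.
Proof.
have n0 := den_neq0 h; rewrite /phase -/(den h).
  have -> : (kp * h)%:C%C = (kp * h / 2)%:C%C + (kp * h / 2)%:C%C :> R[i].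
    by rewrite -rmorphD/=; congr (_%:C%C); field.
  move: n0; rewrite /den; move: ((kp * h / 2)%:C%C) => X n0; field; exact: n0.
Qed.

Lemma phase_sub1_le h : nrm (phase h - 1) <= `|kp * h|.
Proof.
rewrite phase_sub1.
apply: le_trans (nrm_divden_le _ _) _.
by rewrite nrmM nrmR /nrm /sqn Rei Imi expr0n expr1n/= add0r sqrtr1 mul1r.
Qed.

Lemma phase_deriv h : h != 0 ->
  nrm ((h^-1)%:C%C * (phase h - 1) - 'i%C * kp%:C%C) <= kp ^+ 2 * `|h|.
Proof.
move=> h0.
have -> : (h^-1)%:C%C * (phase h - 1) - 'i%C * kp%:C%C =
    (- (kp * (kp * h / 2))%:C%C) / den h.
  have n0 := den_neq0 h.
  have e1 : (h^-1)%:C%C * ('i%C * (kp * h)%:C%C) = 'i%C * kp%:C%C :> R[i].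
    by rewrite mulrCA -rmorphM/= mulrCA mulVf// mulr1.
  apply: (mulIf n0); rewrite phase_sub1 mulrA e1 mulrBl !divfK// /den.
  rewrite (rmorphM _ kp) /=.
  move: (kp%:C%C : R[i]) ((kp * h / 2)%:C%C : R[i]) => K X.
  have -> : - (K * X) = 'i%C ^+ 2 * (K * X) by rewrite sqr_i mulN1r.
  by ring.
apply: le_trans (nrm_divden_le _ _) _.
rewrite nrmN nrmR.
have -> : kp * (kp * h / 2) = kp ^+ 2 * h / 2 by ring.
rewrite normrM [X in X * _]normrM [X in X * _ * _]ger0_norm ?sqr_ge0//.
rewrite ler_piMr//; first by apply: mulr_ge0; rewrite ?sqr_ge0.
by rewrite ger0_norm ?invr_ge0// invf_le1// ler1n.
Qed.

Definition shiftj h f : Om -> Cplx R := transl tau (h *: delta_mx 0 j) f.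
(** Approximates [D_j + i kp]. Putting the twist into a unimodular factor, instead of adding
    [i kp f], keeps a difference of two values: a map equivariant under phases commutes with shift
    and phase, so its difference quotient compares its values at [phase h * shiftj h f] and at
    [f]. *)
Definition tdiff h f : Om -> Cplx R :=
  fun w => (h^-1)%:C%C * (phase h * shiftj h f w - f w).

Lemma shiftj_L2 h f : L2 P f -> L2 P (shiftj h f).
Proof. exact: transl_L2. Qed.

Lemma tdiff_L2 h f : L2 P f -> L2 P (tdiff h f).
Proof.
by move=> Lf; exact: (L2Z _ (L2B (L2Z _ (shiftj_L2 h Lf)) Lf)).
Qed.

Lemma hnZ (c : R[i]) f : L2 P f -> hn (fun w => c * f w) = nrm c * hn f.
Proof. exact: (hnormZ H c). Qed.

Lemma hnD f g : L2 P f -> L2 P g -> hn (fun w => f w + g w) <= hn f + hn g.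
Proof. exact: (hnormD H). Qed.

Lemma tdiff_adj h f g : L2 P f -> L2 P g ->
  inner P f (tdiff h g) = - inner P (tdiff (- h) f) g.
Proof.
move=> Lf Lg.
have Lsg := shiftj_L2 h Lg; have Lsf := shiftj_L2 (- h) Lf.
have LSg := shZ H (phase h) Lsg; have LSf := shZ H (phase (- h)) Lsf.
rewrite -[tdiff h g]/((h^-1)%:C%C *: (phase h *: shiftj h g - g)).
rewrite -[tdiff (- h) f]/(((- h)^-1)%:C%C *: (phase (- h) *: shiftj (- h) f - f)).
rewrite (ipZr H _ Lf (shB H LSg Lg)).
rewrite (ipZl H _ Lg (shB H LSf Lf)).
rewrite (ipBr H)// (ipBl H)// (ipZr H)// (ipZl H)//.
rewrite conjc_phase conjc_real invrN rmorphN/= mulNr opprK.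
congr (_ * (_ * _ - _)).
rewrite -[RHS](inner_transl tau_action (h *: delta_mx 0 j))//.
by rewrite /shiftj (translD tau_action) scaleNr addrN (transl0 tau_action).
Qed.

Lemma is_grad_hn u g : is_grad P tau j u g -> forall e, 0 < e ->
  exists2 dl, 0 < dl & forall h, h != 0 -> `|h| < dl ->
    hn (fun w => (h^-1)%:C%C * (shiftj h u w - u w) - g w) < e.
Proof.
move=> [Lu Lg ug] e e0.
have LL h : L2 P (fun w => (h^-1)%:C%C * (shiftj h u w - u w) - g w).
  exact: (L2B (L2Z _ (L2B (shiftj_L2 h Lu) Lu)) Lg).
have : \forall h \near (0 : R)^', (sqnorm P (fun w =>
    (h^-1)%:C%C * (shiftj h u w - u w) - g w)%R < (e ^+ 2)%:E)%E.
  have n0 : nbhs (0%:E : \bar R) [set x | (x < (e ^+ 2)%:E)%E].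
    by apply: open_nbhs_nbhs; split; [exact: open_ereal_lt_ereal|rewrite /= lte_fin exprn_gt0].
  exact: (ug _ n0).
rewrite near_withinE near_nbhs_norm => -[dl/= dl0 dlP]; exists dl => // h h0 hdl.
rewrite -sqnorm_lt//; apply: dlP => //=; by rewrite sub0r normrN.
Qed.

Lemma tdiff_cvg u g : is_grad P tau j u g -> forall e, 0 < e ->
  exists2 dl, 0 < dl & forall h, h != 0 -> `|h| < dl ->
    hn (fun w => tdiff h u w - (g w + 'i%C * kp%:C%C * u w)) < e.
Proof.
move=> gu e e0; have [Lu Lg _] := gu.
have [dl dl0 dlP] := is_grad_hn gu (divr_gt0 e0 (ltr0Sn _ 1)).
(* [C] sums the coefficients of [|h|] in the last two terms of the decomposition below; 1 is added
   to keep it positive. *)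
pose C := `|kp| * hn g + kp ^+ 2 * hn u + 1.
have C0 : 0 < C.
  by rewrite /C ltr_wpDl// addr_ge0// mulr_ge0 ?hn_ge0 ?sqr_ge0.
exists (Num.min dl (e / 2 / C)); first by rewrite lt_min dl0 !divr_gt0.
move=> h h0; rewrite lt_min => /andP[h1 h2].
have LD : L2 P (fun w => (h^-1)%:C%C * (shiftj h u w - u w) - g w).
  exact: (L2B (L2Z _ (L2B (shiftj_L2 h Lu) Lu)) Lg).
have -> : (fun w => tdiff h u w - (g w + 'i%C * kp%:C%C * u w)) =
  (fun w => phase h * ((h^-1)%:C%C * (shiftj h u w - u w) - g w) +
    ((phase h - 1) * g w +
     ((h^-1)%:C%C * (phase h - 1) - 'i%C * kp%:C%C) * u w)).
  by apply/funext => w; rewrite /tdiff; ring.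
apply: le_lt_trans (hnD _ _) _.
- exact: L2Z.
- by apply: L2D; exact: L2Z.
rewrite hnZ// nrm_phase mul1r.
have b1 := hnD (L2Z (phase h - 1) Lg)
   (L2Z ((h^-1)%:C%C * (phase h - 1) - 'i%C * kp%:C%C) Lu).
rewrite !hnZ// in b1.
have b2 := ler_wpM2r (hn_ge0 P g) (phase_sub1_le h).
have b3 := ler_wpM2r (hn_ge0 P u) (phase_deriv h0).
have b4 := dlP h h0 h1.
have b5 : `|h| * C < e / 2 by rewrite -ltr_pdivlMr.
rewrite normrM in b2.
have b6 : `|h| * C = `|kp| * `|h| * hn g + kp ^+ 2 * `|h| * hn u + `|h|.
  by rewrite /C; ring.
have b7 := normr_ge0 h.
lra.
Qed.

End TwistedDifferences.

(** * Sectoriality of -(D + i k)^2 in one direction *)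

Section SectorEstimate.
Context {disp : measure_display} {Om : measurableType disp} {R : realType}.
Variables (P : probability Om R) (d : nat) (tau : 'rV[R]_d -> Om -> Om).
Hypothesis tau_action : preserving_action P tau.
Implicit Types (h e : R) (f g u v l : Om -> Cplx R).

Notation H := (L2_semi_hilbert P).
Notation hn := (hn P).

(** [F] will be the truncated power [Ftr]. The Lipschitz bound controls difference quotients of
    [F u] without asking that [F u] be in the domain of the gradient; [F_cone] is the pointwise
    inequality that gets integrated. *)
Variables (F : R[i] -> R[i]) (Lam kap : R).
Hypothesis F_meas : forall f, cmeas f -> cmeas (fun w => F (f w)).
Hypothesis F0 : F 0 = 0.
Hypothesis Lam0 : 0 <= Lam.
Hypothesis F_lip : forall a b, nrm (F b - F a) <= Lam * nrm (b - a).
Hypothesis F_equiv : forall c a, nrm c = 1 -> F (c * a) = c * F a.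
Hypothesis kap0 : 0 <= kap.
Hypothesis F_cone : forall a b, cone kap (conjc (F b - F a) * (b - a)).

Lemma sqn_lip (x y c : R) (z w : R[i]) : 0 <= c -> nrm z <= c * nrm w ->
  sqn z <= c ^+ 2 * sqn w.
Proof.
move=> c0 h; rewrite -!sqr_nrm -exprMn ler_sqr ?nnegrE ?mulr_ge0 ?nrm_ge0//.
Qed.

Lemma hn_le (c : R) f g : 0 <= c -> cmeas f -> L2 P g ->
  (forall w, nrm (f w) <= c * nrm (g w)) -> L2 P f /\ hn f <= c * hn g.
Proof.
move=> c0 mf Lg fg; have /L2P[mg gi] := Lg.
have s w : sqn (f w) <= c ^+ 2 * sqn (g w) by apply: sqn_lip.
have ig := rintZ (c ^+ 2) gi.
have ifn : rint P (fun w => sqn (f w)).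
  apply: (rint_le (rmeas_sqn mf) _ ig) => w.
  by rewrite ger0_norm ?sqn_ge0.
have Lf : L2 P f by apply/L2P.
split => //; rewrite -ler_sqr ?nnegrE ?mulr_ge0 ?hn_ge0//.
rewrite exprMn !sqr_hn// -RintegralZl//.
by apply: le_Rintegral => // w _; exact: s.
Qed.

Lemma F_L2 f : L2 P f -> L2 P (fun w => F (f w)).
Proof.
move=> Lf; have /L2P[mf _] := Lf.
have [] // := @hn_le Lam (fun w => F (f w)) f Lam0 (F_meas mf) Lf.
by move=> w; have := F_lip 0 (f w); rewrite F0 !subr0.
Qed.

Lemma F_hn_lip f g : L2 P f -> L2 P g ->
  hn (fun w => F (f w) - F (g w)) <= Lam * hn (fun w => f w - g w).
Proof.
move=> Lf Lg; have /L2P[mf _] := Lf; have /L2P[mg _] := Lg.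
by have [] := @hn_le Lam (fun w => F (f w) - F (g w)) (fun w => f w - g w) Lam0
  (cmeasB (F_meas mf) (F_meas mg)) (L2B Lf Lg) (fun w => F_lip _ _).
Qed.

Lemma cone_Expect f : cint P f -> (forall w, cone kap (f w)) -> cone kap (Expect P f).
Proof.
move=> [fr fi] fc; change (`|complex.Im (Expect P f)| <= kap * complex.Re (Expect P f)).
rewrite Re_Expect Im_Expect -RintegralZl//.
apply: le_trans (le_normr_Rintegral measurableT fi) _.
apply: le_Rintegral => //; [exact: rint_norm|exact: rintZ|].
by move=> w _; exact: fc.
Qed.

Section OneDirection.
Variables (j : 'I_d) (kp : R).

Notation shiftj := (shiftj tau j).
Notation tdiff := (tdiff tau j kp).

Lemma tdiff_F h u w : tdiff h (fun w => F (u w)) w =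
  (h^-1)%:C%C * (F (phase kp h * shiftj h u w) - F (u w)).
Proof. by rewrite F_equiv ?nrm_phase. Qed.

Lemma tdiff_F_cone h u : L2 P u ->
  cone kap (inner P (tdiff h (fun w => F (u w))) (tdiff h u)).
Proof.
move=> Lu; apply: cone_Expect.
  by apply: cint_mulJ; apply: tdiff_L2 => //; exact: F_L2.
move=> w; rewrite tdiff_F /tdiff.
set b := _ * shiftj h u w.
have -> : conjc ((h^-1)%:C%C * (F b - F (u w))) * ((h^-1)%:C%C * (b - u w)) =
   (h^-1 ^+ 2)%:C%C * (conjc (F b - F (u w)) * (b - u w)).
  rewrite conjcM conjc_real rmorphXn /=.
  by ring.
by apply: coneZ => //; exact: sqr_ge0.
Qed.

Lemma hn_tdiff_F h u : L2 P u ->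
  hn (tdiff h (fun w => F (u w))) <= Lam * hn (tdiff h u).
Proof.
move=> Lu; have /L2P[mu _] := Lu.
have L1 := tdiff_L2 tau_action j kp h (F_L2 Lu).
have /L2P[m1 _] := L1.
have [] // := @hn_le Lam (tdiff h (fun w => F (u w))) (tdiff h u) Lam0 m1
  (tdiff_L2 tau_action j kp h Lu).
move=> w; rewrite tdiff_F /tdiff !nrmM mulrCA.
by apply: ler_wpM2l (F_lip _ _); exact: nrm_ge0.
Qed.

(* [-(D + i kp)^2 u] paired with [F u], the second derivative being moved to
   [F u] as a difference quotient, which is controlled by Lipschitz continuity. *)
Lemma second_derivative_cone u g l : is_grad P tau j u g -> is_grad P tau j g l ->
  cone kap (inner P (fun w => F (u w))
    (fun w => - l w - 2%:R * 'i%C * (kp%:C%C * g w) + (kp ^+ 2)%:C%C * u w)).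
Proof.
move=> gu gl; have [Lu Lg _] := gu; have [_ Ll _] := gl.
pose I := 'i%C * kp%:C%C : R[i].
have I2 : I * I = - (kp ^+ 2)%:C%C.
  by rewrite /I mulrACA -expr2 sqr_i mulN1r -rmorphM.
pose G := fun w => g w + I * u w.
have LG : L2 P G by exact: (L2D Lg (L2Z I Lu)).
pose Lt := fun w => l w + I * g w + I * G w.
have LLt : L2 P Lt by exact: (L2D (L2D Ll (L2Z I Lg)) (L2Z I LG)).
have -> : (fun w => - l w - 2%:R * 'i%C * (kp%:C%C * g w) + (kp ^+ 2)%:C%C * u w)
    = (fun w => (-1) * Lt w).
  apply/funext => w; rewrite /Lt /G.
  have -> : (kp ^+ 2)%:C%C = - (I * I) by rewrite I2 opprK.
  by rewrite /I; ring.
pose Fu w := F (u w); have LF : L2 P Fu by exact: F_L2.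
have -> : inner P Fu (fun w => (-1) * Lt w) = - inner P Fu Lt.
  exact: (etrans (ipZr H (-1) LF LLt) (mulN1r _)).
apply: cone_closed => // e e0.
pose C := hn Fu * (1 + nrm I) + Lam * (hn G + 1) + 1.
have C0 : 0 < C.
  by rewrite /C ltr_wpDl// addr_ge0// mulr_ge0 ?hn_ge0// addr_ge0 ?hn_ge0 ?nrm_ge0.
pose e' := Num.min 1 (e / C).
have e'0 : 0 < e' by rewrite lt_min ltr01 divr_gt0.
have [d1 d10 d1P] := tdiff_cvg tau_action kp gl e'0.
have [d2 d20 d2P] := tdiff_cvg tau_action kp gu e'0.
pose h := Num.min d1 d2 / 2.
have h0 : 0 < h by rewrite divr_gt0// lt_min d10.
have hm : h < Num.min d1 d2.
  by rewrite /h ltr_pdivrMr// ltr_pMr ?ltr1n// lt_min d10.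
have hne : h != 0 by rewrite gt_eqF.
have [h1 h2] : h < d1 /\ h < d2 by move: hm; rewrite lt_min => /andP[].
have E1 : hn (fun w => tdiff h g w - (l w + I * g w)) < e'.
  by apply: d1P => //; rewrite gtr0_norm.
have E2 : hn (fun w => tdiff h u w - G w) < e'.
  by apply: d2P => //; rewrite gtr0_norm.
(* Summation by parts turns [tdiff h] into [tdiff (- h)], so the gradient has to be approximated at
   both increments. *)
have E3 : hn (fun w => tdiff (- h) u w - G w) < e'.
  by apply: d2P; rewrite ?oppr_eq0// normrN gtr0_norm.
have LE f h' : L2 P f -> L2 P (tdiff h' f) by exact: tdiff_L2.
have L1 := L2B (LE _ h Lg) (L2D Ll (L2Z I Lg)).
have L2' := L2B (LE _ h Lu) LG.
have L3 := L2B (LE _ (- h) Lu) LG.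
have EG : hn (fun w => tdiff h G w - Lt w) <= e' * (1 + nrm I).
  have -> : (fun w => tdiff h G w - Lt w) = (fun w =>
     (tdiff h g w - (l w + I * g w)) + I * (tdiff h u w - G w)).
    apply/funext => w; rewrite /Lt /tdiff /G.
    rewrite -[shiftj h _ w]/(shiftj h g w + I * shiftj h u w); ring.
  apply: le_trans (hnD L1 (L2Z I L2')) _.
  rewrite (hnZ I L2') mulrDr mulr1 lerD ?(ltW E1)// mulrC.
  by apply: ler_wpM2r; [exact: nrm_ge0|exact: ltW].
have LFE := LE _ (- h) LF.
(* This approximant comes from [- inner P Fu Lt] by replacing [Lt] with [tdiff h G], summing by
   parts, and replacing [G] with [tdiff (- h) u]. *)
exists (inner P (tdiff (- h) Fu) (tdiff (- h) u)); first exact: tdiff_F_cone.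
have -> : - inner P Fu Lt - inner P (tdiff (- h) Fu) (tdiff (- h) u) =
  inner P Fu (fun w => tdiff h G w - Lt w) -
  inner P (tdiff (- h) Fu) (fun w => tdiff (- h) u w - G w).
  have e1 := ipBr H LF (LE _ h LG) LLt.
  have e2 := ipBr H LFE (LE _ (- h) Lu) LG.
  rewrite -[fun w => tdiff h G w - Lt w]/(tdiff h G - Lt) e1.
  rewrite -[fun w => tdiff (- h) u w - G w]/(tdiff (- h) u - G) e2.
  by rewrite (tdiff_adj tau_action j kp h LF LG); ring.
apply: le_trans (nrmB _ _) _.
have b1 : nrm (inner P Fu (fun w => tdiff h G w - Lt w)) <= hn Fu * (e' * (1 + nrm I)).
  apply: le_trans (cauchy_schwarz H LF (L2B (LE _ h LG) LLt)) _.
  by apply: ler_wpM2l EG; exact: hn_ge0.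
have b2 : hn (tdiff (- h) u) <= hn G + 1.
  have -> : tdiff (- h) u = (fun w => (tdiff (- h) u w - G w) + G w).
    by apply/funext => w; rewrite subrK.
  apply: le_trans (hnD L3 LG) _; rewrite addrC lerD2l (le_trans (ltW E3))//.
  by rewrite ge_min lexx.
have b3 : nrm (inner P (tdiff (- h) Fu) (fun w => tdiff (- h) u w - G w)) <=
    Lam * (hn G + 1) * e'.
  apply: le_trans (cauchy_schwarz H LFE L3) _.
  apply: ler_pM; rewrite ?hn_ge0 ?(ltW E3)//.
  apply: le_trans (hn_tdiff_F (- h) Lu) _.
  exact: ler_wpM2l b2.
have b4 : e' * C <= e by rewrite -ler_pdivlMr// ge_min lexx orbT.
apply: le_trans (lerD b1 b3) _; apply: le_trans b4; rewrite /C.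
have -> : hn Fu * (e' * (1 + nrm I)) + Lam * (hn G + 1) * e' =
   e' * (hn Fu * (1 + nrm I) + Lam * (hn G + 1)) by ring.
by rewrite ler_pM2l// lerDl.
Qed.

End OneDirection.
End SectorEstimate.

(** * Sectoriality of the free operator *)

Section StationaryOperator.
Context {disp : measure_display} {Om : measurableType disp} {R : realType}.
Variables (P : probability Om R) (d : nat) (tau : 'rV[R]_d -> Om -> Om).
Hypothesis tau_action : preserving_action P tau.
Variable V : Om -> R.
Implicit Types (k : 'rV[R]_d) (f g u v : Om -> Cplx R).

Notation H := (L2_semi_hilbert P).
Notation hn := (hn P).

Lemma inner_aer f g g' : L2 P f -> L2 P g -> L2 P g' -> ae_eq P setT g g' ->
  inner P f g = inner P f g'.
Proof.
move=> /L2P[mf _] /L2P[mg _] /L2P[mg' _] gg'; apply: Expect_ae.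
- by apply: cmeasM => //; exact: cmeasJ.
- by apply: cmeasM => //; exact: cmeasJ.
- by apply: filterS gg' => w h _; rewrite h.
Qed.

Lemma Hst_L2 k lam q : Hst P tau V k lam q -> L2 P q.1 /\ L2 P q.2.
Proof. by move=> [? [? _]]. Qed.

Lemma Hst0E k u v : Hst P tau V k 0 (u, v) <-> [/\ L2 P u, L2 P v &
  exists g l : 'I_d -> Om -> Cplx R,
    [/\ forall j, is_grad P tau j u (g j),
        forall j, is_grad P tau j (g j) (l j) &
        ae_eq P setT v (fun w => - (\sum_(j < d) l j w)
          - 2%:R * 'i%C * (\sum_(j < d) (k 0 j)%:C%C * g j w))]].
Proof.
have z (c x : Cplx R) : 0%:C%C * c * x = 0 by rewrite !mul0r.
split.
- move=> /= [Lu [Lv [_ [g [l [h1 h2 h3]]]]]]; split => //; exists g, l; split => //.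
  by apply: filterS h3 => w /(_ I) /= -> _; rewrite z addr0.
- move=> [Lu Lv [g [l [h1 h2 h3]]]]; split => //; split => //; split.
    rewrite (_ : (fun w => _) = fun=> 0); first exact: L2_cst.
    by apply/funext => w; rewrite z.
  exists g, l; split => //.
  by apply: filterS h3 => w /(_ I) /= -> _; rewrite z addr0.
Qed.

Section Sector.
Variables (F : R[i] -> R[i]) (Lam kap : R).
Hypothesis F_meas : forall f, cmeas f -> cmeas (fun w => F (f w)).
Hypothesis F0 : F 0 = 0.
Hypothesis Lam0 : 0 <= Lam.
Hypothesis F_lip : forall a b, nrm (F b - F a) <= Lam * nrm (b - a).
Hypothesis F_equiv : forall c a, nrm c = 1 -> F (c * a) = c * F a.
Hypothesis kap0 : 0 <= kap.
Hypothesis F_cone : forall a b, cone kap (conjc (F b - F a) * (b - a)).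

Definition ksq k : R := \sum_(j < d) (k 0 j) ^+ 2.

Lemma cone_inner_sum f (I : Type) (r : seq I) (X : I -> Om -> Cplx R) : L2 P f ->
  (forall j, L2 P (X j)) -> (forall j, cone kap (inner P f (X j))) ->
  L2 P (fun w => \sum_(j <- r) X j w) /\
  cone kap (inner P f (fun w => \sum_(j <- r) X j w)).
Proof.
move=> Lf LX cX; elim: r => [|j r [Lr cr]].
  have -> : (fun w => \sum_(j <- [::]) X j w) = (fun=> 0).
    by apply/funext => w; rewrite big_nil.
  split; first exact: L2_cst.
  by rewrite -[fun=> 0]/(0 : Om -> Cplx R) (ip0r H Lf); exact: cone0.
have -> : (fun w => \sum_(j <- j :: r) X j w) =
    (fun w => X j w + \sum_(j <- r) X j w).
  by apply/funext => w; rewrite big_cons.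
split; first exact: (L2D (LX j) Lr).
have -> := ipDr H Lf (LX j) Lr.
exact: coneD.
Qed.

(** Completing the square, [H_{k,0} + |k|²] is the sum over [j] of [-(D_j + i k_j)²], and the
    estimate in one direction applies to each term. *)
Lemma Hst0_cone k u v : Hst P tau V k 0 (u, v) ->
  cone kap (inner P (fun w => F (u w)) (fun w => v w + (ksq k)%:C%C * u w)).
Proof.
move=> /Hst0E[Lu Lv [g [l [gu gl vE]]]].
pose X j w := - l j w - 2%:R * 'i%C * ((k 0 j)%:C%C * g j w) +
  ((k 0 j) ^+ 2)%:C%C * u w.
have LX j : L2 P (X j).
  have [_ Lg Ll] := gl j.
  have [_ Lgj _] := gl j; have [_ Llj _] := gl j; have [_ Lgg _] := gu j.
  have -> : X j = (fun w => (-1) * l j w +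
     ((- (2%:R * 'i%C) * (k 0 j)%:C%C) * g j w + ((k 0 j) ^+ 2)%:C%C * u w)).
    by apply/funext => w; rewrite /X; ring.
  by apply: (L2D (L2Z _ Llj) (L2D (L2Z _ Lgg) (L2Z _ Lu))).
have LF := F_L2 F_meas F0 Lam0 F_lip Lu.
have [LS cS] := cone_inner_sum (index_enum 'I_d) LF LX (fun j =>
  second_derivative_cone tau_action F_meas F0 Lam0 F_lip F_equiv kap0 F_cone
   (k 0 j) (gu j) (gl j)).
rewrite (inner_aer LF _ LS)//; first exact: (L2D Lv (L2Z _ Lu)).
apply: filterS vE => w h _; rewrite h// /X big_split /= big_split /= !sumrN.
by rewrite /ksq rmorph_sum mulr_suml mulr_sumr.
Qed.

(** Both arguments of the pairing depend continuously on [(u, v)] in L², the first one by the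
    Lipschitz bound on [F], and the cone is closed. *)
Lemma clHst0_cone k u v : op_closure P (Hst P tau V k 0) (u, v) ->
  cone kap (inner P (fun w => F (u w)) (fun w => v w + (ksq k)%:C%C * u w)).
Proof.
move=> /(op_closureP (@Hst_L2 k 0))[/= Lu Lv huv].
pose K := (ksq k)%:C%C : R[i].
have LF f : L2 P f -> L2 P (fun w => F (f w)) by exact: (F_L2 F_meas F0 Lam0 F_lip).
pose A f g : Om -> Cplx R := fun w => g w + K * f w.
have LA f g : L2 P f -> L2 P g -> L2 P (A f g).
  by move=> Lf Lg; exact: (L2D Lg (L2Z K Lf)).
apply: cone_closed => // e e0.
pose C := Lam * hn (A u v) + (hn (fun w => F (u w)) + Lam) * (1 + nrm K) + 1.
have C0 : 0 < C.
  rewrite /C ltr_wpDl// addr_ge0// mulr_ge0// ?hn_ge0 ?addr_ge0 ?hn_ge0 ?nrm_ge0//.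
have e'0 : 0 < Num.min 1 (e / C) by rewrite lt_min ltr01 divr_gt0.
have [[a b] [/= Hab h1 h2]] := huv _ e'0; set e' := Num.min _ _ in h1 h2 e'0.
have [/= La Lb] := Hst_L2 Hab.
exists (inner P (fun w => F (a w)) (A a b)); first exact: Hst0_cone.
have LFd := L2B (LF _ Lu) (LF _ La); have LAd := L2B (LA _ _ Lu Lv) (LA _ _ La Lb).
have -> : inner P (fun w => F (u w)) (A u v) - inner P (fun w => F (a w)) (A a b) =
   inner P (fun w => F (u w) - F (a w)) (A u v) +
   inner P (fun w => F (a w)) (fun w => A u v w - A a b w).
  have e1 := ipBl H (LA _ _ Lu Lv) (LF _ Lu) (LF _ La).
  have e2 := ipBr H (LF _ La) (LA _ _ Lu Lv) (LA _ _ La Lb).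
  rewrite -[fun w => F (u w) - _]/((fun w => F (u w)) - (fun w => F (a w))) e1.
  rewrite -[fun w => A u v w - _]/(A u v - A a b) e2; ring.
apply: le_trans (nrmD _ _) _.
have b0 : hn (fun w => F (u w) - F (a w)) <= Lam * e'.
  apply: le_trans (F_hn_lip F_meas Lam0 F_lip Lu La) _.
  exact: ler_wpM2l (ltW h1).
have b1 : nrm (inner P (fun w => F (u w) - F (a w)) (A u v)) <= Lam * e' * hn (A u v).
  apply: le_trans (cauchy_schwarz H LFd (LA _ _ Lu Lv)) _.
  by apply: ler_wpM2r b0; exact: hn_ge0.
have b2 : hn (fun w => F (a w)) <= hn (fun w => F (u w)) + Lam.
  have -> : (fun w => F (a w)) = (fun w => F (u w) + (-1) * (F (u w) - F (a w))).
    by apply/funext => w; ring.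
  apply: le_trans (hnD (LF _ Lu) (L2Z (-1) LFd)) _.
  rewrite (hnZ (-1) LFd) nrmN nrm1 mul1r lerD2l (le_trans b0)//.
  by rewrite ler_piMr// ge_min lexx.
have b3 : hn (fun w => A u v w - A a b w) <= e' * (1 + nrm K).
  have -> : (fun w => A u v w - A a b w) = (fun w => (v w - b w) + K * (u w - a w)).
    by apply/funext => w; rewrite /A; ring.
  apply: le_trans (hnD (L2B Lv Lb) (L2Z K (L2B Lu La))) _.
  rewrite (hnZ K (L2B Lu La)) mulrDr mulr1 lerD ?(ltW h2)// mulrC.
  by apply: ler_wpM2r (ltW h1); exact: nrm_ge0.
have b4 : nrm (inner P (fun w => F (a w)) (fun w => A u v w - A a b w)) <=
    (hn (fun w => F (u w)) + Lam) * (e' * (1 + nrm K)).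
  apply: le_trans (cauchy_schwarz H (LF _ La) LAd) _.
  by apply: ler_pM => //; exact: hn_ge0.
have b5 : e' * C <= e by rewrite -ler_pdivlMr// ge_min lexx orbT.
apply: le_trans (lerD b1 b4) _; apply: le_trans b5; rewrite /C.
have -> : Lam * e' * hn (A u v) + (hn (fun w => F (u w)) + Lam) * (e' * (1 + nrm K))
  = e' * (Lam * hn (A u v) + (hn (fun w => F (u w)) + Lam) * (1 + nrm K)) by ring.
by rewrite ler_pM2l// lerDl.
Qed.

End Sector.
End StationaryOperator.

(** * Higher integrability of the free resolvent *)

Section TruncatedPower.
Variable R : realType.
Variables (n : nat) (N : R).
Hypothesis n0 : (0 < n)%N.
Hypothesis N0 : 0 < N.
Implicit Types (r s : R) (a b : R[i]).

Definition rt r : R := r `^ n%:R^-1.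

Lemma rt_ge0 r : 0 <= rt r. Proof. exact: powR_ge0. Qed.

Let nR0 : (n%:R : R) != 0. Proof. by rewrite pnatr_eq0 -lt0n. Qed.

Lemma rtK r : 0 <= r -> rt r ^+ n = r.
Proof.
by move=> r0; rewrite -powR_mulrn ?rt_ge0// -powRrM mulVf// powRr1.
Qed.

Lemma le_rt r s : 0 <= r -> r <= s -> rt r <= rt s.
Proof.
by move=> r0 rs; apply: ge0_ler_powR; rewrite ?nnegrE ?invr_ge0 ?ler0n ?(le_trans r0).
Qed.

Lemma rt_le r s : 0 <= r -> 0 <= s -> r <= s ^+ n -> rt r <= s.
Proof.
move=> r0 s0 rs; rewrite -(@ler_pXn2r _ n)// ?nnegrE ?rt_ge0//.
by rewrite rtK.
Qed.

Lemma rt_le1D r : 0 <= r -> rt r <= 1 + r.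
Proof.
move=> r0; apply: rt_le => //; first by rewrite addr_ge0.
rewrite (le_trans (_ : r <= 1 + r))//; first by rewrite lerDr.
by rewrite ler_eXnr// lerDl.
Qed.

(** The tangent bound for the concave function [r^(1/n)]. With [x = (s - r) / (n r)], Bernoulli's
    inequality gives [s / r = 1 + n x <= (1 + x)^n]; take n-th roots. *)
Lemma rt_concave r s : 0 <= r -> r <= s ->
  (rt s - rt r) * r <= n%:R^-1 * rt r * (s - r).
Proof.
rewrite le_eqVlt => /predU1P[<-|r0] rs.
  by rewrite mulr0 mulr_ge0 ?subr_ge0// mulr_ge0 ?rt_ge0// invr_ge0.
have s0 := lt_le_trans r0 rs.
set x := n%:R^-1 * (s - r) / r.
have x0 : 0 <= x.
  by rewrite /x !mulr_ge0 ?invr_ge0 ?subr_ge0// ltW.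
have h : rt s <= rt r * (1 + x).
  apply: rt_le; [exact: ltW|by rewrite mulr_ge0 ?rt_ge0 ?addr_ge0|].
  rewrite exprMn rtK ?(ltW r0)// addrC.
  have hb : 1 + x *+ n <= (x + 1) ^+ n.
    elim: n => [|m IH]; first by rewrite mulr0n expr0 addr0.
    rewrite exprS mulrDl mul1r mulrS addrA.
    have : x * 1 <= x * (x + 1) ^+ m.
      by rewrite ler_wpM2l// exprn_ege1// lerDr.
    rewrite mulr1; lra.
  apply: le_trans (ler_wpM2l (ltW r0) hb).
  have -> : r * (1 + x *+ n) = s; last by [].
  rewrite -mulr_natr /x; field; by rewrite nR0 gt_eqF.
have -> : n%:R^-1 * rt r * (s - r) = (rt r * (1 + x) - rt r) * r.
  by rewrite /x; field; rewrite nR0 gt_eqF.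
by rewrite ler_pM2r// lerB.
Qed.

Definition trunc r : R := Num.min (rt r) N.

Lemma trunc_ge0 r : 0 <= trunc r.
Proof. by rewrite le_min rt_ge0 ltW. Qed.

Lemma trunc_le r : trunc r <= N.
Proof. by rewrite ge_min lexx orbT. Qed.

Lemma le_trunc r s : 0 <= r -> r <= s -> trunc r <= trunc s.
Proof.
move=> r0 rs; rewrite le_min trunc_le andbT.
by apply: le_trans (le_rt r0 rs); rewrite ge_min lexx.
Qed.

Lemma trunc_concave r s : 0 <= r -> r <= s ->
  (trunc s - trunc r) * r <= n%:R^-1 * trunc r * (s - r).
Proof.
move=> r0 rs; rewrite /trunc; have [h|h] := leP N (rt r).
  have -> : Num.min (rt s) N = N.
    by apply/min_idPr; exact: le_trans h (le_rt r0 rs).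
  by rewrite subrr mul0r mulr_ge0 ?subr_ge0// mulr_ge0 ?invr_ge0// ltW.
apply: le_trans (rt_concave r0 rs); rewrite ler_wpM2r// lerB//.
by rewrite ge_min lexx.
Qed.

Definition Ftr a : R[i] := (trunc (nrm a))%:C%C * a.

Lemma Ftr_0 : Ftr 0 = 0. Proof. by rewrite /Ftr mulr0. Qed.

Lemma Ftr_equiv c a : nrm c = 1 -> Ftr (c * a) = c * Ftr a.
Proof. by move=> c1; rewrite /Ftr nrmM c1 mul1r mulrCA. Qed.

Lemma nrm_dist a b : nrm b - nrm a <= nrm (b - a).
Proof. by rewrite lerBlDr -{1}[b](subrK a) nrmD. Qed.

(** For [|a| <= |b|] the factor itself costs at most [N |b - a|], and by concavity its change costs
    [(trunc |b| - trunc |a|) |a|], again at most [N |b - a|]. *)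
Lemma Ftr_lip a b : nrm (Ftr b - Ftr a) <= 2 * N * nrm (b - a).
Proof.
wlog ab : a b / nrm a <= nrm b.
  move=> W; have [/W//|/ltW/W] := leP (nrm a) (nrm b).
  by rewrite -nrmN opprB -[nrm (a - b)]nrmN opprB.
have -> : Ftr b - Ftr a = (trunc (nrm b))%:C%C * (b - a) +
    (trunc (nrm b) - trunc (nrm a))%:C%C * a.
  by rewrite /Ftr rmorphB /=; ring.
apply: le_trans (nrmD _ _) _; rewrite !nrmM !nrmR.
rewrite ger0_norm ?trunc_ge0// ger0_norm ?subr_ge0 ?le_trunc ?nrm_ge0//.
have -> : 2 * N * nrm (b - a) = N * nrm (b - a) + N * nrm (b - a) by ring.
apply: lerD; first by rewrite ler_wpM2r ?nrm_ge0 ?trunc_le.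
apply: le_trans (trunc_concave (nrm_ge0 a) ab) _.
apply: le_trans (ler_wpM2r _ _) _; last 1 first.
- apply: ler_wpM2l (nrm_dist a b); exact: ltW.
- by rewrite subr_ge0.
- rewrite -[leRHS]mul1r ler_pM ?trunc_ge0 ?trunc_le ?invr_ge0//.
  by rewrite invf_le1 ?ltr0n// ler1n.
Qed.

(** Let [p <= q] be the factors at [|a| <= |b|]. The product is
    [p |b - a|² + (q - p) conj(b) (b - a)]. Its real part is at least [p |b - a|²]; its imaginary
    part is at most [(q - p) |a| |b - a|], which concavity bounds by [p |b - a|² / n]. *)
Lemma Ftr_cone a b : cone n%:R^-1 (conjc (Ftr b - Ftr a) * (b - a)).
Proof.
wlog ab : a b / nrm a <= nrm b.
  move=> W; have [/W//|/ltW/W] := leP (nrm a) (nrm b).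
  congr cone; apply: complex_eq; rewrite !reimE; ring.
set p := trunc (nrm a); set q := trunc (nrm b).
have pq : p <= q by rewrite le_trunc ?nrm_ge0.
have p0 : 0 <= p by exact: trunc_ge0.
have -> : conjc (Ftr b - Ftr a) * (b - a) =
  (p * sqn (b - a))%:C%C + (q - p)%:C%C * (conjc b * (b - a)).
  by rewrite /Ftr -/p -/q; apply: complex_eq; rewrite /sqn !reimE; ring.
change (`|complex.Im ((p * sqn (b - a))%:C%C + (q - p)%:C%C * (conjc b * (b - a)))|
  <= n%:R^-1 * complex.Re ((p * sqn (b - a))%:C%C + (q - p)%:C%C * (conjc b * (b - a)))).
have -> : complex.Im ((p * sqn (b - a))%:C%C + (q - p)%:C%C * (conjc b * (b - a))) =
   - (q - p) * complex.Im (conjc (b - a) * a).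
  by rewrite !reimE; ring.
have hre : p * sqn (b - a) <= complex.Re ((p * sqn (b - a))%:C%C +
    (q - p)%:C%C * (conjc b * (b - a))).
  have -> : complex.Re ((p * sqn (b - a))%:C%C + (q - p)%:C%C * (conjc b * (b - a)))
     = p * sqn (b - a) + (q - p) * (sqn b - complex.Re (conjc b * a)).
    by rewrite /sqn !reimE; ring.
  rewrite lerDl mulr_ge0 ?subr_ge0//.
  apply: le_trans (ler_norm _) _; apply: le_trans (normRe_le _) _.
  by rewrite nrmM nrmJ -sqr_nrm expr2 ler_wpM2l ?nrm_ge0.
apply: (@le_trans _ _ (n%:R^-1 * (p * sqn (b - a)))); last first.
  by rewrite ler_wpM2l ?invr_ge0.
rewrite normrM normrN [`|q - p|]ger0_norm ?subr_ge0//.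
have h1 : `|complex.Im (conjc (b - a) * a)| <= nrm a * nrm (b - a).
  by apply: le_trans (normIm_le _) _; rewrite nrmM nrmJ mulrC.
apply: (@le_trans _ _ ((q - p) * (nrm a * nrm (b - a)))).
  by apply: ler_wpM2l h1; rewrite subr_ge0.
rewrite mulrA -sqr_nrm expr2 !mulrA ler_wpM2r ?nrm_ge0//.
apply: le_trans (trunc_concave (nrm_ge0 a) ab) _.
rewrite ler_wpM2l ?nrm_dist//.
by rewrite mulr_ge0 ?invr_ge0.
Qed.

End TruncatedPower.

Section TruncatedPowerMeasurable.
Context {disp : measure_display} {Om : measurableType disp} {R : realType}.

Lemma rmeas_rt n (f : Om -> R) : rmeas f -> rmeas (fun w => rt n (f w)).
Proof. by move=> mf; apply: (measurableT_comp (measurable_powR _) mf). Qed.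

Lemma rmeas_trunc n N (f : Om -> R) : rmeas f -> rmeas (fun w => trunc n N (f w)).
Proof.
move=> mf; apply: measurable_minr; first exact: rmeas_rt.
exact: measurable_cst.
Qed.

Lemma Ftr_meas n N (f : Om -> Cplx R) : cmeas f -> cmeas (fun w => Ftr n N (f w)).
Proof.
move=> mf; apply: cmeasM => //; apply: cmeas_real.
by apply: rmeas_trunc; exact: rmeas_nrm.
Qed.

End TruncatedPowerMeasurable.

(** * A weighted bound uniform in the truncation *)

Section HigherIntegrability.
Context {disp : measure_display} {Om : measurableType disp} {R : realType}.
Variables (P : probability Om R) (d : nat) (tau : 'rV[R]_d -> Om -> Om).
Hypothesis tau_action : preserving_action P tau.
Variable V : Om -> R.
Implicit Types (k : 'rV[R]_d) (f g u v : Om -> Cplx R).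

Notation H := (L2_semi_hilbert P).

Lemma nrm_Expect_le f (h : Om -> R) : cint P f -> rint P h ->
  (forall w, nrm (f w) <= h w) -> nrm (Expect P f) <= 2 * \int[P]_w h w.
Proof.
move=> [fr fi] ih fh; apply: le_trans (nrm_le_ReIm _) _.
rewrite Re_Expect Im_Expect mulr_natl mulr2n.
apply: lerD.
- apply: le_trans (le_normr_Rintegral measurableT fr) _.
  apply: le_Rintegral => //; first exact: rint_norm.
  by move=> w _; apply: le_trans (normRe_le _) (fh w).
- apply: le_trans (le_normr_Rintegral measurableT fi) _.
  apply: le_Rintegral => //; first exact: rint_norm.
  by move=> w _; apply: le_trans (normIm_le _) (fh w).
Qed.

(** With [I] the pairing of [F u] with [u] and [J] that with [f], the sector condition yields [|Im
    z| I - |J| <= |J| + |Re z + |k|²| I / n]. The condition on [n] leaves half of [|Im z| I] on the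
    left, and [trunc <= 1 + |u|] makes the final bound independent of [N]. *)
Lemma truncated_bound k (z : R[i]) f u n (N : R) : (0 < n)%N -> 0 < N ->
  complex.Im z != 0 -> n%:R^-1 * `|complex.Re z + ksq k| <= `|complex.Im z| / 2 ->
  L2 P f -> rint P (fun w => sqn (f w) ^+ 2) ->
  op_closure P (Hst P tau V k 0) (u, fun w => f w + z * u w) ->
  rint P (fun w => (1 + nrm (u w)) * sqn (f w)) /\
  (\int[P]_w (trunc n N (nrm (u w)) * sqn (u w))%:E <=
   (64 / complex.Im z ^+ 2 * \int[P]_w ((1 + nrm (u w)) * sqn (f w)))%:E)%E.
Proof.
move=> n0 N0 z0 hz Lf f4 Gu.
have /(op_closureP (@Hst_L2 _ _ _ P d tau V k 0))[/= Lu _ _] := Gu.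
have /L2P[mu iu] := Lu; have /L2P[mf iF] := Lf.
set s := `|complex.Im z| in hz; have s0 : 0 < s by rewrite normr_gt0.
have mm := rmeas_trunc n N (rmeas_nrm mu).
have m0 w : 0 <= trunc n N (nrm (u w)) by exact: trunc_ge0.
have i1 : rint P (fun w => (1 + nrm (u w)) * sqn (f w)).
  have := rintD (rintD iF iu) f4; apply: rint_le.
    apply: measurable_funM; last exact: rmeas_sqn.
    by apply: measurable_funD; [exact: measurable_cst|exact: rmeas_nrm].
  move=> w; rewrite -!sqr_nrm; have := nrm_ge0 (u w); have := nrm_ge0 (f w).
  move: (nrm (u w)) (nrm (f w)) => x y y0 x0.
  rewrite ger0_norm; last by rewrite mulr_ge0 ?sqr_ge0// addr_ge0.
  have := sqr_ge0 (x - y ^+ 2); have := sqr_ge0 x; have := sqr_ge0 (y ^+ 2); nra.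
split => //.
have iI : rint P (fun w => trunc n N (nrm (u w)) * sqn (u w)).
  apply: rint_le (rintZ N iu) => [|w].
    by apply: measurable_funM => //; exact: rmeas_sqn.
  rewrite ger0_norm ?mulr_ge0 ?sqn_ge0// ler_wpM2r ?sqn_ge0//; exact: trunc_le.
have iK : rint P (fun w => trunc n N (nrm (u w)) * sqn (f w)).
  apply: rint_le i1 => [|w].
    by apply: measurable_funM => //; exact: rmeas_sqn.
  rewrite ger0_norm ?mulr_ge0 ?sqn_ge0// ler_wpM2r ?sqn_ge0//.
  apply: le_trans (rt_le1D n0 (nrm_ge0 _)).
  by rewrite ge_min lexx.
rewrite integral_Rintegral// lee_fin.
set I := \int[P]_w _; set B := \int[P]_w ((1 + _) * _).
pose Fu w := Ftr n N (u w).
have Lam0 : 0 <= 2 * N by rewrite mulr_ge0// ltW.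
have LFu : L2 P Fu.
  exact: (F_L2 (@Ftr_meas _ _ _ n N) (Ftr_0 n N) Lam0 (Ftr_lip n0 N0) Lu).
have := clHst0_cone tau_action (@Ftr_meas _ _ _ n N) (Ftr_0 n N) Lam0
  (Ftr_lip n0 N0) (@Ftr_equiv _ n N) _ (@Ftr_cone _ n N n0 N0) Gu.
rewrite invr_ge0 ler0n => /(_ isT).
rewrite -/Fu.
have -> : (fun w => f w + z * u w + (ksq k)%:C%C * u w) =
   (fun w => f w + (z + (ksq k)%:C%C) * u w) by apply/funext => w; ring.
have -> := ipDr H LFu Lf (L2Z (z + (ksq k)%:C%C) Lu).
have -> := ipZr H (z + (ksq k)%:C%C) LFu Lu.
have -> : inner P Fu u = I%:C%C.
  apply: complex_eq; rewrite ?Re_Expect ?Im_Expect.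
  - apply: eq_Rintegral => w _; rewrite /Fu /Ftr /sqn !reimE; ring.
  - rewrite -[RHS](_ : \int[P]_(w in setT) 0 = 0); last by rewrite Rintegral_cst// mul0r.
    apply: eq_Rintegral => w _; rewrite /Fu /Ftr !reimE; ring.
set J := inner P Fu f.
have I0 : 0 <= I by apply: Rintegral_ge0 => w _; rewrite mulr_ge0 ?sqn_ge0.
(* The weights are such that [2 |J|] consumes only half of the remaining [s I / 2]; the leading
   factor 2 comes from bounding real and imaginary parts separately. *)
have Jle : nrm J <= 2 * \int[P]_w (s / 16 * (trunc n N (nrm (u w)) * sqn (u w)) +
    4 / s * (trunc n N (nrm (u w)) * sqn (f w))).
  apply: nrm_Expect_le; first exact: cint_mulJ.
    by apply: rintD; exact: rintZ.
  move=> w; rewrite nrmM nrmJ /Fu /Ftr nrmM nrmR ger0_norm// -!sqr_nrm.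
  move: (m0 w) (nrm_ge0 (u w)) (nrm_ge0 (f w)).
  move: (trunc n N (nrm (u w))) => m; move: (nrm (u w)) (nrm (f w)) => x y h1 h2 h3.
  (* AM-GM: xy <= s x^2 / 16 + 4 y^2 / s *)
  have -> : s / 16 * (m * x ^+ 2) + 4 / s * (m * y ^+ 2) =
     m * x * y + m * ((s * x - 8 * y) ^+ 2 / (16 * s)).
    by field; rewrite gt_eqF.
  by rewrite lerDl mulr_ge0// divr_ge0 ?sqr_ge0// mulr_ge0// ltW.
rewrite RintegralD// in Jle; try exact: rintZ.
rewrite !RintegralZl// in Jle.
have KB : \int[P]_w (trunc n N (nrm (u w)) * sqn (f w)) <= B.
  apply: le_Rintegral => // w _; rewrite ler_wpM2r ?sqn_ge0//.
  apply: le_trans (rt_le1D n0 (nrm_ge0 _)).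
  by rewrite ge_min lexx.
set K := \int[P]_w _ in KB; rewrite -/I -/K in Jle.
rewrite /cone /= => hc.
have h1 := le_trans (normRe_le _) (lexx (nrm J)).
have h2 := le_trans (normIm_le _) (lexx (nrm J)).
have n1 : 0 <= (n%:R^-1 : R) <= 1.
  by rewrite invr_ge0 ler0n /= invf_le1 ?ltr0n// ler1n.
have key : s * I - nrm J <= nrm J + s / 2 * I.
  have : s * I <= `|complex.Im (J + (z + (ksq k)%:C%C) * I%:C%C)| + nrm J.
    rewrite -[s * I](_ : `|complex.Im z * I| = _); last by rewrite normrM [`|I|]ger0_norm.
    have -> : complex.Im z * I =
      complex.Im (J + (z + (ksq k)%:C%C) * I%:C%C) - complex.Im J.
      by rewrite !reimE; ring.
    by apply: le_trans (ler_normB _ _) _; rewrite lerD2l.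
  have : n%:R^-1 * complex.Re (J + (z + (ksq k)%:C%C) * I%:C%C) <= nrm J + s / 2 * I.
    have -> : complex.Re (J + (z + (ksq k)%:C%C) * I%:C%C) =
      complex.Re J + (complex.Re z + ksq k) * I by rewrite !reimE; ring.
    rewrite mulrDr; apply: lerD.
      apply: le_trans (ler_wpM2l _ (le_trans (ler_norm _) h1)) _.
        by case/andP: n1.
      by rewrite ler_piMl ?nrm_ge0//; case/andP: n1.
    by rewrite mulrA ler_wpM2r// (le_trans _ hz)// ler_wpM2l ?ler_norm//.
  move: hc; lra.
have h3 : s * I <= 64 / s * K.
  have := Jle; have -> : 64 / s * K = 16 * (4 / s * K) by field; rewrite gt_eqF.
  move: (4 / s * K) => q.
  have -> : s / 16 * I = s * I / 16 by ring.
  have : s / 2 * I = s * I / 2 by ring.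
  move: key; move: (s * I) (s / 2 * I) => x y; lra.
have -> : complex.Im z ^+ 2 = s ^+ 2 by rewrite real_normK ?num_real.
rewrite -(ler_pM2l s0); apply: le_trans h3 _.
have -> : s * (64 / s ^+ 2 * B) = 64 / s * B by field; rewrite gt_eqF.
by rewrite ler_wpM2l// divr_ge0// ltW.
Qed.

End HigherIntegrability.

(** * Polynomials in V, and multiplication by V after the free resolvent *)

Section VPolynomials.
Context {disp : measure_display} {Om : measurableType disp} {R : realType}.
Variables (P : probability Om R) (d : nat) (tau : 'rV[R]_d -> Om -> Om).
Hypothesis tau_action : preserving_action P tau.
Variable V : Om -> R.
Hypothesis V_meas : measurable_fun setT V.
Hypothesis V_moments : forall p : nat, P.-integrable setT (fun w => (V w ^+ p)%:E).
Implicit Types (k : 'rV[R]_d) (f g u v : Om -> Cplx R).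

Notation H := (L2_semi_hilbert P).

(** A class containing the V-polynomials, stable under products, sums and translations, that
    provides the fourth moments required by [truncated_bound]. *)
Definition all_moments f := cmeas f /\ forall p, rint P (fun w => sqn (f w) ^+ p).

Lemma all_moments_L2 f : all_moments f -> L2 P f.
Proof. by move=> [mf /(_ 1%N) h]; apply/L2P. Qed.

Lemma all_moments_cst (c : Cplx R) : all_moments (fun=> c).
Proof. by split; [exact: cmeas_cst|move=> p; exact: rint_cst]. Qed.

Lemma all_momentsM f g : all_moments f -> all_moments g ->
  all_moments (fun w => f w * g w).
Proof.
move=> [mf fi] [mg gi]; split; first exact: cmeasM.
move=> p; apply: (rint_le _ _ (rintD (fi (p * 2)%N) (gi (p * 2)%N))).
  by apply: measurable_funX; apply: rmeas_sqn; exact: cmeasM.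
move=> w; rewrite sqnM exprMn ger0_norm; last first.
  by rewrite mulr_ge0 ?exprn_ge0 ?sqn_ge0.
rewrite !exprM; move: (sqn (f w) ^+ p) (sqn (g w) ^+ p) => x y.
have := sqr_ge0 (x - y); have := sqr_ge0 x; have := sqr_ge0 y; nra.
Qed.

Lemma all_momentsD f g : all_moments f -> all_moments g ->
  all_moments (fun w => f w + g w).
Proof.
move=> [mf fi] [mg gi]; split; first exact: cmeasD.
move=> p; apply: (rint_le _ _ (rintZ (4 ^+ p) (rintD (fi p) (gi p)))).
  by apply: measurable_funX; apply: rmeas_sqn; exact: cmeasD.
move=> w; rewrite ger0_norm; last by rewrite exprn_ge0 ?sqn_ge0.
have := sqn2 (f w) (g w); move: (sqn_ge0 (f w)) (sqn_ge0 (g w)) (sqn_ge0 (f w + g w)).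
move: (sqn (f w + g w)) (sqn (f w)) (sqn (g w)) => z x y x0 y0 z0 h.
have hmax : z <= 4 * Num.max x y.
  have := le_max x x y; have := le_max y x y; rewrite !lexx orbT /=; lra.
have m0 : 0 <= Num.max x y by rewrite le_max x0.
apply: le_trans (_ : (4 * Num.max x y) ^+ p <= _).
  by rewrite lerXn2r ?nnegrE// mulr_ge0.
rewrite exprMn ler_wpM2l ?exprn_ge0//.
by have [_|_] := leP x y; rewrite ?lerDl ?lerDr exprn_ge0.
Qed.

Lemma all_moments_transl x f : all_moments f -> all_moments (transl tau x f).
Proof.
move=> [mf fi]; split; first exact: (cmeas_transl tau_action x mf).
by move=> p; exact: (tau_rint tau_action (- x) (fi p)).
Qed.

Lemma V_all_moments : all_moments (fun w => (V w)%:C%C).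
Proof.
split; first exact: cmeas_real.
move=> p; have := V_moments (2 * p)%N; congr (P.-integrable _ _).
by apply/funext => w /=; rewrite /sqn ReC ImC expr0n/= addr0 exprM.
Qed.

Lemma Vpoly_all_moments f : Vpoly tau V f -> all_moments f.
Proof.
move=> [n [a [m [x ->]]]].
have sumP (I : Type) (r : seq I) (h : I -> Om -> Cplx R) :
    (forall i, all_moments (h i)) -> all_moments (fun w => \sum_(i <- r) h i w).
  move=> hi; elim: r => [|i r IH].
    by under eq_fun do rewrite big_nil; exact: all_moments_cst.
  by under eq_fun do rewrite big_cons; exact: all_momentsD.
have prodP (I : Type) (r : seq I) (h : I -> Om -> Cplx R) :
    (forall i, all_moments (h i)) -> all_moments (fun w => \prod_(i <- r) h i w).
  move=> hi; elim: r => [|i r IH].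
    by under eq_fun do rewrite big_nil; exact: all_moments_cst.
  by under eq_fun do rewrite big_cons; exact: all_momentsM.
apply: sumP => j; apply: all_momentsM; first exact: all_moments_cst.
by apply: prodP => l; exact: (all_moments_transl (x j l) V_all_moments).
Qed.

Lemma Vpoly_L2 f : Vpoly tau V f -> L2 P f.
Proof. by move=> /Vpoly_all_moments/all_moments_L2. Qed.

Lemma Vpoly_cst (c : Cplx R) : Vpoly tau V (fun=> c).
Proof.
exists 0%N, (fun=> c), (fun=> 0%N), (fun _ _ => 0); apply/funext => w.
by rewrite big_ord_recl !big_ord0 addr0 mulr1.
Qed.

Lemma Vpoly_V : Vpoly tau V (fun w => (V w)%:C%C).
Proof.
exists 0%N, (fun=> 1), (fun=> 1%N), (fun _ _ => 0); apply/funext => w.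
by rewrite !big_ord_recl !big_ord0 addr0 mulr1 mul1r (transl0 tau_action).
Qed.

Lemma Vpoly_lin (c : Cplx R) f g : Vpoly tau V f -> Vpoly tau V g ->
  Vpoly tau V (fun w => c * f w + g w).
Proof.
move=> [n [a [m [x ->]]]] [n' [a' [m' [x' ->]]]].
exists (n + n'.+1)%N.
exists (fun j : 'I_(n.+1 + n'.+1) =>
  match fintype.split j with inl i => c * a i | inr i => a' i end).
exists (fun j : 'I_(n.+1 + n'.+1) =>
  match fintype.split j with inl i => m i | inr i => m' i end).
exists (fun j : 'I_(n.+1 + n'.+1) =>
  match fintype.split j with inl i => x i | inr i => x' i end).
apply/funext => w; rewrite (@big_split_ord _ _ _ n.+1 n'.+1) /=.
congr (_ + _).
- rewrite mulr_sumr; apply: eq_bigr => i _.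
  by rewrite (unsplitK (inl i)) mulrA.
- by apply: eq_bigr => i _; rewrite (unsplitK (inr i)).
Qed.

Lemma Vpoly_Proj f : Vpoly tau V f -> Vpoly tau V (Proj P f).
Proof.
move=> Vf; have := Vpoly_lin 1 Vf (Vpoly_cst (- Expect P f)).
by congr (Vpoly _ _ _); apply/funext => w; rewrite mul1r.
Qed.

Lemma Expect_Proj f : Vpoly tau V f -> Expect P (Proj P f) = 0.
Proof.
move=> Vf; have cf := L2_cint (Vpoly_L2 Vf).
have -> : Proj P f = (fun w => 1 * f w + (fun=> - Expect P f) w).
  by apply/funext => w; rewrite mul1r.
by rewrite (Expect_lin _ cf (cint_cst _ _)) Expect_cst mul1r subrr.
Qed.

(* [truncated_bound] with N tending to infinity puts [u] in L^(2+1/n), which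
   suffices as V has all moments. *)
Lemma mulV_resolvent_L2 k (z : R[i]) f u : complex.Im z != 0 -> all_moments f ->
  op_closure P (Hst P tau V k 0) (u, fun w => f w + z * u w) -> L2 P (mulV V u).
Proof.
move=> z0 mf Gu; have Lf := all_moments_L2 mf.
have /(op_closureP (@Hst_L2 _ _ _ P d tau V k 0))[/= Lu _ _] := Gu.
have /L2P[mu iu] := Lu.
set s := `|complex.Im z|; have s0 : 0 < s by rewrite normr_gt0.
set A := `|complex.Re z + ksq k|.
have q0 : 0 <= 2 * A / s by rewrite divr_ge0 ?(ltW s0)// mulr_ge0 ?normr_ge0.
(* [n > 2 A / s] is the absorption condition of [truncated_bound]. *)
have hb := archi_boundP q0; set n := Num.bound _ in hb.
have nR0 : (0 : R) < n%:R by exact: le_lt_trans hb.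
have n0 : (0 < n)%N by rewrite -(ltr_nat R).
have hn : n%:R^-1 * A <= s / 2.
  rewrite mulrC ler_pdivrMr//.
  by move: hb; rewrite ltr_pdivrMr// => /ltW; lra.
set B := 64 / complex.Im z ^+ 2 * \int[P]_w ((1 + nrm (u w)) * sqn (f w)).
have f4 : rint P (fun w => sqn (f w) ^+ 2) by case: mf.
have bd N : (\int[P]_w (trunc n N.+1%:R (nrm (u w)) * sqn (u w))%:E <= B%:E)%E.
  by have [] := truncated_bound tau_action n0 (ltr0Sn R N) z0 hn Lf f4 Gu.
have mt : rmeas (fun w => rt n (nrm (u w)) * sqn (u w)).
  by apply: measurable_funM; [apply: rmeas_rt; exact: rmeas_nrm|exact: rmeas_sqn].
have t0 w : 0 <= rt n (nrm (u w)) * sqn (u w) by rewrite mulr_ge0 ?rt_ge0 ?sqn_ge0.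
have it : rint P (fun w => rt n (nrm (u w)) * sqn (u w)).
  apply: rint_ge0 => //; apply: le_lt_trans (ltry B).
  apply: (fatou_le (h := fun N w => trunc n N.+1%:R (nrm (u w)) * sqn (u w))) bd => //.
  - move=> N; apply: measurable_funM; last exact: rmeas_sqn.
    by apply: rmeas_trunc; exact: rmeas_nrm.
  - by move=> N w; rewrite mulr_ge0 ?trunc_ge0 ?sqn_ge0.
  - apply: aeW => w; apply: (@cvg_trans _ ((fun=> rt n (nrm (u w)) * sqn (u w)) @ \oo)).
      apply: near_eq_cvg; exists (Num.bound (rt n (nrm (u w)))) => // N /= hN.
      congr (_ * _); apply/esym/min_idPl.
      apply: ltW; apply: lt_le_trans (archi_boundP (rt_ge0 _ _)) _.
      by rewrite ler_nat (leq_trans hN).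
    exact: cvg_cst.
apply/L2P; split; first by apply: cmeasM => //; exact: cmeas_real.
(* If [V² <= |u|^(1/n)], then [V² |u|²] is dominated by [|u|^(2+1/n)]. Otherwise [|u| < |V|^(2n)],
   and it is dominated by this moment. *)
have iV : rint P (fun w => V w ^+ (2 * (1 + 2 * n))) by exact: V_moments.
apply: rint_le (rintD it iV) => [|w].
  by apply: rmeas_sqn; apply: cmeasM => //; exact: cmeas_real.
rewrite /mulV sqnM ger0_norm ?mulr_ge0 ?sqn_ge0//.
have -> : sqn (V w)%:C%C = V w ^+ 2 by rewrite /sqn ReC ImC expr0n addr0.
rewrite exprM exprD expr1 exprM.
have := sqr_ge0 (V w); move: (V w ^+ 2) => q qge0.
rewrite -sqr_nrm; have := nrm_ge0 (u w); move: (nrm (u w)) => r r0.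
have [h|h] := leP q (rt n r).
  apply: le_trans (_ : rt n r * r ^+ 2 <= _).
    by rewrite ler_wpM2r ?sqr_ge0.
  by rewrite lerDl mulr_ge0// exprn_ge0 ?sqr_ge0.
apply: le_trans (_ : q * q ^+ 2 ^+ n <= _); last first.
  by rewrite lerDr mulr_ge0 ?rt_ge0 ?sqr_ge0.
rewrite ler_wpM2l// -exprM mulnC exprM lerXn2r ?nnegrE ?exprn_ge0//.
rewrite -(rtK n0 r0) lerXn2r ?nnegrE ?rt_ge0//.
exact: ltW.
Qed.

End VPolynomials.

(** * Resolvent identities *)

Section ResolventIdentities.
Context {disp : measure_display} {Om : measurableType disp} {R : realType}.
Variables (P : probability Om R) (d : nat) (tau : 'rV[R]_d -> Om -> Om).
Hypothesis tau_action : preserving_action P tau.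
Variable V : Om -> R.
Hypothesis V_meas : measurable_fun setT V.
Hypothesis V_moments : forall p : nat, P.-integrable setT (fun w => (V w ^+ p)%:E).
Variables (k : 'rV[R]_d) (lam0 : R).
Hypothesis lam0_gt0 : 0 < lam0.
Hypothesis H_sa : forall lam : R, 0 <= lam < lam0 ->
  op_selfadjoint P (op_closure P (Hst P tau V k lam)).
Implicit Types (f g u v phi psi : Om -> Cplx R) (z : R[i]) (lam : R).

Notation H := (L2_semi_hilbert P).
Notation hn := (hn P).
Notation res := (resolvent P tau V k).
Notation clH lam := (clG P (Hst P tau V k lam)).
Notation Vc := (fun w => (V w)%:C%C).

Let in0 : (0 : R) <= 0 < lam0. Proof. by rewrite lexx. Qed.

Let HL2 lam q : Hst P tau V k lam q -> L2 P q.1 /\ L2 P q.2.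
Proof. exact: Hst_L2. Qed.

Let clHE lam (hl : 0 <= lam < lam0) := clGE (H_sa hl).

Lemma Vc_L2 : L2 P Vc.
Proof. exact: all_moments_L2 (V_all_moments V_meas V_moments). Qed.

Lemma is_grad_cst (c : Cplx R) j : is_grad P tau j (fun=> c) (fun=> 0).
Proof.
split; [exact: L2_cst|exact: L2_cst|].
have -> : (fun h : R => sqnorm P (fun w => (h^-1)%:C%C *
   (transl tau (h *: delta_mx 0 j) (fun=> c) w - c) - 0)) = (fun=> 0%E).
  apply/funext => h; rewrite /sqnorm; under eq_integral => w _.
    rewrite /transl subrr mulr0 subr0 /= expr0n /= addr0; over.
  by rewrite integral0.
exact: cvg_cst.
Qed.

Lemma one_in_domain lam : clH lam (fun=> 1) (fun w => lam%:C%C * (V w)%:C%C).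
Proof.
apply: (sub_closure (@HL2 lam)).
have LV := L2Z (lam%:C%C) Vc_L2.
split; first exact: L2_cst.
split; first exact: LV.
split; first by move: LV; congr L2; apply/funext => w /=; rewrite mulr1.
exists (fun _ _ => 0), (fun _ _ => 0); split; [by move=> j; exact: is_grad_cst..|].
apply: aeW => w _ /=; rewrite big1// big1; last by move=> j _; rewrite mulr0.
by rewrite oppr0 mulr0 subr0 add0r mulr1.
Qed.

Lemma inner_1 f : inner P (fun=> 1) f = Expect P f.
Proof. by congr Expect; apply/funext => w; rewrite conjc1 mul1r. Qed.

Lemma inner_V f : inner P Vc f = Expect P (mulV V f).
Proof. by congr Expect; apply/funext => w; rewrite conjc_real. Qed.

Lemma res_P lam z f : 0 <= lam < lam0 -> complex.Im z != 0 -> L2 P f ->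
  clH lam (res lam z f) (fun w => f w + z * res lam z f w).
Proof. by move=> hl z0 Lf; apply: (op_resolventP (H_sa hl)). Qed.

Lemma res_L2 lam z f : 0 <= lam < lam0 -> complex.Im z != 0 -> L2 P f ->
  L2 P (res lam z f).
Proof. by move=> hl z0 Lf; apply: (op_resolvent_L2 (H_sa hl)). Qed.

Lemma res_adj lam z f g : 0 <= lam < lam0 -> complex.Im z != 0 ->
  L2 P f -> L2 P g ->
  inner P g (res lam z f) = inner P (res lam (conjc z) g) f.
Proof. by move=> hl z0 Lf Lg; apply: (op_resolvent_adj (H_sa hl)). Qed.

Lemma Im_conjc_neq0 z : complex.Im z != 0 -> complex.Im (conjc z) != 0.
Proof. by rewrite Im_conjc oppr_eq0. Qed.

Lemma res_conjc lam z f g : 0 <= lam < lam0 -> complex.Im z != 0 ->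
  L2 P f -> L2 P g ->
  inner P g (res lam z f) = conjc (inner P f (res lam (conjc z) g)).
Proof.
move=> hl z0 Lf Lg; rewrite res_adj//.
by rewrite (sh_ipC H Lf (res_L2 hl (Im_conjc_neq0 z0) Lg)).
Qed.

Lemma res_pair_one lam z phi : 0 <= lam < lam0 -> complex.Im z != 0 -> L2 P phi ->
  lam%:C%C * inner P Vc (res lam z phi) =
  Expect P phi + z * inner P (fun=> 1) (res lam z phi).
Proof.
move=> hl z0 Lphi; have Lr := res_L2 hl z0 Lphi.
have := G_sym (clHE hl) (one_in_domain lam) (res_P hl z0 Lphi).
have L1 : L2 P (fun=> 1) by exact: L2_cst.
have -> := ipDr H L1 Lphi (L2Z z Lr); have -> := ipZr H z L1 Lr.
by have -> := ipZl H (lam%:C%C) Lr Vc_L2; rewrite conjc_real inner_1 => ->.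
Qed.

Lemma res_pair_one_adj lam z phi : 0 <= lam < lam0 -> complex.Im z != 0 ->
  L2 P phi ->
  lam%:C%C * inner P phi (res lam z Vc) =
  conjc (Expect P phi) + z * inner P phi (res lam z (fun=> 1)).
Proof.
move=> hl z0 Lphi; have LV := Vc_L2.
have L1 : L2 P (fun=> 1) by exact: L2_cst.
have := res_pair_one hl (Im_conjc_neq0 z0) Lphi.
rewrite (res_conjc hl z0 LV Lphi) (res_conjc hl z0 L1 Lphi) => h.
by rewrite -{1}(conjc_real lam) -rmorphM h rmorphD rmorphM /= conjcK.
Qed.

(** By [clG_of_core] it suffices to test against core pairs [(a, b)] of [H_lam]. There [lam V a] is
    in L² by definition, and subtracting it from [b] leaves a core pair of [H_0]. *)
Lemma perturb_domain lam u v : 0 <= lam < lam0 -> L2 P (mulV V u) ->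
  clH 0 u v -> clH lam u (fun w => v w + lam%:C%C * mulV V u w).
Proof.
move=> hl LVu Guv; have /(clHE in0)[Lu Lv _] := Guv.
apply: (clG_of_core (@HL2 lam) (H_sa hl)) => //; first exact: (L2D Lv (L2Z _ LVu)).
move=> a b Gab.
have [/= La [Lb [LVa [g [l [ga gl bE]]]]]] := Gab.
pose b0 w := b w - lam%:C%C * (V w)%:C%C * a w.
have Lb0 : L2 P b0 by exact: (L2B Lb LVa).
have G0 : Hst P tau V k 0 (a, b0).
  apply/Hst0E; split => //; exists g, l; split => //.
  apply: filterS bE => w /(_ I) /= hb _; rewrite /b0 hb; ring.
have key := G_sym (clHE in0) Guv (sub_closure (@HL2 0) G0).
have -> : inner P u b = inner P u (fun w => b0 w + lam%:C%C * (V w)%:C%C * a w).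
  by congr inner; apply/funext => w; rewrite /b0 subrK.
have -> := ipDr H Lu Lb0 LVa; rewrite key.
have -> := ipDl H La Lv (L2Z lam%:C%C LVu); congr (_ + _).
congr Expect; apply/funext => w; rewrite /mulV !conjcM !conjc_real; ring.
Qed.

Lemma mulV_res_L2 z f : complex.Im z != 0 -> all_moments P f ->
  L2 P (mulV V (res 0 z f)).
Proof.
move=> z0 mf; have Lf := all_moments_L2 mf.
exact: (mulV_resolvent_L2 tau_action V_meas V_moments z0 mf (res_P in0 z0 Lf)).
Qed.

(** The second resolvent identity with the perturbed resolvent moved onto [psi]: [V] then acts only
    on a free resolvent, where the product is known to be in L². *)
Lemma res_perturb lam z phi psi : 0 <= lam < lam0 -> complex.Im z != 0 ->
  all_moments P phi -> L2 P psi ->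
  inner P psi (res lam z phi) - inner P psi (res 0 z phi) =
  - (lam%:C%C * inner P (res lam (conjc z) psi) (mulV V (res 0 z phi))).
Proof.
move=> hl z0 mphi Lpsi; have Lphi := all_moments_L2 mphi.
have z0' := Im_conjc_neq0 z0.
have LVu := mulV_res_L2 z0 mphi; have Lu := res_L2 in0 z0 Lphi.
have Gu := perturb_domain hl LVu (res_P in0 z0 Lphi).
have Gv := res_P hl z0' Lpsi; have Lv := res_L2 hl z0' Lpsi.
rewrite (res_adj hl z0 Lphi Lpsi).
set u := res 0 z phi in LVu Lu Gu *; set v := res lam (conjc z) psi in Gv Lv *.
have := G_sym (clHE hl) Gv Gu.
have -> := ipDr H Lv (L2D Lphi (L2Z z Lu)) (L2Z lam%:C%C LVu).
have -> := ipDr H Lv Lphi (L2Z z Lu).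
have -> := ipZr H z Lv Lu; have -> := ipZr H lam%:C%C Lv LVu.
have -> := ipDl H Lu Lpsi (L2Z (conjc z) Lv).
have -> := ipZl H (conjc z) Lu Lv; rewrite conjcK => h.
have -> : inner P psi u = inner P v phi + lam%:C%C * inner P v (mulV V u).
  by apply: (addIr (z * inner P v u)); rewrite -h; ring.
ring.
Qed.

(** [(H_lam - z) (R_0 psi - R_lam psi) = lam V R_0 psi], and the resolvent has norm at most
    [1 / |Im z|]. *)
Lemma res_dist lam z psi : 0 <= lam < lam0 -> complex.Im z != 0 ->
  all_moments P psi ->
  `|complex.Im z| * hn (fun w => res 0 z psi w - res lam z psi w) <=
  lam * hn (mulV V (res 0 z psi)).
Proof.
move=> hl z0 mpsi; have Lpsi := all_moments_L2 mpsi.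
have LVu := mulV_res_L2 z0 mpsi.
have Gu := perturb_domain hl LVu (res_P in0 z0 Lpsi).
have Gv := res_P hl z0 Lpsi.
set u := res 0 z psi in LVu Gu *; set v := res lam z psi in Gv *.
have Gd := G_lin H (clHE hl) (-1) Gv Gu.
have l0 : 0 <= lam by case/andP: hl.
have -> : lam * hn (mulV V u) = hn (fun w => lam%:C%C * mulV V u w).
  by rewrite (hnZ lam%:C%C LVu) nrmR ger0_norm.
have -> : (fun w => u w - v w) = (-1) *: v + u.
  by apply/funext => w; rewrite -[RHS]/((-1) * v w + u w); ring.
apply: (resolvent_norm_le H (clHE hl) (z := z)).
move: Gd; congr (clH lam _ _); apply/funext => w.
rewrite -[LHS]/((-1) * (psi w + z * v w) + (psi w + z * u w + lam%:C%C * mulV V u w)).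
rewrite -[RHS]/(lam%:C%C * mulV V u w + z * ((-1) * v w + u w)).
ring.
Qed.

(** [res_perturb], followed by [res_dist] for the perturbed resolvent that remains. The constant
    contains [1 / |Im z|], which forces the expansion in [lam] to be made at fixed [z]. *)
Lemma res_taylor z phi psi : complex.Im z != 0 ->
  all_moments P phi -> all_moments P psi ->
  exists C : R, forall lam, 0 <= lam < lam0 ->
  nrm (inner P psi (res lam z phi) - inner P psi (res 0 z phi) +
    lam%:C%C * inner P (res 0 (conjc z) psi) (mulV V (res 0 z phi))) <= C * lam ^+ 2.
Proof.
move=> z0 mphi mpsi.
have Lphi := all_moments_L2 mphi; have Lpsi := all_moments_L2 mpsi.
have z0' := Im_conjc_neq0 z0.
have LVu := mulV_res_L2 z0 mphi.
exists (hn (mulV V (res 0 (conjc z) psi)) / `|complex.Im z| * hn (mulV V (res 0 z phi))).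
move=> lam hl; rewrite (res_perturb hl z0 mphi Lpsi).
have L1 := res_L2 in0 z0' Lpsi; have L2' := res_L2 hl z0' Lpsi.
have -> : - (lam%:C%C * inner P (res lam (conjc z) psi) (mulV V (res 0 z phi))) +
    lam%:C%C * inner P (res 0 (conjc z) psi) (mulV V (res 0 z phi)) =
  lam%:C%C * inner P (fun w => res 0 (conjc z) psi w - res lam (conjc z) psi w)
    (mulV V (res 0 z phi)).
  transitivity (lam%:C%C * (inner P (res 0 (conjc z) psi) (mulV V (res 0 z phi)) -
    inner P (res lam (conjc z) psi) (mulV V (res 0 z phi)))); first by rewrite mulrBr addrC.
  by congr (_ * _); exact/esym/(ipBl H LVu L1 L2').
have l0 : 0 <= lam by case/andP: hl.
rewrite nrmM nrmR ger0_norm//.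
have iz : 0 < `|complex.Im z| by rewrite normr_gt0.
have h1 := cauchy_schwarz H (L2B L1 L2') LVu.
have h2 := res_dist hl z0' mpsi.
move: h1 h2; rewrite Im_conjc normrN.
set D := hn (fun w => _); move: (hn (mulV V (res 0 (conjc z) psi))) => B.
set A := nrm _.
rewrite -[hnorm _ (fun w => _ - _)]/D -[hnorm _ (mulV _ _)]/(hn (mulV V (res 0 z phi))).
move: A D (hn (mulV V (res 0 z phi))) (hn_ge0 P (mulV V (res 0 z phi))).
move=> A D E E0 h1 h2.
have h3 : D <= lam * B / `|complex.Im z| by rewrite ler_pdivlMr// mulrC.
apply: le_trans (ler_wpM2l l0 (le_trans h1 (ler_wpM2r E0 h3))) _.
by rewrite le_eqVlt; apply/orP; left; apply/eqP; ring.
Qed.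

End ResolventIdentities.

(** * One-variable asymptotics *)

Section Osmall.
Variable R : realType.
Implicit Types (r s b : R -> Cplx R) (n : nat) (e dl l : R).

Definition near0 (Q : R -> Prop) := exists2 dl : R, 0 < dl & forall l, 0 < l < dl -> Q l.

Lemma near0_and (Q Q' : R -> Prop) : near0 Q -> near0 Q' -> near0 (fun l => Q l /\ Q' l).
Proof.
move=> [d d0 h] [d' d0' h']; exists (Num.min d d'); first by rewrite lt_min d0.
by move=> l /andP[l0]; rewrite lt_min => /andP[? ?]; split; [apply: h|apply: h']; rewrite l0.
Qed.

Lemma near0_mono (Q Q' : R -> Prop) : (forall l, 0 < l -> Q l -> Q' l) -> near0 Q -> near0 Q'.
Proof.
by move=> QQ [d d0 h]; exists d => // l hl; case/andP: (hl) => l0 _; apply: QQ => //; exact: h.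
Qed.

Lemma near0_lt e : 0 < e -> near0 (fun l => l < e).
Proof. by move=> e0; exists e => // l /andP[]. Qed.

(** [littleo_pow] with real radii and moduli; the two agree by [littleo_powP]. *)
Definition osmall n r := forall e, 0 < e -> near0 (fun l => nrm (r l) <= e * l ^+ n).

Definition bounded0 b := exists C : R, near0 (fun l => nrm (b l) <= C).

Lemma bounded0_pos b : bounded0 b -> exists2 C : R, 0 < C & near0 (fun l => nrm (b l) <= C).
Proof.
move=> [C h]; exists (Num.max C 1); first by rewrite lt_max ltr01 orbT.
by apply: near0_mono h => l _ h; rewrite (le_trans h)// le_max lexx.
Qed.

Lemma osmall_near n r s : near0 (fun l => r l = s l) -> osmall n r -> osmall n s.
Proof.
move=> rs or e e0; apply: near0_mono (near0_and rs (or e e0)).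
by move=> l _ [<-].
Qed.

Lemma osmall0 n : osmall n (fun=> 0).
Proof.
move=> e e0; exists 1 => // l /andP[l0 _].
by rewrite nrm0 mulr_ge0 ?exprn_ge0// ltW.
Qed.

Lemma osmallD n r s : osmall n r -> osmall n s -> osmall n (fun l => r l + s l).
Proof.
move=> hr hs e e0; have e2 : 0 < e / 2 by rewrite divr_gt0.
apply: near0_mono (near0_and (hr _ e2) (hs _ e2)) => l _ [h1 h2].
apply: le_trans (nrmD _ _) _; apply: le_trans (lerD h1 h2) _.
by rewrite -mulrDl -splitr.
Qed.

Lemma osmallM n r b : bounded0 b -> osmall n r -> osmall n (fun l => b l * r l).
Proof.
move=> /bounded0_pos[C C0 hb] hr e e0.
apply: near0_mono (near0_and hb (hr _ (divr_gt0 e0 C0))) => l _ [h1 h2].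
rewrite nrmM; apply: le_trans (ler_pM (nrm_ge0 _) (nrm_ge0 _) h1 h2) _.
by rewrite mulrA [C * _]mulrC divfK// gt_eqF.
Qed.

Lemma osmallM_pow m n r s : (exists C, near0 (fun l => nrm (r l) <= C * l ^+ m)) ->
  osmall n s -> osmall (m + n) (fun l => r l * s l).
Proof.
move=> [C hr] hs e e0; have C1 : 0 < `|C| + 1 by rewrite ltr_wpDl.
apply: near0_mono (near0_and hr (hs _ (divr_gt0 e0 C1))) => l l0 [h1 h2].
rewrite nrmM; have h3 : nrm (r l) <= (`|C| + 1) * l ^+ m.
  apply: le_trans h1 _; rewrite ler_wpM2r ?exprn_ge0 ?(ltW l0)//.
  by rewrite (le_trans (ler_norm C))// lerDl.
apply: le_trans (ler_pM (nrm_ge0 _) (nrm_ge0 _) h3 h2) _.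
rewrite exprD le_eqVlt; apply/orP; left; apply/eqP.
by field; rewrite gt_eqF.
Qed.

Lemma osmall_cst_mul n (c : Cplx R) r : osmall n r -> osmall n (fun l => c * r l).
Proof. by apply: osmallM; exists (nrm c); exists 1. Qed.

Lemma osmallN n r : osmall n r -> osmall n (fun l => - r l).
Proof.
by move=> h e e0; apply: near0_mono (h e e0) => l _; rewrite nrmN.
Qed.

Lemma osmallB n r s : osmall n r -> osmall n s -> osmall n (fun l => r l - s l).
Proof. by move=> hr hs; apply: osmallD => //; exact: osmallN. Qed.

Lemma osmallJ n r : osmall n r -> osmall n (fun l => conjc (r l)).
Proof. by move=> h e e0; apply: near0_mono (h e e0) => l _; rewrite nrmJ. Qed.

Lemma osmall_weak m n r : (n <= m)%N -> osmall m r -> osmall n r.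
Proof.
move=> nm h e e0; apply: near0_mono (near0_and (near0_lt ltr01) (h e e0)) => l l0 [l1].
move=> /le_trans; apply; rewrite ler_wpM2l ?(ltW e0)//.
by rewrite ler_wiXn2l ?(ltW l0) ?(ltW l1).
Qed.

Lemma osmall_pow m n b : (n < m)%N -> bounded0 b -> osmall n (fun l => (l ^+ m)%:C%C * b l).
Proof.
move=> nm /bounded0_pos[C C0 hb].
suff h : osmall n (fun l => (l ^+ n.+1)%:C%C * b l).
  have -> : (fun l => (l ^+ m)%:C%C * b l) =
      (fun l => (l ^+ (m - n.+1))%:C%C * ((l ^+ n.+1)%:C%C * b l)).
    by apply/funext => l; rewrite mulrA -rmorphM -exprD subnK.
  apply: osmallM h; exists 1, 1 => // l /andP[l0 l1].
  by rewrite nrmR ger0_norm ?exprn_ge0 ?(ltW l0)// exprn_ile1// ltW.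
move=> e e0.
apply: near0_mono (near0_and (near0_lt (divr_gt0 e0 C0)) hb) => l l0 [l1 h].
rewrite nrmM nrmR ger0_norm ?exprn_ge0 ?(ltW l0)// exprSr -mulrA mulrC.
rewrite ler_wpM2r ?exprn_ge0 ?(ltW l0)//.
by apply: le_trans (ler_wpM2l (ltW l0) h) _; rewrite -ler_pdivlMr// ltW.
Qed.

Lemma osmall_pow_cst0 n (c : Cplx R) : osmall n (fun l => (l ^+ n)%:C%C * c) -> c = 0.
Proof.
move=> h; apply/nrm_eq0/eqP; rewrite eq_le nrm_ge0 andbT.
apply/ler_addgt0Pr => e e0; rewrite add0r; have [d d0 hd] := h e e0.
have h2 : 0 < d / 2 < d by rewrite divr_gt0//= ltr_pdivrMr// ltr_pMr// ltr1n.
have := hd _ h2; case/andP: h2 => h2 _.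
rewrite nrmM nrmR ger0_norm ?exprn_ge0 ?(ltW h2)// mulrC ler_pM2r//.
exact: exprn_gt0.
Qed.

Lemma osmall_bounded0 r (c : Cplx R) : osmall 0 (fun l => r l - c) -> bounded0 r.
Proof.
move=> /(_ 1 ltr01) h; exists (1 + nrm c); apply: near0_mono h => l _.
rewrite expr0 mulr1 => h; rewrite -[r l](subrK c).
by apply: le_trans (nrmD _ _) _; rewrite lerD2r.
Qed.

Lemma osmallV r (c : Cplx R) : c != 0 -> osmall 0 (fun l => r l - c) ->
  near0 (fun l => r l != 0) /\ bounded0 (fun l => (r l)^-1).
Proof.
move=> c0 h; have n0 : 0 < nrm c.
  by rewrite lt_neqAle nrm_ge0 andbT eq_sym; apply: contra c0 => /eqP/nrm_eq0 ->.
have {}h : near0 (fun l => nrm c / 2 <= nrm (r l)).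
  have n2 : 0 < nrm c / 2 by rewrite divr_gt0.
  apply: near0_mono (h _ n2) => l _; rewrite expr0 mulr1 => hl.
  have : nrm c <= nrm (r l - c) + nrm (r l).
    rewrite -[nrm (r l - c)]nrmN opprB; apply: le_trans (nrmD _ _).
    by rewrite subrK.
  lra.
split; first apply: near0_mono h => l _ hl.
  by apply/eqP => rl; move: hl; rewrite rl nrm0; lra.
exists (nrm c / 2)^-1; apply: near0_mono h => l _ hl.
by rewrite nrmV lef_pV2 ?posrE ?(lt_le_trans _ hl)// divr_gt0.
Qed.

Lemma cvg_at_right_nrm (f : R -> Cplx R) (c : Cplx R) :
  f l @[l --> (0 : R)^'+] --> c <-> (forall e, 0 < e -> near0 (fun l => nrm (f l - c) < e)).
Proof.
split.
- move=> /cvgrPdist_lt fc e e0.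
  have e0' : (0 : R[i]) < e%:C%C by rewrite ltcR.
  have [d/= d0 h] := fc _ e0'; exists d => // l /andP[l0 ld].
  have := h l; rewrite /= sub0r normrN gtr0_norm// => /(_ ld l0).
  by rewrite nrmE ltcR -nrmN opprB.
- move=> h; apply/cvgrPdist_lt => e e0.
  have er : e \is Num.real by exact: gtr0_real.
  have eE := RRe_real er; rewrite -eE ltcR in e0.
  have [d d0 hd] := h _ e0; exists d => //= l; rewrite /= sub0r normrN => hl l0.
  rewrite -eE nrmE ltcR -nrmN opprB; apply: hd.
  by rewrite l0 -(gtr0_norm l0).
Qed.

Lemma littleo_powP n r : littleo_pow n r <-> osmall n r.
Proof.
have nE l : 0 < l -> nrm (((l ^+ n)^-1)%:C%C * r l - 0) = nrm (r l) / l ^+ n.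
  move=> l0; rewrite subr0 nrmM nrmR ger0_norm ?invr_ge0 ?exprn_ge0 ?(ltW l0)//.
  by rewrite mulrC.
split.
- move=> /cvg_at_right_nrm h e e0; apply: near0_mono (h e e0) => l l0.
  by rewrite nE// ltr_pdivrMr ?exprn_gt0// => /ltW.
- move=> h; apply/cvg_at_right_nrm => e e0.
  apply: near0_mono (h (e / 2) (divr_gt0 e0 (ltr0Sn _ 1))) => l l0 hl.
  rewrite nE// ltr_pdivrMr ?exprn_gt0//; apply: le_lt_trans hl _.
  by rewrite ltr_pM2r ?exprn_gt0// ltr_pdivrMr// ltr_pMr// ltr1n.
Qed.

End Osmall.

(** * Taylor expansions in the coupling constant *)

Section Taylor.
Variables (R : realType) (l0 : R).
Implicit Types (f : R -> Cplx R) (e : R).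

Lemma fam_cvg_nrm (U : choiceType) (fam : set (set U)) (F : set_system (U -> Cplx R))
    (FF : Filter F) (g : U -> Cplx R) A : {family fam, F --> g} -> fam A ->
  forall e : R, 0 < e -> \forall f \near F, forall u, A u -> nrm (f u - g u) < e.
Proof.
move=> /fam_cvgP Fg famA e e0.
have e0' : (0 : R[i]) < e%:C%C by rewrite ltcR.
have := Fg A famA; apply.
apply/uniform_nbhs; exists [set xy | ball xy.1 (e%:C%C : R[i]) xy.2].
split; first by rewrite -entourage_ballE; exists (e%:C%C).
move=> f hf u Au; have := hf u Au; rewrite /= -ball_normE /=.
by rewrite nrmE ltcR -nrmN opprB.
Qed.

Definition has_d (f f' : R -> Cplx R) := forall l, 0 <= l < l0 -> forall e, 0 < e ->
  exists2 dl, 0 < dl & forall h : R, h != 0 -> `|h| < dl -> 0 <= l + h < l0 ->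
    nrm ((h^-1)%:C%C * (f (l + h) - f l) - f' l) < e.

Lemma has_deriv_in_unif (U : choiceType) (fam : set (set U)) (f g : R -> U -> Cplx R) A :
  has_deriv_in fam l0 f g -> fam A -> forall l, 0 <= l < l0 -> forall e, 0 < e ->
  exists2 dl, 0 < dl & forall h : R, h != 0 -> `|h| < dl -> 0 <= l + h < l0 ->
    forall u, A u -> nrm ((h^-1)%:C%C * (f (l + h) u - f l u) - g l u) < e.
Proof.
move=> fg famA l hl e e0.
have := fam_cvg_nrm _ (fg l hl) famA e0.
rewrite /= near_simpl !near_withinE near_nbhs_norm => -[dl/= dl0 hd].
exists dl => // h h0 hdl hlh u Au; apply: hd => //=.
by rewrite sub0r normrN.
Qed.

Lemma has_deriv_in_has_d (U : choiceType) (fam : set (set U)) (f g : R -> U -> Cplx R) A u :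
  has_deriv_in fam l0 f g -> fam A -> A u -> has_d (fun l => f l u) (fun l => g l u).
Proof.
move=> fg famA Au l hl e e0; have [dl dl0 hd] := has_deriv_in_unif fg famA hl e0.
by exists dl => // h h0 hdl hlh; exact: hd.
Qed.

(** Only increments that stay in [[0, b]] are controlled. In the interior this is differentiability;
    at the end points it still gives the one-sided continuity that the mean value theorem asks
    for. *)
Lemma mean_value_eps (r r' : R -> R) (b : R) : 0 < b ->
  (forall t, 0 <= t <= b -> forall e, 0 < e -> exists2 dl, 0 < dl &
     forall h, h != 0 -> `|h| < dl -> 0 <= t + h <= b ->
     `|h^-1 * (r (t + h) - r t) - r' t| < e) ->
  exists2 c, 0 < c < b & r b - r 0 = r' c * b.
Proof.
move=> b0 hr.
have cvd t : t \in `]0, b[ -> h^-1 *: (r (h *: 1 + t) - r t) @[h --> (0 : R)^'] --> r' t.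
  rewrite in_itv /= => /andP[t0 tb]; apply/cvgrPdist_lt => e e0.
  have [|dl dl0 hd] := hr t _ e e0; first by rewrite (ltW t0) (ltW tb).
  have m0 : 0 < Num.min dl (Num.min t (b - t)) by rewrite !lt_min dl0 t0 subr_gt0.
  exists (Num.min dl (Num.min t (b - t))) => //= h /=.
  rewrite sub0r normrN !lt_min => /and3P[h1 h2 h3] h0.
  rewrite -normrN opprB [h *: 1]mulr1 [h + t]addrC; apply: hd => //.
  move: h2 h3; rewrite !ltr_norml => /andP[? ?] /andP[? ?]; lra.
have dr t : t \in `]0, b[ -> is_derive t 1 r (r' t).
  move=> tb; apply: DeriveDef; first by apply/cvg_ex; exists (r' t); exact: cvd.
  by apply/cvg_lim => //; exact: cvd.
have [|c cb ->] := MVT b0 dr; last first.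
  by exists c; rewrite ?subr0//; move: cb; rewrite in_itv.
apply/subspace_continuousP => t; rewrite /= in_itv /= => tb.
apply/cvgrPdist_lt => e e0.
have [dl dl0 hd] := hr t tb 1 ltr01.
have C0 : 0 < `|r' t| + 1 by rewrite ltr_wpDl.
have m0 : 0 < Num.min dl (e / (`|r' t| + 1)) by rewrite lt_min dl0 divr_gt0.
rewrite near_withinE near_nbhs_norm; exists (Num.min dl (e / (`|r' t| + 1))) => //= s.
rewrite /ball_ /= lt_min => /andP[h1 h2]; rewrite in_itv /= => sb.
rewrite -[from_subspace _ _]/r.
have [->|st] := eqVneq s t; first by rewrite subrr normr0.
rewrite -normrN opprB in h1; rewrite -normrN opprB in h2; rewrite -normrN opprB.
have st0 : s - t != 0 by rewrite subr_eq0.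
have := hd (s - t) st0 h1; rewrite [t + _]addrC subrK => /(_ sb) hq.
have q0 : 0 < `|s - t| by rewrite normr_gt0.
have -> : r s - r t = (s - t) * ((s - t)^-1 * (r s - r t)).
  by rewrite mulrA divff// mul1r.
set q := (s - t)^-1 * _ in hq *.
rewrite normrM; have : `|q| <= `|r' t| + 1.
  rewrite -[q](subrK (r' t)) addrC; apply: le_trans (ler_normD _ _) _.
  by rewrite lerD2l ltW.
move: h2; rewrite ltr_pdivlMr// => h2 hq2; apply: le_lt_trans h2.
by rewrite ler_wpM2l.
Qed.

Lemma has_d_taylor1 f f1 : 0 < l0 -> has_d f f1 ->
  osmall 1 (fun l => f l - (f 0 + l%:C%C * f1 0)).
Proof.
move=> l00 fd e e0; have [|dl dl0 hd] := fd 0 _ e e0; first by rewrite lexx.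
exists (Num.min dl l0); first by rewrite lt_min dl0.
move=> l /andP[lp]; rewrite lt_min => /andP[h1 h2].
have lne : l != 0 by rewrite gt_eqF.
have := hd l lne; rewrite gtr0_norm// add0r (ltW lp) h2 => /(_ h1 isT) /ltW h.
have lc : l%:C%C * (l^-1)%:C%C = 1 :> R[i] by rewrite -rmorphM /= divff.
have -> : f l - (f 0 + l%:C%C * f1 0) = l%:C%C * ((l^-1)%:C%C * (f l - f 0) - f1 0).
  by rewrite mulrBr mulrA lc mul1r opprD addrA.
by rewrite nrmM nrmR gtr0_norm// expr1 mulrC ler_wpM2r// ltW.
Qed.

Lemma has_d_bounded0 f f1 : 0 < l0 -> has_d f f1 -> bounded0 f.
Proof.
move=> l00 fd; apply: (osmall_bounded0 (c := f 0)).
have h1 := osmall_weak (leq0n 1) (has_d_taylor1 l00 fd).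
have h2 : osmall 0 (fun l => (l ^+ 1)%:C%C * f1 0).
  by apply: osmall_pow => //; exists (nrm (f1 0)), 1.
have := osmallD h1 h2; apply: osmall_near; exists 1 => // l _.
by rewrite expr1; ring.
Qed.

(** The derivative of the remainder is [o(l)] by the first-order expansion of [f1]. The mean value
    theorem, valid for real functions only, is applied to real and imaginary parts. *)
Lemma has_d_taylor2 f f1 f2 : 0 < l0 -> has_d f f1 -> has_d f1 f2 ->
  osmall 2 (fun l => f l - (f 0 + l%:C%C * f1 0 + (l ^+ 2)%:C%C * (f2 0 / 2))).
Proof.
move=> l00 fd f1d.
pose phi l := f l - (f 0 + l%:C%C * f1 0 + (l ^+ 2)%:C%C * (f2 0 / 2)).
pose phi' l := f1 l - (f1 0 + l%:C%C * f2 0).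
have phi0 : phi 0 = 0.
  by rewrite /phi expr0n /= !mul0r !addr0 subrr.
have phid : has_d phi phi'.
  move=> l hl e e0; have e2 : 0 < e / 2 by rewrite divr_gt0.
  have [dl dl0 hd] := fd l hl _ e2.
  have C0 : 0 < nrm (f2 0) + 1 by rewrite ltr_wpDl ?nrm_ge0.
  exists (Num.min dl (e / 2 / (nrm (f2 0) + 1))); first by rewrite lt_min dl0 divr_gt0.
  move=> h h0; rewrite lt_min => /andP[h1 h2] hlh.
  have hc : (h^-1)%:C%C * h%:C%C = 1 :> R[i] by rewrite -rmorphM /= mulVf.
  have -> : (h^-1)%:C%C * (phi (l + h) - phi l) - phi' l =
     ((h^-1)%:C%C * (f (l + h) - f l) - f1 l) - h%:C%C * (f2 0 / 2).
    rewrite /phi /phi' !(rmorphXn, rmorphD) /=.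
    have -> : (h^-1)%:C%C * (f (l + h) -
       (f 0 + (l%:C%C + h%:C%C) * f1 0 + (l%:C%C + h%:C%C) ^+ 2 * (f2 0 / 2)) -
       (f l - (f 0 + l%:C%C * f1 0 + l%:C%C ^+ 2 * (f2 0 / 2)))) =
      (h^-1)%:C%C * (f (l + h) - f l) - ((h^-1)%:C%C * h%:C%C) *
       (f1 0 + (2 * l%:C%C + h%:C%C) * (f2 0 / 2)) by ring.
    rewrite hc [X in l%:C%C * X](splitr (f2 0)); ring.
  apply: le_lt_trans (nrmB _ _) _.
  have h3 := hd h h0 h1 hlh.
  have h4 : nrm (h%:C%C * (f2 0 / 2)) <= `|h| * (nrm (f2 0) + 1).
    rewrite nrmM nrmR ler_wpM2l// nrmM nrmV.
    have -> : nrm (2 : R[i]) = 2.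
      by rewrite -[2 : R[i]](rmorph_nat (real_complex R) 2) nrmR ger0_norm.
    by have := nrm_ge0 (f2 0); lra.
  move: h2; rewrite ltr_pdivlMr// => h2; lra.
move=> e e0; have e2 : 0 < e / 2 by rewrite divr_gt0.
have [d d0 hd] := has_d_taylor1 l00 f1d e2.
exists (Num.min d l0); first by rewrite lt_min d0.
move=> b /andP[b0]; rewrite lt_min => /andP[bd bl].
rewrite -/(phi b).
have hd' c : 0 < c < b -> nrm (phi' c) * b <= e / 2 * b ^+ 2.
  move=> /andP[c0 cb]; rewrite expr2 mulrA ler_wpM2r ?(ltW b0)//.
  have := hd c; rewrite c0 (lt_trans cb bd) expr1 => /(_ isT) /le_trans; apply.
  by rewrite ler_wpM2l ?(ltW e2)// ltW.
(* [p] stands for the real or the imaginary part. *)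
have mvt (p : R[i] -> R) : (forall x y, p (x - y) = p x - p y) ->
    (forall (c : R) x, p (c%:C%C * x) = c * p x) ->
    (forall x, `|p x| <= nrm x) -> `|p (phi b)| <= e / 2 * b ^+ 2.
  move=> pB pZ pn.
  have [|c cb] := @mean_value_eps (p \o phi) (p \o phi') b b0.
    move=> t /andP[t0 tb] e' e'0.
    have [|dl dl0 hh] := phid t _ e' e'0; first by rewrite t0 (le_lt_trans tb).
    exists dl => // h h0 h1 /andP[h2 h3].
    rewrite /= -pB -pZ -pB; apply: le_lt_trans (pn _) _; apply: hh => //.
    by rewrite h2 (le_lt_trans h3).
  rewrite /= phi0 -[X in p (phi b) - X](_ : 0 = p 0); last first.
    by rewrite -(subrr (0 : R[i])) pB subrr.
  rewrite subr0 => ->; rewrite normrM (gtr0_norm b0).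
  by apply: le_trans (hd' c cb); rewrite ler_wpM2r// ltW.
apply: le_trans (nrm_le_ReIm _) _.
have -> : e * b ^+ 2 = e / 2 * b ^+ 2 + e / 2 * b ^+ 2 by rewrite -mulrDl -splitr.
apply: lerD.
- apply: mvt => [x y|c x|x]; last exact: normRe_le.
    by rewrite ReD ReN.
  by rewrite ReM ReC ImC mul0r subr0.
- apply: mvt => [x y|c x|x]; last exact: normIm_le.
    by rewrite ImD ImN.
  by rewrite ImM ReC ImC mul0r addr0.
Qed.

(* Continuity at 0 along the positive imaginary axis passes to derivatives in
   the parameter, as the difference quotients converge uniformly. *)
Definition icont (g : Cplx R -> Cplx R) := forall e, 0 < e ->
  near0 (fun y => nrm (g ('i%C * y%:C%C) - g 0) < e).

Definition iseg (y0 : R) : set (Cplx R) :=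
  [set z | exists2 y : R, 0 <= y <= y0 & z = 'i%C * y%:C%C].

Lemma icont_deriv (fam : set (set (Cplx R))) (f g : R -> Cplx R -> Cplx R) y0 :
  0 < l0 -> 0 < y0 -> fam (iseg y0) -> has_deriv_in fam l0 f g ->
  (forall l, 0 <= l < l0 -> icont (f l)) -> forall l, 0 <= l < l0 -> icont (g l).
Proof.
move=> l00 y00 famA fg fc l hl e e0.
have e4 : 0 < e / 4 by rewrite divr_gt0.
have [dl dl0 hd] := has_deriv_in_unif fg famA hl e4.
(* One increment [h] suffices: by uniformity on the segment, the same [h] makes the quotient close
   to [g l] at 0 and at every [i y]. *)
have [h [h0 hdl hlh]] : exists h, [/\ h != 0, `|h| < dl & 0 <= l + h < l0].
  case/andP: hl => lge lt; pose h := Num.min dl (l0 - l) / 2.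
  have m0 : 0 < Num.min dl (l0 - l) by rewrite lt_min dl0 subr_gt0.
  have h0 : 0 < h by rewrite divr_gt0.
  have hm : h < Num.min dl (l0 - l) by rewrite /h ltr_pdivrMr// ltr_pMr// ltr1n.
  move: hm; rewrite lt_min => /andP[h1 h2].
  exists h; rewrite gt_eqF// gtr0_norm// h1; split => //.
  by rewrite addr_ge0 ?(ltW h0)//=; lra.
have hne : 0 < `|h| by rewrite normr_gt0.
have eh : 0 < e / 4 * `|h| by rewrite mulr_gt0.
have c1 := fc (l + h) hlh _ eh; have c2 := fc l hl _ eh.
apply: near0_mono (near0_and (near0_lt y00) (near0_and c1 c2)) => y yp [yy [b1 b2]].
have A0 : iseg y0 0.
  by exists 0; rewrite ?lexx ?(ltW y00)// rmorph0 mulr0.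
have Ay : iseg y0 ('i%C * y%:C%C) by exists y; rewrite ?(ltW yp) ?(ltW yy).
have q0 := hd h h0 hdl hlh _ A0; have qy := hd h h0 hdl hlh _ Ay.
set Y := 'i%C * y%:C%C in Ay qy b1 b2 *.
have -> : g l Y - g l 0 = - ((h^-1)%:C%C * (f (l + h) Y - f l Y) - g l Y) +
    (((h^-1)%:C%C * (f (l + h) 0 - f l 0) - g l 0) +
    (h^-1)%:C%C * ((f (l + h) Y - f (l + h) 0) - (f l Y - f l 0))) by ring.
apply: le_lt_trans (nrmD _ _) _; rewrite nrmN.
apply: le_lt_trans (lerD (lexx _) (nrmD _ _)) _.
have b3 : nrm ((h^-1)%:C%C * ((f (l + h) Y - f (l + h) 0) - (f l Y - f l 0))) < e / 2.
  rewrite nrmM nrmR normfV mulrC ltr_pdivrMr//.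
  apply: le_lt_trans (nrmB _ _) _; apply: lt_le_trans (ltrD b1 b2) _.
  by rewrite -mulrDl ler_pM2r//; lra.
lra.
Qed.

End Taylor.

(** * Expansion at the pole *)

Section PoleExpansion.
Variable R : realType.
Implicit Types (g : Cplx R -> Cplx R) (e f x : Cplx R).

Notation Y := (fun y : R => 'i%C * y%:C%C : Cplx R).

Lemma nrm_Y (y : R) : nrm ('i%C * y%:C%C) = `|y|.
Proof.
by rewrite nrmM nrmR /nrm /sqn Rei Imi expr0n expr1n/= add0r sqrtr1 mul1r.
Qed.

Lemma Y_neq0 (y : R) : 0 < y -> ('i%C * y%:C%C : R[i]) != 0.
Proof.
move=> y0; apply/eqP => h; have := nrm_Y y; rewrite h nrm0 gtr0_norm// => y00.
by rewrite -y00 ltxx in y0.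
Qed.

Lemma bounded0_cst (c : Cplx R) : bounded0 (fun=> c).
Proof. by exists (nrm c), 1. Qed.

Lemma osmall_Y b : bounded0 b -> osmall 0 (fun y => Y y * b y).
Proof.
move=> hb; have := osmall_cst_mul 'i%C (osmall_pow (n := 0) (m := 1) isT hb).
by apply: osmall_near; exists 1 => // l _; rewrite expr1 mulrA.
Qed.

Lemma icont_osmall g : icont g -> osmall 0 (fun y => g (Y y) - g 0).
Proof.
by move=> gc e e0; apply: near0_mono (gc e e0) => y _ /ltW; rewrite expr0 mulr1.
Qed.

Lemma icont_bounded0 g : icont g -> bounded0 (fun y => g (Y y)).
Proof. by move=> /icont_osmall/osmall_bounded0. Qed.

Lemma osmall_cst0 (c : Cplx R) : osmall 0 (fun=> c) -> c = 0.
Proof.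
move=> h; apply: (@osmall_pow_cst0 _ 0); apply: osmall_near h.
by exists 1 => // l _; rewrite expr0 mul1r.
Qed.

Lemma near0_Y_neq (z : Cplx R) : near0 (fun y => z - Y y != 0).
Proof.
have [->|z0] := eqVneq z 0.
  by exists 1 => // y /andP[y0 _]; rewrite sub0r oppr_eq0 Y_neq0.
have nz : 0 < nrm z.
  by rewrite lt_neqAle nrm_ge0 andbT eq_sym; apply: contra z0 => /eqP/nrm_eq0 ->.
exists (nrm z) => // y /andP[y0 yz]; rewrite subr_eq0; apply/eqP => h.
by move: yz; rewrite h nrm_Y gtr0_norm// ltxx.
Qed.

(** Multiplication by [zl - z] clears the pole, also if [zl = 0], and leaves terms continuous at 0.
    At [z = 0] the residue [f] drops out, so [x] is expressed through [zl]. *)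
Lemma pole_identity_at0 (lc x f e zl : Cplx R) (zV z1 : Cplx R -> Cplx R) :
  (forall y : R, 0 < y -> lc * (x / (zl - Y y) + zV (Y y)) =
     e + Y y * (f / (zl - Y y) + z1 (Y y))) ->
  icont zV -> icont z1 -> lc * x + lc * zl * zV 0 = e * zl.
Proof.
move=> id cV c1; apply/eqP; rewrite -subr_eq0; apply/eqP/osmall_cst0.
have h1 := osmall_cst_mul (- (lc * zl)) (icont_osmall cV).
have b1 : bounded0 (fun y => lc * zV (Y y) - e + f + z1 (Y y) * (zl - Y y)).
  apply: (osmall_bounded0 (c := lc * zV 0 - e + f + z1 0 * zl)).
  have k1 := osmall_cst_mul lc (icont_osmall cV).
  have k2 := osmall_cst_mul zl (icont_osmall c1).
  have k3 := osmall_Y (icont_bounded0 c1).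
  apply: osmall_near (osmallB (osmallD k1 k2) k3); exists 1 => // y _; ring.
apply: osmall_near (osmallD h1 (osmall_Y b1)).
apply: near0_mono (near0_Y_neq zl) => y y0 zy.
have := id y y0; move: zy; set Z := 'i%C * y%:C%C => zy hid.
have {}hid : lc * x + lc * zV Z * (zl - Z) =
    e * (zl - Z) + Z * f + Z * z1 Z * (zl - Z).
  have : lc * (x / (zl - Z) + zV Z) * (zl - Z) =
    (e + Z * (f / (zl - Z) + z1 Z)) * (zl - Z) by rewrite hid.
  have -> : lc * (x / (zl - Z) + zV Z) * (zl - Z) =
    lc * (x / (zl - Z) * (zl - Z)) + lc * zV Z * (zl - Z) by ring.
  have -> : (e + Z * (f / (zl - Z) + z1 Z)) * (zl - Z) =
    e * (zl - Z) + Z * (f / (zl - Z) * (zl - Z)) + Z * z1 Z * (zl - Z) by ring.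
  by rewrite !divfK.
have -> : lc * x = e * (zl - Z) + Z * f + Z * z1 Z * (zl - Z) - lc * zV Z * (zl - Z).
  by rewrite -hid addrK.
ring.
Qed.

(** With the pole at 0 the identity becomes [f - e = z * z1 z]. Letting [z] tend to 0 gives [f = e],
    and then [z1] vanishes on the axis. *)
Lemma pole_base (f e : Cplx R) (z1 : Cplx R -> Cplx R) (zl : Cplx R) : zl = 0 ->
  (forall y : R, 0 < y -> 0 = e + Y y * (f / (zl - Y y) + z1 (Y y))) ->
  icont z1 -> f = e /\ forall y : R, 0 < y -> z1 (Y y) = 0.
Proof.
move=> -> id c1.
have key y : 0 < y -> f - e = Y y * z1 (Y y).
  move=> y0; have := id y y0; have := Y_neq0 y0; rewrite sub0r.
  move: ('i%C * y%:C%C) => Z Zn hZ.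
  have e1 : Z * (f / - Z + z1 Z) = - f + Z * z1 Z by field.
  apply/eqP; rewrite -subr_eq0; apply/eqP.
  have -> : f - e - Z * z1 Z = - (e + (- f + Z * z1 Z)) by ring.
  by rewrite -e1 -hZ oppr0.
have fe : f = e.
  apply/eqP; rewrite -subr_eq0; apply/eqP/osmall_cst0.
  apply: osmall_near (osmall_Y (icont_bounded0 c1)).
  by exists 1 => // y /andP[y0 _]; rewrite (key y).
split => // y y0; have := key y y0; rewrite fe subrr => /esym/eqP.
by rewrite mulf_eq0 (negbTE (Y_neq0 y0)) => /eqP.
Qed.

(** [zl] is the pole, [x] and [f] are the residues paired with [V] and with 1, [zV] and [z1] the
    corresponding remainders, [e] the expectation of the test polynomial up to conjugation. A
    further digit 1 or 2 marks a first or second derivative in the coupling constant; [c1] and [c2]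
    are the coefficients of [f]. *)
Variables (l0 y0 : R) (e c1 c2 : Cplx R) (f x zl : R -> Cplx R).
Variables (zV zV1 z1 z11 z12 : R -> Cplx R -> Cplx R).
Hypothesis l0_gt0 : 0 < l0.
Hypothesis y0_gt0 : 0 < y0.
Hypothesis id : forall l : R, 0 <= l < l0 -> forall y : R, 0 < y ->
  l%:C%C * (x l / (zl l - Y y) + zV l (Y y)) =
  e + Y y * (f l / (zl l - Y y) + z1 l (Y y)).
Hypothesis zl_small : osmall 1 zl.
Hypothesis zV_cont : forall l, 0 <= l < l0 -> icont (zV l).
Hypothesis z1_cont : forall l, 0 <= l < l0 -> icont (z1 l).
Hypothesis z1_0 : forall y : R, 0 < y -> z1 0 (Y y) = 0.
Hypothesis f_taylor : osmall 2 (fun l => f l - (e + l%:C%C * c1 + (l ^+ 2)%:C%C * c2)).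
Hypothesis zVd : forall y : R, 0 <= y <= y0 ->
  has_d l0 (fun l => zV l (Y y)) (fun l => zV1 l (Y y)).
Hypothesis z1d : forall y : R, 0 <= y <= y0 ->
  has_d l0 (fun l => z1 l (Y y)) (fun l => z11 l (Y y)).
Hypothesis z11d : forall y : R, 0 <= y <= y0 ->
  has_d l0 (fun l => z11 l (Y y)) (fun l => z12 l (Y y)).
Hypothesis zV1_cont : icont (zV1 0).
Hypothesis z11_cont : icont (z11 0).
Hypothesis z12_cont : icont (z12 0).

(** [pole_identity_at0] eliminates [x] from the identity at [z]. The errors [l zl (zV z - zV 0) / z]
    and [zl z1] are [o(l^2)] because [zl = o(l)] and, as [z1] vanishes at coupling 0,
    [z1 = O(l)]. *)
Lemma pole_residue_expand (y : R) : 0 < y <= y0 ->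
  osmall 2 (fun l => f l - (e - l%:C%C * zV l (Y y) + Y y * z1 l (Y y))).
Proof.
move=> /andP[yp yy]; have Yn := Y_neq0 yp.
have yin : 0 <= y <= y0 by rewrite (ltW yp).
have y0in : 0 <= (0 : R) <= y0 by rewrite lexx ltW.
have EZ0 : Y 0 = 0 by rewrite rmorph0 mulr0.
have bV := has_d_bounded0 l0_gt0 (zVd yin).
have bV0 : bounded0 (fun l => zV l 0).
  by have := has_d_bounded0 l0_gt0 (zVd y0in); rewrite EZ0.
have t1 : osmall 2 (fun l => l%:C%C * ((zV l (Y y) - zV l 0) / Y y * zl l)).
  apply: (@osmallM_pow _ 1 1 (fun l => l%:C%C)).
    by exists 1, 1 => // l /andP[lp _]; rewrite nrmR gtr0_norm// expr1 mul1r.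
  apply: osmallM => //.
  have [C1 C10 h1] := bounded0_pos bV; have [C2 C20 h2] := bounded0_pos bV0.
  exists ((C1 + C2) / nrm (Y y)); apply: near0_mono (near0_and h1 h2) => l _ [a b].
  rewrite [X in X <= _]nrmM nrmV ler_wpM2r ?invr_ge0 ?nrm_ge0//.
  exact: le_trans (nrmB _ _) (lerD a b).
have t2 : osmall 2 (fun l => z1 l (Y y) * zl l).
  apply: (@osmallM_pow _ 1 1 (fun l => z1 l (Y y))) => //.
  have := has_d_taylor1 l0_gt0 (z1d yin).
  rewrite (z1_0 yp) => /(_ 1 ltr01) h.
  exists (1 + nrm (z11 0 (Y y))); apply: near0_mono h => l lp.
  rewrite add0r mul1r expr1 => h.
  rewrite -[z1 l _](subrK (l%:C%C * z11 0 (Y y))); apply: le_trans (nrmD _ _) _.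
  by rewrite mulrDl mul1r nrmM nrmR gtr0_norm// [nrm _ * l]mulrC lerD2r.
apply: osmall_near (osmallB t1 t2).
have zn : near0 (fun l => zl l - Y y != 0).
  have ny : 0 < nrm (Y y) by rewrite nrm_Y gtr0_norm.
  have hz := zl_small (ltr01); have := near0_and hz (near0_lt ny).
  apply: near0_mono => l lp [h1 h2]; rewrite subr_eq0; apply/eqP => h.
  by move: h1; rewrite h mul1r expr1 leNgt h2.
apply: near0_mono (near0_and (near0_lt l0_gt0) zn) => l lp [ll zy].
have lin : 0 <= l < l0 by rewrite ltW.
have idB := pole_identity_at0 (id lin) (zV_cont lin) (z1_cont lin).
have idy := id lin yp.
move: Yn zy idy; set Z := 'i%C * y%:C%C; move: (zV l Z) (zV l 0) (z1 l Z) (zl l) (x l) (f l) idB.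
move=> v v0 w zz xx ff idB Zn zy idy.
have e1 : l%:C%C * xx = e * zz - l%:C%C * zz * v0 by rewrite -idB addrK.
have e2 : l%:C%C * xx + l%:C%C * v * (zz - Z) = e * (zz - Z) + Z * ff + Z * w * (zz - Z).
  have : l%:C%C * (xx / (zz - Z) + v) * (zz - Z) =
    (e + Z * (ff / (zz - Z) + w)) * (zz - Z) by rewrite idy.
  have -> : l%:C%C * (xx / (zz - Z) + v) * (zz - Z) =
    l%:C%C * (xx / (zz - Z) * (zz - Z)) + l%:C%C * v * (zz - Z) by ring.
  have -> : (e + Z * (ff / (zz - Z) + w)) * (zz - Z) =
    e * (zz - Z) + Z * (ff / (zz - Z) * (zz - Z)) + Z * w * (zz - Z) by ring.
  by rewrite !divfK.
apply: (mulIf Zn).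
have -> : (l%:C%C * ((v - v0) / Z * zz) - w * zz) * Z =
   l%:C%C * zz * (v - v0) * (Z^-1 * Z) - w * zz * Z by ring.
rewrite mulVf// mulr1.
have e3 : Z * ff = e * zz - l%:C%C * zz * v0 + l%:C%C * v * (zz - Z) - e * (zz - Z)
   - Z * w * (zz - Z) by rewrite -e1 e2; ring.
have -> : (ff - (e - l%:C%C * v + Z * w)) * Z = Z * ff - (e - l%:C%C * v + Z * w) * Z by ring.
rewrite e3; ring.
Qed.

Lemma pole_coefficients (y : R) : 0 < y <= y0 ->
  c1 = - zV 0 (Y y) + Y y * z11 0 (Y y) /\
  c2 = - zV1 0 (Y y) + Y y * (z12 0 (Y y) / 2).
Proof.
move=> yy; have /andP[yp yle] := yy.
have yin : 0 <= y <= y0 by rewrite (ltW yp).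
have h0 := pole_residue_expand yy.
have hV : osmall 2 (fun l => l%:C%C * (zV l (Y y) - (zV 0 (Y y) + l%:C%C * zV1 0 (Y y)))).
  apply: (@osmallM_pow _ 1 1 (fun l => l%:C%C)).
    by exists 1, 1 => // l /andP[lp _]; rewrite nrmR gtr0_norm// expr1 mul1r.
  exact: has_d_taylor1 l0_gt0 (zVd yin).
have hw := osmall_cst_mul (Y y) (has_d_taylor2 l0_gt0 (z1d yin) (z11d yin)).
set d1 := c1 - (- zV 0 (Y y) + Y y * z11 0 (Y y)).
set d2 := c2 - (- zV1 0 (Y y) + Y y * (z12 0 (Y y) / 2)).
have hc : osmall 2 (fun l => (l ^+ 1)%:C%C * d1 + (l ^+ 2)%:C%C * d2).
  apply: osmall_near (osmallB (osmallD (osmallB h0 f_taylor) hw) hV).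
  exists 1 => // l /andP[lp _]; rewrite /d1 /d2 (z1_0 yp) !rmorphXn /=.
  ring.
have d10 : d1 = 0.
  apply: (@osmall_pow_cst0 _ 1).
  have hc1 := osmall_weak (isT : (1 <= 2)%N) hc.
  have hc2 := osmall_pow (isT : (1 < 2)%N) (bounded0_cst d2).
  by apply: osmall_near (osmallB hc1 hc2); exists 1 => // l _; rewrite addrK.
have d20 : d2 = 0.
  apply: (@osmall_pow_cst0 _ 2); apply: osmall_near hc.
  by exists 1 => // l _; rewrite d10 mulr0 add0r.
by split; apply/eqP; rewrite -subr_eq0; apply/eqP.
Qed.

Lemma pole_expansion :
  c1 = - zV 0 0 /\ c2 = - zV1 0 0.
Proof.
have in0 : 0 <= (0 : R) < l0 by rewrite lexx.
split.
  apply/eqP; rewrite -subr_eq0 opprK; apply/eqP/osmall_cst0.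
  have k1 := icont_osmall (zV_cont in0); have k2 := osmall_Y (icont_bounded0 z11_cont).
  apply: osmall_near (osmallB k2 k1); exists y0 => // y /andP[yp /ltW yle].
  have [|-> _] := @pole_coefficients y; first by rewrite yp.
  ring.
apply/eqP; rewrite -subr_eq0 opprK; apply/eqP/osmall_cst0.
have k1 := icont_osmall zV1_cont.
have b2 : bounded0 (fun y => z12 0 (Y y) / 2).
  have [C h] := icont_bounded0 z12_cont.
  exists (C * nrm (2^-1 : R[i])); apply: near0_mono h => y _ h.
  by rewrite nrmM ler_wpM2r ?nrm_ge0.
apply: osmall_near (osmallB (osmall_Y b2) k1); exists y0 => // y /andP[yp /ltW yle].
have [|_ ->] := @pole_coefficients y; first by rewrite yp.
ring.
Qed.

End PoleExpansion.

(** * Algebra of second-order expansions *)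

Section TaylorAlgebra.
Variable R : realType.
Implicit Types (f g : R -> Cplx R) (a b : Cplx R).

Definition taylor2 f a0 a1 a2 :=
  osmall 2 (fun l => f l - (a0 + l%:C%C * a1 + (l ^+ 2)%:C%C * a2)).

Let bounded0_poly a0 a1 a2 :
  bounded0 (fun l : R => a0 + l%:C%C * a1 + (l ^+ 2)%:C%C * a2).
Proof.
exists (nrm a0 + nrm a1 + nrm a2), 1 => // l /andP[l0 l1].
apply: le_trans (nrmD _ _) _; apply: lerD.
  apply: le_trans (nrmD _ _) _; rewrite lerD2l nrmM nrmR gtr0_norm//.
  by rewrite ler_piMl ?nrm_ge0// ltW.
rewrite nrmM nrmR ger0_norm ?exprn_ge0 ?(ltW l0)//.
by rewrite ler_piMl ?nrm_ge0// exprn_ile1 ?ltW.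
Qed.

Lemma taylor2_osmall0 f a0 a1 a2 : taylor2 f a0 a1 a2 -> osmall 0 (fun l => f l - a0).
Proof.
move=> h; have h0 := osmall_weak (leq0n 2) h.
have k1 := osmall_pow (isT : (0 < 1)%N) (bounded0_cst a1).
have k2 := osmall_pow (isT : (0 < 2)%N) (bounded0_cst a2).
apply: osmall_near (osmallD (osmallD h0 k1) k2); exists 1 => // l _.
by rewrite expr1; ring.
Qed.

Lemma taylor2_bounded0 f a0 a1 a2 : taylor2 f a0 a1 a2 -> bounded0 f.
Proof. by move=> /taylor2_osmall0/osmall_bounded0. Qed.

Lemma taylor2_osmall1 f a0 a1 a2 : taylor2 f a0 a1 a2 ->
  osmall 1 (fun l => f l - (a0 + l%:C%C * a1)).
Proof.
move=> h; have h0 := osmall_weak (isT : (1 <= 2)%N) h.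
have k2 := osmall_pow (isT : (1 < 2)%N) (bounded0_cst a2).
by apply: osmall_near (osmallD h0 k2); exists 1 => // l _; ring.
Qed.

Lemma taylor2M f g a0 a1 a2 b0 b1 b2 : taylor2 f a0 a1 a2 -> taylor2 g b0 b1 b2 ->
  taylor2 (fun l => f l * g l) (a0 * b0) (a0 * b1 + a1 * b0)
    (a0 * b2 + a1 * b1 + a2 * b0).
Proof.
move=> hf hg.
have k1 := osmallM (taylor2_bounded0 hg) hf.
have k2 := osmallM (bounded0_poly a0 a1 a2) hg.
have k3 := osmall_pow (isT : (2 < 3)%N) (bounded0_cst (a1 * b2 + a2 * b1)).
have k4 := osmall_pow (isT : (2 < 4)%N) (bounded0_cst (a2 * b2)).
apply: osmall_near (osmallD (osmallD k1 k2) (osmallD k3 k4)); exists 1 => // l _.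
rewrite !rmorphXn /=; ring.
Qed.

Lemma taylor2J f a0 a1 a2 : taylor2 f a0 a1 a2 ->
  taylor2 (fun l => conjc (f l)) (conjc a0) (conjc a1) (conjc a2).
Proof.
move=> /osmallJ; apply: osmall_near; exists 1 => // l _.
by apply: complex_eq; rewrite !reimE; ring.
Qed.

Lemma taylor2_lin f g a0 a1 a2 b0 b1 b2 c : taylor2 f a0 a1 a2 -> taylor2 g b0 b1 b2 ->
  taylor2 (fun l => c * f l + g l) (c * a0 + b0) (c * a1 + b1) (c * a2 + b2).
Proof.
move=> hf hg; apply: osmall_near (osmallD (osmall_cst_mul c hf) hg).
by exists 1 => // l _; ring.
Qed.

Lemma taylor2_unique f g a0 a1 a2 b0 b1 b2 : near0 (fun l => f l = g l) ->
  taylor2 f a0 a1 a2 -> taylor2 g b0 b1 b2 -> [/\ a0 = b0, a1 = b1 & a2 = b2].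
Proof.
move=> fg hf hg.
have h : osmall 2 (fun l => (l ^+ 0)%:C%C * (b0 - a0) + ((l ^+ 1)%:C%C * (b1 - a1) +
     (l ^+ 2)%:C%C * (b2 - a2))).
  apply: osmall_near (osmallB hf hg); apply: near0_mono fg => l _ ->.
  by rewrite expr0 expr1 mul1r; ring.
have e0 : b0 - a0 = 0.
  apply: (@osmall_pow_cst0 _ 0); have h0 := osmall_weak (leq0n 2) h.
  have k1 := osmall_pow (isT : (0 < 1)%N) (bounded0_cst (b1 - a1)).
  have k2 := osmall_pow (isT : (0 < 2)%N) (bounded0_cst (b2 - a2)).
  by apply: osmall_near (osmallB h0 (osmallD k1 k2)); exists 1 => // l _; rewrite addrK.
have e1 : b1 - a1 = 0.
  apply: (@osmall_pow_cst0 _ 1); have h0 := osmall_weak (isT : (1 <= 2)%N) h.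
  have k2 := osmall_pow (isT : (1 < 2)%N) (bounded0_cst (b2 - a2)).
  apply: osmall_near (osmallB h0 k2); exists 1 => // l _.
  by rewrite e0 mulr0 add0r addrK.
have e2 : b2 - a2 = 0.
  apply: (@osmall_pow_cst0 _ 2); apply: osmall_near h; exists 1 => // l _.
  by rewrite e0 e1 !mulr0 !add0r.
by split; apply/esym/eqP; rewrite -subr_eq0; apply/eqP.
Qed.

Lemma has_d_taylor (l0 : R) f f1 f2 : 0 < l0 -> has_d l0 f f1 -> has_d l0 f1 f2 ->
  taylor2 f (f 0) (f1 0) (f2 0 / 2).
Proof. exact: has_d_taylor2. Qed.

Lemma C2_scalar_taylor (l0 : R) f : 0 < l0 -> C2_scalar l0 f ->
  exists a1 a2, taylor2 f (f 0) a1 a2.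
Proof.
move=> l00 [f1 [f2 [h1 h2 _]]]; exists (f1 0 tt), (f2 0 tt / 2).
have fam : [set [set: unit]] [set: unit] by [].
apply: (@has_d_taylor l0 f (f1 ^~ tt) (f2 ^~ tt)) => //.
- exact: (has_deriv_in_has_d (u := tt) h1 fam).
- exact: (has_deriv_in_has_d (u := tt) h2 fam).
Qed.

End TaylorAlgebra.

(** * Approach to z = 0 along the imaginary axis *)

Section ImaginarySegment.
Variable R : realType.

Lemma iseg_compact (y0 : R) : compact (iseg y0).
Proof.
have -> : iseg y0 = (fun y : R => 'i%C * y%:C%C : Cplx R) @` `[0, y0].
  apply/seteqP; split => z.
    by move=> [y yy ->]; exists y => //; rewrite /= in_itv.
  by move=> [y yy <-]; exists y => //; move: yy; rewrite /= in_itv.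
apply: continuous_compact; last exact: segment_compact.
apply: continuous_subspaceT => y; apply/cvgrPdist_lt => e e0.
have eE := RRe_real (gtr0_real e0); rewrite -eE ltcR in e0.
near=> t.
rewrite -mulrBr -rmorphB /= nrmE nrm_Y -eE ltcR.
by near: t; exact: cvgr_dist_lt.
Unshelve. all: by end_near. Qed.

Lemma iseg_compacts_of_disc (M : R) : 0 < M -> compacts_of_disc M (iseg (M^-1 / 2)).
Proof.
move=> M0; split; first exact: iseg_compact.
move=> z [y /andP[y0 yM] ->]; rewrite /disc /= nrmE nrm_Y ger0_norm// ltcR.
by apply: le_lt_trans yM _; rewrite ltr_pdivrMr ?ltr_pMr ?invr_gt0// ltr1n.
Qed.

Lemma icont_derivable (g : Cplx R -> Cplx R) : derivable g 0 1 -> icont g.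
Proof.
move=> dg e e0; have /derivable1_diffP/differentiable_continuous := dg.
move=> /cvgrPdist_lt gc.
have e0' : (0 : R[i]) < e%:C%C by rewrite ltcR.
have := gc _ e0'; rewrite near_nbhs_norm => -[d /= d0 hd].
have dE := RRe_real (gtr0_real d0); rewrite -dE ltcR in d0.
exists (complex.Re d) => // y /andP[y0 yd].
have := hd ('i%C * y%:C%C); rewrite /= sub0r normrN nrmE nrm_Y gtr0_norm// -dE ltcR.
by move=> /(_ yd); rewrite nrmE ltcR -nrmN opprB.
Qed.

End ImaginarySegment.

(** * Expansion of the resonance *)

Section Assembly.
Context {disp : measure_display} {Om : measurableType disp} {R : realType}.
Variables (P : probability Om R) (d : nat) (tau : 'rV[R]_d -> Om -> Om).
Hypothesis tau_action : preserving_action P tau.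
Variable V : Om -> R.
Hypothesis V_meas : measurable_fun setT V.
Hypothesis V_moments : forall p : nat, P.-integrable setT (fun w => (V w ^+ p)%:E).
Hypothesis V_centered : (\int[P]_w (V w)%:E = 0)%E.
Variables (k : 'rV[R]_d) (lam0 M : R).
Hypothesis lam0_gt0 : 0 < lam0.
Hypothesis M_gt0 : 0 < M.
Hypothesis H_sa : forall lam : R, 0 <= lam < lam0 ->
  op_selfadjoint P (op_closure P (Hst P tau V k lam)).
Implicit Types (f g u v phi psi : Om -> Cplx R) (z : R[i]) (lam l y : R) (s : bool).

Notation H := (L2_semi_hilbert P).
Notation res := (resolvent P tau V k).
Notation Vc := (fun w => (V w)%:C%C : Cplx R).
Notation one := (fun _ : Om => 1 : Cplx R).
Notation Vp := (Vpoly tau V).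
Notation E := (Expect P).
Notation Y := (fun y : R => 'i%C * y%:C%C : Cplx R).

Variables (zz : R -> Cplx R) (Psi : bool -> R -> (Om -> Cplx R) -> Cplx R).
Variable zeta : R -> (Om -> Cplx R) -> (Om -> Cplx R) -> Cplx R -> Cplx R.
Hypothesis Psi_dual : forall s lam, 0 <= lam < lam0 -> Vdual P tau V (Psi s lam).
Hypothesis expansion : forall lam phi phi' (z : Cplx R),
  0 <= lam < lam0 -> Vp phi -> Vp phi' -> 0 < complex.Im z ->
  inner P phi' (res lam z phi) =
   (conjc (Psi true lam phi') : Cplx R) * Psi false lam phi / (zz lam - z)
   + zeta lam phi' phi z.
Hypothesis zeta_holo0 : forall lam phi phi', 0 <= lam < lam0 -> Vp phi -> Vp phi' ->
  derivable (zeta lam phi' phi) 0 1.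
Hypothesis Psi_C2 : forall s phi, Vp phi -> C2_scalar lam0 (fun l => Psi s l phi).
Hypothesis zeta_C2 : forall phi phi', Vp phi -> Vp phi' ->
  C2_in (compacts_of_disc M) lam0 (fun l => zeta l phi' phi).

(* The two signs are treated at once: for [s = false] the fixed vector
   ([one] or [Vc]) is the bra and the test polynomial the ket; for [s = true]
   the roles are exchanged. *)
Definition pairing s l a phi : Cplx R :=
  if s then (conjc (Psi true l phi) : Cplx R) * Psi false l a
  else (conjc (Psi true l a) : Cplx R) * Psi false l phi.
Definition remainder s l a phi : Cplx R -> Cplx R :=
  if s then zeta l phi a else zeta l a phi.
Definition matel s l z a phi : Cplx R :=
  if s then inner P phi (res l z a) else inner P a (res l z phi).
(** For [s = true] the pairing is conjugate linear in the test polynomial; [cj] restores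
    linearity. *)
Definition cj s (c : Cplx R) : Cplx R := if s then conjc c else c.

Let in0 : (0 : R) <= 0 < lam0. Proof. by rewrite lexx. Qed.
Let Vp1 : Vp one. Proof. exact: Vpoly_cst. Qed.
Let VpV : Vp Vc. Proof. exact: (Vpoly_V tau_action). Qed.
Let VpL2 phi : Vp phi -> L2 P phi.
Proof. exact: (Vpoly_L2 tau_action V_meas V_moments). Qed.
Let Vpam phi : Vp phi -> all_moments P phi.
Proof. exact: (Vpoly_all_moments tau_action V_meas V_moments). Qed.

Lemma ImY y : 0 < y -> complex.Im ('i%C * y%:C%C : R[i]) != 0.
Proof. by move=> y0; rewrite !reimE mul0r mul1r add0r gt_eqF. Qed.

Lemma ImY_gt0 y : 0 < y -> 0 < complex.Im ('i%C * y%:C%C : R[i]).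
Proof. by move=> y0; rewrite !reimE mul0r mul1r add0r. Qed.

Lemma matel_expansion s l y a phi : 0 <= l < lam0 -> 0 < y -> Vp a -> Vp phi ->
  matel s l (Y y) a phi = pairing s l a phi / (zz l - Y y) + remainder s l a phi (Y y).
Proof.
by move=> hl y0 Va Vphi; case: s; rewrite /matel /pairing /remainder /=
  expansion ?ImY_gt0.
Qed.

Lemma pairing_identity s phi l : Vp phi -> 0 <= l < lam0 -> forall y, 0 < y ->
  l%:C%C * (pairing s l Vc phi / (zz l - Y y) + remainder s l Vc phi (Y y)) =
  cj s (E phi) +
  Y y * (pairing s l one phi / (zz l - Y y) + remainder s l one phi (Y y)).
Proof.
move=> Vphi hl y y0; rewrite -!matel_expansion//; case: s; rewrite /matel /cj.
- exact: (res_pair_one_adj V_meas V_moments H_sa hl (ImY y0) (VpL2 Vphi)).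
- exact: (res_pair_one V_meas V_moments H_sa hl (ImY y0) (VpL2 Vphi)).
Qed.

Lemma remainder_icont s l a phi : 0 <= l < lam0 -> Vp a -> Vp phi ->
  icont (remainder s l a phi).
Proof.
by move=> hl Va Vphi; apply: icont_derivable; case: s; exact: zeta_holo0.
Qed.

Lemma E1 : E one = 1. Proof. exact: Expect_cst. Qed.

Lemma EV : E Vc = 0.
Proof.
apply: complex_eq; rewrite ?Re_Expect ?Im_Expect.
  by rewrite /Rintegral /= V_centered.
by rewrite Rintegral_cst// mul0r.
Qed.

Lemma cj0 s : cj s 0 = 0. Proof. by case: s => //; apply: complex_eq; rewrite /= ?oppr0. Qed.
Lemma cj1 s : cj s 1 = 1. Proof. by case: s => //; apply: complex_eq; rewrite /= ?oppr0. Qed.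
Lemma cjK s : involutive (cj s). Proof. by case: s => // x; rewrite /cj conjcK. Qed.
Lemma nrm_cj s c : nrm (cj s c) = nrm c. Proof. by case: s => //; rewrite /cj nrmJ. Qed.

Lemma cj_lin s (a b c : Cplx R) : cj s (a * b + c) = cj s a * cj s b + cj s c.
Proof. by case: s => //; rewrite /cj; apply: complex_eq; rewrite !reimE; ring. Qed.

Lemma cjB s (a b : Cplx R) : cj s (a - b) = cj s a - cj s b.
Proof. by case: s => //; rewrite /cj; apply: complex_eq; rewrite !reimE; ring. Qed.

Lemma cjN s (a : Cplx R) : cj s (- a) = - cj s a.
Proof. by rewrite -sub0r cjB cj0 sub0r. Qed.

(** [pole_identity_at0] at coupling 0 with test polynomial 1: the left-hand side vanishes, and
    [E one = 1]. *)
Lemma zz0 : zz 0 = 0.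
Proof.
have := pole_identity_at0 (pairing_identity false Vp1 in0)
  (remainder_icont false in0 VpV Vp1) (remainder_icont false in0 Vp1 Vp1).
by rewrite rmorph0 !mul0r addr0 /= E1 mul1r => <-.
Qed.

Lemma pairing0 s phi : Vp phi -> pairing s 0 one phi = cj s (E phi) /\
  forall y, 0 < y -> remainder s 0 one phi (Y y) = 0.
Proof.
move=> Vphi; apply: (pole_base zz0) => [y y0|].
  by rewrite -(pairing_identity s Vphi in0 y0) rmorph0 mul0r.
exact: remainder_icont.
Qed.

Lemma Psi0_neq0 s : Psi s 0 one != 0.
Proof.
have [h _] := pairing0 false Vp1; rewrite /pairing /= E1 in h.
apply/eqP => h0; move: h; case: s h0 => h0; rewrite h0.
  by rewrite conjc0 mul0r => /esym/eqP; rewrite oner_eq0.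
by rewrite mulr0 => /esym/eqP; rewrite oner_eq0.
Qed.

(** At coupling 0 the residue is [cj s (E phi)], and its other factor, a value at 1, is nonzero. *)
Lemma Psi0_eq0 s phi : Vp phi -> E phi = 0 -> Psi s 0 phi = 0.
Proof.
move=> Vphi E0; have := Psi0_neq0 (~~ s); have [] := pairing0 s Vphi.
rewrite E0 cj0 => + _; rewrite /pairing; case: s => /= /eqP;
  rewrite mulf_eq0 => /orP[/eqP h|/eqP ->]; rewrite ?eqxx//.
  by move=> _; rewrite -[LHS]conjcK h conjc0.
by move/eqP: h; rewrite conjc_eq0 => ->.
Qed.

Lemma pairing_taylor s a phi : Vp a -> Vp phi -> exists c1 c2,
  taylor2 (fun l => pairing s l a phi) (pairing s 0 a phi) c1 c2.
Proof.
move=> Va Vphi.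
have PT t f : Vp f -> exists a1 a2, taylor2 (fun l => Psi t l f) (Psi t 0 f) a1 a2.
  by move=> Vf; exact: C2_scalar_taylor lam0_gt0 (Psi_C2 t Vf).
case: s; rewrite /pairing.
- have [a1 [a2 h]] := PT true _ Vphi; have [b1 [b2 h']] := PT false _ Va.
  by have := taylor2M (taylor2J h) h'; do 2 eexists; eassumption.
- have [a1 [a2 h]] := PT true _ Va; have [b1 [b2 h']] := PT false _ Vphi.
  by have := taylor2M (taylor2J h) h'; do 2 eexists; eassumption.
Qed.

Lemma remainder_C2 s a phi : Vp a -> Vp phi ->
  C2_in (compacts_of_disc M) lam0 (fun l => remainder s l a phi).
Proof. by move=> Va Vphi; case: s; exact: zeta_C2. Qed.

(** The identity at [z = 0] gives [zz = l x / (1 - l zeta(0))], where [x] tends to 0 as [V] is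
    centered. This weak bound is needed before the residue can be expanded. *)
Lemma zz_small : osmall 1 zz.
Proof.
(* The same product is [pairing false l Vc one], in which form [pole_identity_at0] provides it. *)
pose x l := pairing true l one Vc.
have idB l : 0 <= l < lam0 ->
    l%:C%C * x l + l%:C%C * zz l * remainder false l Vc one 0 = zz l.
  move=> hl; have := pole_identity_at0 (pairing_identity false Vp1 hl)
    (remainder_icont false hl VpV Vp1) (remainder_icont false hl Vp1 Vp1).
  by rewrite /= E1 mul1r.
have [x1 [x2 xT]] := pairing_taylor true Vp1 VpV.
have x0 : osmall 0 x.
  have := taylor2_osmall0 xT; have [-> _] := pairing0 true VpV.
  by rewrite EV cj0; apply: osmall_near; exists 1 => // l _; rewrite subr0.
have [f1 [f2 [h1 h2 _]]] := remainder_C2 false VpV Vp1.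
have famA := iseg_compacts_of_disc M_gt0.
have A0 : iseg (M^-1 / 2) 0.
  by exists 0; rewrite ?rmorph0 ?mulr0// lexx divr_ge0// invr_ge0 ltW.
have bz := has_d_bounded0 lam0_gt0 (has_deriv_in_has_d h1 famA A0).
have q0 := osmall_pow (isT : (0 < 1)%N) bz.
have q1 : osmall 0 (fun l => (1 - l%:C%C * remainder false l Vc one 0) - 1).
  by apply: osmall_near (osmallN q0); exists 1 => // l _; rewrite expr1; ring.
have [qn qb] := osmallV (oner_neq0 _) q1.
have k1 : osmall 1 (fun l => l%:C%C * (((1 - l%:C%C * remainder false l Vc one 0))^-1 * x l)).
  apply: (@osmallM_pow _ 1 0 (fun l => l%:C%C)).
    by exists 1, 1 => // l /andP[lp _]; rewrite nrmR gtr0_norm// expr1 mul1r.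
  exact: osmallM qb x0.
apply: osmall_near k1; apply: near0_mono (near0_and (near0_lt lam0_gt0) qn).
move=> l lp [ll qne]; have hl : 0 <= l < lam0 by rewrite ltW.
have := idB l hl; move: qne; move: (remainder false l Vc one 0) (x l) (zz l).
move=> r xx z qne h; rewrite mulrCA mulrC; apply: (mulIf qne); rewrite divfK//.
have -> : l%:C%C * xx = z - l%:C%C * z * r by rewrite -[X in X - _]h addrK.
ring.
Qed.

Lemma mulV_symm a b : inner P (mulV V a) b = inner P a (mulV V b).
Proof.
by congr Expect; apply/funext => w; rewrite /mulV conjcM conjc_real; ring.
Qed.

(** [H + i eps] for [s = true] and [H - i eps] for [s = false] correspond to resolvents at [-i eps]
    and [i eps]; the former arises from [Y y] by moving the resolvent to the bra. *)
Definition zs s y : Cplx R := if s then conjc (Y y) else Y y.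

Lemma Im_zs s y : 0 < y -> complex.Im (zs s y) != 0.
Proof. by move=> y0; case: s => /=; rewrite ?Im_conjc ?oppr_eq0 ImY. Qed.

Lemma Expect_mulV_res s y phi : 0 < y -> L2 P phi ->
  E (mulV V (res 0 (zs s y) phi)) = cj s (matel s 0 (Y y) Vc phi).
Proof.
move=> y0 Lphi; rewrite -inner_V; case: s => //=.
rewrite (res_conjc H_sa in0 (Im_conjc_neq0 (ImY y0)) Lphi (VpL2 VpV)).
by rewrite conjcK.
Qed.

(** Minus the derivative at coupling 0 of [matel] with fixed vector [Vc], in the form given by
    [res_taylor]. *)
Definition second_order s y phi : Cplx R :=
  if s then inner P (res 0 (conjc (Y y)) phi) (mulV V (res 0 (Y y) Vc))
  else inner P (res 0 (conjc (Y y)) Vc) (mulV V (res 0 (Y y) phi)).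

Lemma mulV_zs_L2 s y phi : 0 < y -> all_moments P phi ->
  L2 P (mulV V (res 0 (zs s y) phi)).
Proof.
move=> y0 mphi.
exact: (mulV_res_L2 tau_action V_meas V_moments lam0_gt0 H_sa (Im_zs s y0) mphi).
Qed.

Lemma Expect_second_order s y phi : 0 < y -> all_moments P phi ->
  E (mulV V (res 0 (zs s y) (mulV V (res 0 (zs s y) phi)))) =
  cj s (second_order s y phi).
Proof.
move=> y0 mphi; have LV := VpL2 VpV.
rewrite Expect_mulV_res//; last exact: mulV_zs_L2.
congr cj; case: s; rewrite /matel /second_order /zs.
- by rewrite mulV_symm.
- by rewrite (res_adj H_sa in0 (ImY y0) (mulV_zs_L2 false y0 mphi) LV).
Qed.

Lemma matel_taylor s y phi : 0 < y -> Vp phi -> osmall 1 (fun l =>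
  matel s l (Y y) Vc phi - matel s 0 (Y y) Vc phi + l%:C%C * second_order s y phi).
Proof.
move=> y0 Vphi; have mphi := Vpam Vphi; have mV := Vpam VpV.
have [C hC] : exists C : R, forall l, 0 <= l < lam0 ->
    nrm (matel s l (Y y) Vc phi - matel s 0 (Y y) Vc phi + l%:C%C * second_order s y phi)
    <= C * l ^+ 2.
  case: s => /=.
  - exact: (res_taylor tau_action V_meas V_moments lam0_gt0 H_sa (ImY y0) mV mphi).
  - exact: (res_taylor tau_action V_meas V_moments lam0_gt0 H_sa (ImY y0) mphi mV).
move=> e e0; have C1 : 0 < `|C| + 1 by rewrite ltr_wpDl.
apply: near0_mono (near0_and (near0_lt lam0_gt0) (near0_lt (divr_gt0 e0 C1))) => l lp [ll le].
have hl : 0 <= l < lam0 by rewrite ltW.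
apply: le_trans (hC l hl) _; rewrite expr2 expr1 mulrA ler_wpM2r ?(ltW lp)//.
apply: le_trans (_ : (`|C| + 1) * l <= _).
  by rewrite ler_wpM2r ?(ltW lp)// (le_trans (ler_norm C))// lerDl.
by rewrite mulrC -ler_pdivlMr// ltW.
Qed.

(** Both factors vanish at coupling 0, one because [V] is centered and the other because
    [E phi = 0]. So the pole term does not contribute to the derivative of the matrix element at
    coupling 0 and fixed [z]. *)
Lemma pairing_osmall1 s phi : Vp phi -> E phi = 0 ->
  osmall 1 (fun l => pairing s l Vc phi).
Proof.
move=> Vphi E0.
have PT t f : Vp f -> E f = 0 -> osmall 0 (fun l => Psi t l f) /\
    exists C, near0 (fun l => nrm (Psi t l f) <= C * l ^+ 1).
  move=> Vf Ef; have [a1 [a2]] := C2_scalar_taylor lam0_gt0 (Psi_C2 t Vf).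
  rewrite (Psi0_eq0 t Vf Ef) => h; split.
    by apply: osmall_near (taylor2_osmall0 h); exists 1 => // l _; rewrite subr0.
  exists (1 + nrm a1); apply: near0_mono (taylor2_osmall1 h ltr01) => l lp.
  rewrite add0r mul1r expr1 => hl; rewrite -[Psi t l f](subrK (l%:C%C * a1)).
  apply: le_trans (nrmD _ _) _.
  by rewrite mulrDl mul1r nrmM nrmR gtr0_norm// [nrm _ * l]mulrC lerD2r.
have G a b : Vp a -> Vp b -> E a = 0 -> E b = 0 ->
    osmall 1 (fun l => conjc (Psi true l a) * Psi false l b).
  move=> Va Vb Ea Eb; have [ha _] := PT true a Va Ea; have [_ hb] := PT false b Vb Eb.
  apply: osmall_near (osmallM_pow (m := 1) (n := 0) hb (osmallJ ha)).
  by exists 1 => // l _; rewrite mulrC.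
by case: s; apply: G => //; exact: EV.
Qed.

(** [pole_expansion] identifies [c1] and [c2] with values of the remainder and its derivative at
    [z = 0]; what remains is to recognise these functions on the imaginary axis as expectations of
    free resolvents. *)
Lemma main_expansion s phi : Vp phi -> exists c1 c2,
  [/\ taylor2 (fun l => pairing s l one phi) (cj s (E phi)) c1 c2,
      forall e : R, 0 < e -> near0 (fun y =>
        nrm (- E (mulV V (res 0 (zs s y) phi)) - cj s c1) < e) &
      E phi = 0 -> forall e : R, 0 < e -> near0 (fun y =>
        nrm (E (mulV V (res 0 (zs s y) (mulV V (res 0 (zs s y) phi)))) - cj s c2) < e)].
Proof.
move=> Vphi; have [c1 [c2 cT]] := pairing_taylor s Vp1 Vphi.
have [p0 r0] := pairing0 s Vphi; rewrite p0 in cT.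
have [v1 [v2 [hv1 hv2 _]]] := remainder_C2 s VpV Vphi.
have [w1 [w2 [hw1 hw2 _]]] := remainder_C2 s Vp1 Vphi.
have famA := iseg_compacts_of_disc M_gt0.
set y0 := M^-1 / 2 in famA.
have y00 : 0 < y0 by rewrite divr_gt0// invr_gt0.
have iA y : 0 <= y <= y0 -> iseg y0 (Y y) by move=> hy; exists y.
have cV l (hl : 0 <= l < lam0) := remainder_icont s hl VpV Vphi.
have cW l (hl : 0 <= l < lam0) := remainder_icont s hl Vp1 Vphi.
have cv1 := icont_deriv lam0_gt0 y00 famA hv1 cV.
have cw1 := icont_deriv lam0_gt0 y00 famA hw1 cW.
have cw2 := icont_deriv lam0_gt0 y00 famA hw2 cw1.
have [e1 e2] := pole_expansion lam0_gt0 y00 (fun l hl => pairing_identity s Vphi hl)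
  zz_small cV cW r0 cT
  (fun y hy => has_deriv_in_has_d hv1 famA (iA y hy))
  (fun y hy => has_deriv_in_has_d hw1 famA (iA y hy))
  (fun y hy => has_deriv_in_has_d hw2 famA (iA y hy))
  (cv1 0 in0) (cw1 0 in0) (cw2 0 in0).
(* Without pole term at coupling 0, the remainder there is the free matrix element. *)
have pV0 : pairing s 0 Vc phi = 0.
  rewrite /pairing; case: s {cV cW cv1 cw1 cw2 r0 cT p0 hv1 hv2 hw1 hw2 e1 e2} => /=.
    by rewrite (Psi0_eq0 false VpV EV) mulr0.
  by rewrite (Psi0_eq0 true VpV EV) conjc0 mul0r.
exists c1, c2; split => //.
- move=> e e_gt0; apply: near0_mono (cV 0 in0 e e_gt0) => y yp hy.
  rewrite Expect_mulV_res//; last exact: VpL2.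
  rewrite matel_expansion// pV0 mul0r add0r e1.
  rewrite -[X in nrm X](_ : - cj s (remainder s 0 Vc phi (Y y) - remainder s 0 Vc phi 0) = _).
    by rewrite nrmN nrm_cj; exact: hy.
  by rewrite cjB cjN opprB opprK addrC.
- move=> E0 e e_gt0; rewrite e2.
  (* [matel] and the remainder have the same derivative at coupling 0, since their difference, the
     pole term, is [o(l)]. *)
  have key y : 0 < y <= y0 -> second_order s y phi = - v1 0 (Y y).
    move=> /andP[yp yle]; have yy : 0 <= y <= y0 by rewrite (ltW yp).
    have hd := has_d_taylor1 lam0_gt0 (has_deriv_in_has_d hv1 famA (iA y yy)).
    have ht := matel_taylor s yp Vphi.
    have hq : osmall 0 (fun l => (zz l - Y y) - (- Y y)).
      apply: osmall_near (osmall_weak (leq0n 1) zz_small).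
      by exists 1 => // l _; rewrite opprK subrK.
    have Yn : - Y y != 0 by rewrite oppr_eq0 Y_neq0.
    have [_ qb] := osmallV Yn hq.
    have hp := osmallM qb (pairing_osmall1 s Vphi E0).
    apply/eqP; rewrite -subr_eq0 opprK; apply/eqP.
    apply: (@osmall_pow_cst0 _ 1).
    apply: osmall_near (osmallB (osmallB ht hp) hd).
    apply: near0_mono (near0_lt lam0_gt0) => l lp ll.
    have hl : 0 <= l < lam0 by rewrite ltW.
    rewrite !matel_expansion// pV0 mul0r add0r expr1.
    move: (remainder s l Vc phi (Y y)) (remainder s 0 Vc phi (Y y)) (v1 0 (Y y)).
    move: (second_order s y phi) (pairing s l Vc phi) ((zz l - Y y)^-1).
    by move=> S p q r r0' v; ring.
  apply: near0_mono (near0_and (near0_lt y00) (cv1 0 in0 e e_gt0)) => y yp [yy hy].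
  rewrite Expect_second_order//; last exact: Vpam.
  rewrite key ?yp ?(ltW yy)// -cjB -opprD nrm_cj.
  by rewrite nrmN; exact: hy.
Qed.

Lemma zz_identity l : 0 <= l < lam0 ->
  l%:C%C * pairing true l one Vc + l%:C%C * zz l * remainder false l Vc one 0 = zz l.
Proof.
move=> hl; have := pole_identity_at0 (pairing_identity false Vp1 hl)
  (remainder_icont false hl VpV Vp1) (remainder_icont false hl Vp1 Vp1).
by rewrite /= E1 mul1r.
Qed.

(** In [zz_identity] the term with the remainder is [O(l) o(l)]. Up to [o(l^2)] the pole is thus [l]
    times the residue at [V], which has no constant term as [E Vc = 0]. *)
Lemma zz_expansion c1 c2 :
  taylor2 (fun l => pairing true l one Vc) (cj true (E Vc)) c1 c2 ->
  osmall 2 (fun l => zz l - (l ^+ 2)%:C%C * c1).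
Proof.
rewrite EV cj0 => xT.
have lb : exists C : R, near0 (fun l => nrm (l%:C%C : R[i]) <= C * l ^+ 1).
  by exists 1, 1 => // l /andP[lp _]; rewrite nrmR gtr0_norm// expr1 mul1r.
have k1 := osmallM_pow lb (taylor2_osmall1 xT).
have [f1 [f2 [h1 _ _]]] := remainder_C2 false VpV Vp1.
have famA := iseg_compacts_of_disc M_gt0.
have A0 : iseg (M^-1 / 2) 0.
  by exists 0; rewrite ?rmorph0 ?mulr0// lexx divr_ge0// invr_ge0 ltW.
have bz := has_d_bounded0 lam0_gt0 (has_deriv_in_has_d h1 famA A0).
have k2 := osmallM_pow lb (osmallM bz zz_small).
apply: osmall_near (osmallD k1 k2); apply: near0_mono (near0_lt lam0_gt0) => l lp ll.
have hl : 0 <= l < lam0 by rewrite ltW.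
transitivity (l%:C%C * pairing true l one Vc +
  l%:C%C * zz l * remainder false l Vc one 0 - (l ^+ 2)%:C%C * c1).
  by rewrite rmorphXn /=; ring.
by rewrite zz_identity.
Qed.

Lemma pairing_lin s l (a : Cplx R) f g : 0 <= l < lam0 -> Vp f -> Vp g ->
  pairing s l one (fun w => a * f w + g w) =
  cj s a * pairing s l one f + pairing s l one g.
Proof.
move=> hl Vf Vg; case: s; rewrite /pairing /cj.
- have [h _] := Psi_dual true hl; rewrite (h a f g Vf Vg).
  by apply: complex_eq; rewrite !reimE; ring.
- by have [h _] := Psi_dual false hl; rewrite (h a f g Vf Vg); ring.
Qed.

Lemma pairing_ae s l f g : 0 <= l < lam0 -> Vp f -> Vp g -> ae_eq P setT f g ->
  pairing s l one f = pairing s l one g.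
Proof.
move=> hl Vf Vg fg; case: s; rewrite /pairing.
- by have [_ h] := Psi_dual true hl; rewrite (h f g Vf Vg fg).
- by have [_ h] := Psi_dual false hl; rewrite (h f g Vf Vg fg).
Qed.

(** [res_pair_one_adj] at coupling 0 against [V] reads [z E[V R 1] = 0] because [V] is centered.
    Consequently [pairing s l one one] has no first-order term. *)
Lemma Expect_mulV_res_one s y : 0 < y -> E (mulV V (res 0 (zs s y) one)) = 0.
Proof.
move=> y0; have hz := Im_zs s y0.
have := res_pair_one_adj V_meas V_moments H_sa in0 hz (VpL2 VpV).
rewrite EV conjc0 rmorph0 mul0r add0r inner_V => /esym/eqP.
rewrite mulf_eq0 => /orP[/eqP z0|/eqP//].
by move: hz; rewrite z0 eqxx.
Qed.

Lemma near0_cst_eq0 (c : Cplx R) : (forall e : R, 0 < e -> near0 (fun _ : R => nrm c < e)) ->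
  c = 0.
Proof.
move=> h; apply: osmall_cst0 => e e0; apply: near0_mono (h e e0) => y _ /ltW.
by rewrite expr0 mulr1.
Qed.

(** This gauge gives [Psi s] the value 1 at the constant 1 and moves the whole factor
    [pairing s l one one] to the other sign. *)
Lemma gauge_pairing (t s : bool) l phi (a : Cplx R) :
  a = (if s then (Psi true l one)^-1 else conjc (Psi false l one)) ->
  pairing s l one one != 0 ->
  gauge a t (Psi t l) phi =
  cj t (if t == s then pairing t l one phi / pairing t l one one
        else pairing t l one phi).
Proof.
move=> ->; rewrite /gauge.
have JJ (x y : R[i]) : conjc (conjc x * y) = x * conjc y by rewrite conjcM conjcK.
have JV (x : R[i]) : conjc x^-1 = (conjc x)^-1 by exact: conjc_inv.
case: t; case: s; rewrite /pairing /= mulf_eq0 negb_or => /andP[];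
  rewrite ?conjc_eq0 => n1 n2.
- rewrite /cj conjcM JV !JJ.
  have n3 : conjc (Psi false l one) != 0 :> R[i] by rewrite conjc_eq0.
  by field; rewrite n1 n3.
- by rewrite /cj JJ mulrC.
- by rewrite /cj JV invrK.
- rewrite /cj conjcK; have n3 : conjc (Psi true l one) != 0 :> R[i] by rewrite conjc_eq0.
  by field; rewrite n2 n3.
Qed.

Lemma cj_poly s l (b0 b1 b2 : Cplx R) :
  cj s (b0 + l%:C%C * b1 + (l ^+ 2)%:C%C * b2) =
  cj s b0 + l%:C%C * cj s b1 + (l ^+ 2)%:C%C * cj s b2.
Proof. by case: s => //; rewrite /cj; apply: complex_eq; rewrite !reimE; ring. Qed.

Lemma osmall_cj s n r : osmall n r -> osmall n (fun l => cj s (r l)).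
Proof. by case: s => //; exact: osmallJ. Qed.

Lemma assembly : exists (alpha beta : R) (Phi1 Phi2 : bool -> (Om -> Cplx R) -> Cplx R),
  [/\ ('i%C)^-1 * E (mulV V (res 0 ('i%C * e%:C%C) (fun w => (V w)%:C%C)))
        @[e --> (0 : R)^'+] --> ((alpha +i* beta)%C : Cplx R),
      littleo_pow 2 (fun l => zz l - (l ^+ 2)%:C%C * (beta%:C%C - 'i%C * alpha%:C%C)),
      forall s, Vdual P tau V (Phi1 s) /\ Vdual P tau V (Phi2 s),
      forall s phi, Vp phi ->
        - E (mulV V (res 0 (- (pm s * 'i%C * e%:C%C)) phi))
          @[e --> (0 : R)^'+] --> Phi1 s phi /\
        E (mulV V (res 0 (- (pm s * 'i%C * e%:C%C))
              (mulV V (res 0 (- (pm s * 'i%C * e%:C%C)) (Proj P phi)))))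
          @[e --> (0 : R)^'+] --> Phi2 s phi &
      forall s, exists a : R -> Cplx R,
        [/\ forall l, a l != 0,
            forall phi, Vp phi ->
              littleo_pow 2 (fun l => gauge (a l) s (Psi s l) phi -
                (E phi + l%:C%C * Phi1 s phi + (l ^+ 2)%:C%C * Phi2 s phi)),
            forall phi, Vp phi ->
              littleo_pow 1 (fun l => gauge (a l) (~~ s) (Psi (~~ s) l) phi -
                (E phi + l%:C%C * Phi1 (~~ s) phi)) &
            forall phi, Vp phi -> E phi = 0 ->
              littleo_pow 2 (fun l => gauge (a l) (~~ s) (Psi (~~ s) l) phi -
                (E phi + l%:C%C * Phi1 (~~ s) phi
                 + (l ^+ 2)%:C%C * Phi2 (~~ s) phi))]].
Proof.
have [c cP] : exists c : bool * (Om -> Cplx R) -> Cplx R * Cplx R, forall p, Vp p.2 ->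
  [/\ taylor2 (fun l => pairing p.1 l one p.2) (cj p.1 (E p.2)) (c p).1 (c p).2,
      forall e : R, 0 < e -> near0 (fun y =>
        nrm (- E (mulV V (res 0 (zs p.1 y) p.2)) - cj p.1 (c p).1) < e) &
      E p.2 = 0 -> forall e : R, 0 < e -> near0 (fun y =>
        nrm (E (mulV V (res 0 (zs p.1 y) (mulV V (res 0 (zs p.1 y) p.2))))
          - cj p.1 (c p).2) < e)].
  have [p|c cP] := @choice (bool * (Om -> Cplx R)) (Cplx R * Cplx R) (fun p q => Vp p.2 ->
   [/\ taylor2 (fun l => pairing p.1 l one p.2) (cj p.1 (E p.2)) q.1 q.2,
      forall e : R, 0 < e -> near0 (fun y =>
        nrm (- E (mulV V (res 0 (zs p.1 y) p.2)) - cj p.1 q.1) < e) &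
      E p.2 = 0 -> forall e : R, 0 < e -> near0 (fun y =>
        nrm (E (mulV V (res 0 (zs p.1 y) (mulV V (res 0 (zs p.1 y) p.2))))
          - cj p.1 q.2) < e)]); last by exists c.
  have [Vp2|nV] := pselect (Vp p.2); last by exists (0, 0).
  by have [c1 [c2 h]] := main_expansion p.1 Vp2; exists (c1, c2).
pose C1 s phi := (c (s, phi)).1; pose C2 s phi := (c (s, phi)).2.
have cT s phi : Vp phi ->
    taylor2 (fun l => pairing s l one phi) (cj s (E phi)) (C1 s phi) (C2 s phi).
  by move=> Vphi; have [] := cP (s, phi) Vphi.
have L1 s phi : Vp phi -> forall e : R, 0 < e -> near0 (fun y =>
    nrm (- E (mulV V (res 0 (zs s y) phi)) - cj s (C1 s phi)) < e).
  by move=> Vphi; have [] := cP (s, phi) Vphi.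
have L2' s phi : Vp phi -> E phi = 0 -> forall e : R, 0 < e -> near0 (fun y =>
    nrm (E (mulV V (res 0 (zs s y) (mulV V (res 0 (zs s y) phi)))) - cj s (C2 s phi)) < e).
  by move=> Vphi; have [] := cP (s, phi) Vphi.
have C_lin s a f g : Vp f -> Vp g ->
    C1 s (fun w => a * f w + g w) = cj s a * C1 s f + C1 s g /\
    C2 s (fun w => a * f w + g w) = cj s a * C2 s f + C2 s g.
  move=> Vf Vg; have h1 := cT s _ (Vpoly_lin a Vf Vg).
  have h2 := taylor2_lin (cj s a) (cT s _ Vf) (cT s _ Vg).
  have nr : near0 (fun l => pairing s l one (fun w => a * f w + g w) =
      cj s a * pairing s l one f + pairing s l one g).
    apply: near0_mono (near0_lt lam0_gt0) => l lp ll; apply: pairing_lin => //.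
    by rewrite ltW.
  by have [_ -> ->] := taylor2_unique nr h1 h2.
have C_ae : forall s f g, Vp f -> Vp g -> ae_eq P setT f g ->
    C1 s f = C1 s g /\ C2 s f = C2 s g.
  move=> s f g Vf Vg fg.
  have nr : near0 (fun l => pairing s l one f = pairing s l one g).
    apply: near0_mono (near0_lt lam0_gt0) => l lp ll; apply: pairing_ae => //.
    by rewrite ltW.
  by have [_ -> ->] := taylor2_unique nr (cT s _ Vf) (cT s _ Vg).
have C1one s : C1 s one = 0.
  rewrite -[LHS](cjK s) (_ : cj s (C1 s one) = 0) ?cj0//; apply: near0_cst_eq0 => e e0.
  apply: near0_mono (L1 s _ Vp1 e e0) => y yp.
  by rewrite Expect_mulV_res_one// oppr0 sub0r nrmN.
pose Phi1 s phi := cj s (C1 s phi); pose Phi2 s phi := cj s (C2 s (Proj P phi)).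
have zsE s y : - (pm s * 'i%C * y%:C%C) = zs s y :> R[i].
  by case: s; rewrite /pm /zs; apply: complex_eq; rewrite !reimE; ring.
(* [g] is the [l^2] coefficient of the pole. As it has to equal [beta - i alpha], the two real
   numbers are read off from [i g = alpha + i beta]. *)
pose g := C1 true Vc.
exists (complex.Re ('i%C * g)), (complex.Im ('i%C * g)), Phi1, Phi2.
have gE : (complex.Im ('i%C * g))%:C%C - 'i%C * (complex.Re ('i%C * g))%:C%C = g.
  by apply: complex_eq; rewrite !reimE; ring.
have projlin a f h : Vp f -> Vp h ->
    Proj P (fun w => a * f w + h w) = (fun w => a * Proj P f w + Proj P h w).
  move=> Vf Vh; apply/funext => w; rewrite /Proj.
  rewrite (Expect_lin a (L2_cint (VpL2 Vf)) (L2_cint (VpL2 Vh))); ring.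
have VpP f : Vp f -> Vp (Proj P f).
  exact: Vpoly_Proj.
(* The constant part of [phi] carries the second-order coefficient of [pairing s l one one], which
   the gauge for the sign [s] divides out. *)
have C2Proj s phi : Vp phi -> C2 s phi = C2 s (Proj P phi) + cj s (E phi) * C2 s one.
  move=> Vphi; have [_ h] := C_lin s (E phi) one (Proj P phi) Vp1 (VpP _ Vphi).
  rewrite addrC -h; congr (C2 s _); apply/funext => w.
  by rewrite mulr1 /Proj addrC subrK.
split.
- apply/cvg_at_right_nrm => e e0; apply: near0_mono (L1 true _ VpV e e0) => y yp hy.
  have -> : ((complex.Re ('i%C * g) +i* complex.Im ('i%C * g))%C : Cplx R) = 'i%C * g.
    by apply: complex_eq.
  have -> : E (mulV V (res 0 ('i%C * y%:C%C) Vc)) =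
      conjc (E (mulV V (res 0 (zs true y) Vc))).
    by have := res_conjc H_sa in0 (ImY yp) (VpL2 VpV) (VpL2 VpV); rewrite !inner_V.
  move: hy; rewrite /cj -/g; move: (E _) => W hy.
  have -> : ('i%C)^-1 * conjc W - 'i%C * g = 'i%C * conjc (- W - conjc g) :> R[i].
    have i2 : ('i%C : R[i])^-1 = - 'i%C.
      apply: (mulIf (_ : ('i%C : R[i]) != 0)).
        by apply/eqP => /(congr1 (@complex.Im R)) /eqP; rewrite /= oner_eq0.
      rewrite mulVf; last first.
        by apply/eqP => /(congr1 (@complex.Im R)) /eqP; rewrite /= oner_eq0.
      by rewrite mulNr -expr2 sqr_i opprK.
    by rewrite i2; apply: complex_eq; rewrite !reimE; ring.
  by rewrite nrmM nrmJ (_ : nrm 'i%C = 1) ?mul1r// /nrm /sqn /= expr0n expr1n add0r sqrtr1.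
- by apply/littleo_powP; rewrite gE; exact: zz_expansion (cT true _ VpV).
- move=> s; split; split.
  + move=> a f h Vf Vh; rewrite /Phi1; have [-> _] := C_lin s a f h Vf Vh.
    by rewrite cj_lin cjK.
  + by move=> f h Vf Vh fh; rewrite /Phi1; have [-> _] := C_ae s f h Vf Vh fh.
  + move=> a f h Vf Vh; rewrite /Phi2 projlin//.
    have [_ ->] := C_lin s a _ _ (VpP _ Vf) (VpP _ Vh).
    by rewrite cj_lin cjK.
  + move=> f h Vf Vh fh; rewrite /Phi2.
    have [|_ ->//] := C_ae s _ _ (VpP _ Vf) (VpP _ Vh).
    have /L2P[mf _] := VpL2 Vf; have /L2P[mh _] := VpL2 Vh.
    have eE := Expect_ae mf mh fh.
    by apply: filterS fh => w hw _; rewrite /Proj (hw I) eE.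
- move=> s phi Vphi; split; apply/cvg_at_right_nrm => e e0.
    by apply: near0_mono (L1 s _ Vphi e e0) => y yp; rewrite zsE.
  have EP := Expect_Proj tau_action V_meas V_moments Vphi.
  by apply: near0_mono (L2' s _ (VpP _ Vphi) EP e e0) => y yp; rewrite zsE.
- move=> s.
  have G1 := cT s _ Vp1; rewrite E1 cj1 C1one in G1.
  have [Gn Gb] := osmallV (oner_neq0 _) (taylor2_osmall0 G1).
  pose a0 l : Cplx R := if s then (Psi true l one)^-1 else conjc (Psi false l one).
  (* [a0 l] is 0 where [Psi s l one] is 0. This is excluded only for small positive [l], so
     elsewhere a value 0 is replaced by 1. *)
  pose a l : Cplx R := if a0 l == 0 then 1 else a0 l.
  have aE : near0 (fun l => a l = a0 l /\ pairing s l one one != 0).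
    apply: near0_mono Gn => l lp hl; split => //; rewrite /a ifF//.
    apply/negbTE; move: hl; rewrite /pairing /a0; case: (s).
      by rewrite mulf_eq0 negb_or conjc_eq0 => /andP[n1 _]; rewrite invr_eq0.
    by rewrite mulf_eq0 negb_or conjc_eq0 => /andP[_ n2]; rewrite conjc_eq0.
  exists a; split.
  + by move=> l; rewrite /a; case: ifPn => //; rewrite oner_eq0.
  + move=> phi Vphi; apply/littleo_powP; have hphi := cT s _ Vphi.
    have pT : taylor2 (fun l => cj s (E phi) + l%:C%C * C1 s phi +
        (l ^+ 2)%:C%C * C2 s (Proj P phi)) (cj s (E phi)) (C1 s phi) (C2 s (Proj P phi)).
      by apply: osmall_near (@osmall0 R 2); exists 1 => // l _; rewrite subrr.
    (* The target polynomial times [pairing s l one one] has, by [C2Proj], the same expansion as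
       [pairing s l one phi]. *)
    have := taylor2M pT G1; rewrite !mulr1 !mulr0 add0r addr0 addrC -C2Proj// => pG.
    apply: osmall_near (osmall_cj s (osmallM Gb (osmallB hphi pG))).
    apply: near0_mono aE => l lp [al n1].
    rewrite (gauge_pairing s phi al n1) eqxx /Phi1 /Phi2.
    have -> : E phi + l%:C%C * cj s (C1 s phi) + (l ^+ 2)%:C%C * cj s (C2 s (Proj P phi))
      = cj s (cj s (E phi) + l%:C%C * C1 s phi + (l ^+ 2)%:C%C * C2 s (Proj P phi)).
      by rewrite cj_poly cjK.
    rewrite -cjB; congr cj; move: n1; move: (pairing s l one one) (pairing s l one phi).
    by move=> q p qn; field.
  + move=> phi Vphi; apply/littleo_powP.
    apply: osmall_near (osmall_cj (~~ s) (taylor2_osmall1 (cT (~~ s) _ Vphi))).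
    apply: near0_mono aE => l lp [al n1].
    rewrite (gauge_pairing (~~ s) phi al n1) ifF; last by case: (s).
    by rewrite cjB /Phi1; have := cj_poly (~~ s) l (cj (~~ s) (E phi)) (C1 (~~ s) phi) 0;
      rewrite mulr0 addr0 cj0 mulr0 addr0 cjK => ->.
  + move=> phi Vphi E0; apply/littleo_powP.
    have PE : Proj P phi = phi by apply/funext => w; rewrite /Proj E0 subr0.
    apply: osmall_near (osmall_cj (~~ s) (cT (~~ s) _ Vphi)).
    apply: near0_mono aE => l lp [al n1].
    rewrite (gauge_pairing (~~ s) phi al n1) ifF; last by case: (s).
    by rewrite cjB cj_poly cjK /Phi1 /Phi2 PE.
Qed.

End Assembly.

Theorem proposition7 (R : realType) (disp : measure_display)
    (Om : measurableType disp) (P : probability Om R) (d : nat)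
    (tau : 'rV[R]_d -> Om -> Om) (V : Om -> R)
    (P_complete : measure_is_complete P)
    (tau_action : preserving_action P tau)
    (tau_meas : jointly_measurable P tau)
    (V_meas : measurable_fun setT V)
    (V_moments : forall p : nat,
       P.-integrable setT (fun w => (V w ^+ p)%:E))
    (V_centered : (\int[P]_w (V w)%:E = 0)%E)
    (Vpoly_dense : dense_in_L2 P (Vpoly tau V))
    (K : set 'rV[R]_d) (K_compact : compact K) (K_nz : ~ K 0)
    (lam0 M : R) (lam0_gt0 : 0 < lam0) (M_gt0 : 0 < M)
    (H_sa : forall k lam, K k -> 0 <= lam < lam0 ->
       op_ess_selfadjoint P (Hst P tau V k lam))
    (zz : 'rV[R]_d -> R -> Cplx R)
    (Psi : bool -> 'rV[R]_d -> R -> (Om -> Cplx R) -> Cplx R)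
    (zeta : 'rV[R]_d -> R -> (Om -> Cplx R) -> (Om -> Cplx R) ->
            Cplx R -> Cplx R)
    (zz_ball : forall k lam, K k -> 0 <= lam < lam0 ->
       `|zz k lam| <= (M^-1)%:C%C)
    (Psi_dual : forall s k lam, K k -> 0 <= lam < lam0 ->
       Vdual P tau V (Psi s k lam))
    (zz_cont : {within K `*` [set l : R | 0 <= l < lam0],
       continuous (fun p : 'rV[R]_d * R => zz p.1 p.2)})
    (Psi_cont : forall s phi, Vpoly tau V phi ->
       {within K `*` [set l : R | 0 <= l < lam0],
       continuous (fun p : 'rV[R]_d * R => Psi s p.1 p.2 phi)})
    (resolvent_expansion : forall k lam phi phi' (z : Cplx R),
       K k -> 0 <= lam < lam0 -> Vpoly tau V phi -> Vpoly tau V phi' ->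
       0 < complex.Im z ->
       inner P phi' (resolvent P tau V k lam z phi) =
         (conjc (Psi true k lam phi') : Cplx R) * Psi false k lam phi
           / (zz k lam - z) + zeta k lam phi' phi z)
    (zeta_holo : forall k lam phi phi' (z : Cplx R),
       K k -> 0 <= lam < lam0 -> Vpoly tau V phi -> Vpoly tau V phi' ->
       0 < complex.Im z \/ disc M z -> derivable (zeta k lam phi' phi) z 1)
    (zeta_cont : forall phi phi' (z : Cplx R),
       Vpoly tau V phi -> Vpoly tau V phi' -> 0 < complex.Im z \/ disc M z ->
       {within K `*` [set l : R | 0 <= l < lam0],
       continuous (fun p : 'rV[R]_d * R => zeta p.1 p.2 phi' phi z)})
    (zz_C2 : forall k, K k -> C2_scalar lam0 (zz k))
    (Psi_C2 : forall s k phi, K k -> Vpoly tau V phi ->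
       C2_scalar lam0 (fun l => Psi s k l phi))
    (zeta_C2 : forall k phi phi', K k -> Vpoly tau V phi -> Vpoly tau V phi' ->
       C2_in (compacts_of_disc M) lam0 (fun l => zeta k l phi' phi)) :
  forall k, K k ->
  exists (alpha beta : R) (Phi1 Phi2 : bool -> (Om -> Cplx R) -> Cplx R),
  [/\ ('i%C)^-1 * Expect P (mulV V (resolvent P tau V k 0 ('i%C * e%:C%C)
                                      (fun w => (V w)%:C%C)))
        @[e --> (0 : R)^'+] --> ((alpha +i* beta)%C : Cplx R),
      littleo_pow 2 (fun l =>
        zz k l - (l ^+ 2)%:C%C * (beta%:C%C - 'i%C * alpha%:C%C)),
      forall s, Vdual P tau V (Phi1 s) /\ Vdual P tau V (Phi2 s),
      forall s phi, Vpoly tau V phi ->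
        - Expect P (mulV V
            (resolvent P tau V k 0 (- (pm s * 'i%C * e%:C%C)) phi))
          @[e --> (0 : R)^'+] --> Phi1 s phi /\
        Expect P (mulV V
            (resolvent P tau V k 0 (- (pm s * 'i%C * e%:C%C))
              (mulV V
                (resolvent P tau V k 0 (- (pm s * 'i%C * e%:C%C))
                  (Proj P phi)))))
          @[e --> (0 : R)^'+] --> Phi2 s phi &
      forall s, exists a : R -> Cplx R,
        [/\ forall l, a l != 0,
            forall phi, Vpoly tau V phi ->
              littleo_pow 2 (fun l => gauge (a l) s (Psi s k l) phi -
                (Expect P phi + l%:C%C * Phi1 s phi
                 + (l ^+ 2)%:C%C * Phi2 s phi)),
            forall phi, Vpoly tau V phi ->
              littleo_pow 1 (fun l => gauge (a l) (~~ s) (Psi (~~ s) k l) phi -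
                (Expect P phi + l%:C%C * Phi1 (~~ s) phi)) &
            forall phi, Vpoly tau V phi -> Expect P phi = 0 ->
              littleo_pow 2 (fun l => gauge (a l) (~~ s) (Psi (~~ s) k l) phi -
                (Expect P phi + l%:C%C * Phi1 (~~ s) phi
                 + (l ^+ 2)%:C%C * Phi2 (~~ s) phi))]].
Proof.
move=> k Kk.
have sa (lam : R) : 0 <= lam < lam0 -> op_selfadjoint P (op_closure P (Hst P tau V k lam)).
  by move=> hl; have [] := H_sa k lam Kk hl.
apply: (@assembly _ _ _ P d tau tau_action V V_meas V_moments V_centered k lam0 M
  lam0_gt0 M_gt0 sa (zz k) (fun s => Psi s k) (zeta k)).
- by move=> s lam; exact: Psi_dual.
- by move=> lam phi phi' z; exact: resolvent_expansion.
- move=> lam phi phi' hl Vphi Vphi'; apply: zeta_holo => //; right.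
  by rewrite /disc /= normr0 ltcR invr_gt0.
- by move=> s phi; exact: Psi_C2.
- by move=> phi phi'; exact: zeta_C2.
Qed.
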